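(* Let $\beta>1$ and let $\{X_n\}_{n\in\mathbb N}$ ($\mathbb N=\{0,1,2,\dots\}$) be random variables bounded from below, with $X_n\in L_G^\beta(\Omega_n)$ for every $n$ and $\hat{\mathbb E}[\sup_{n\in\mathbb N}|X_n|^\beta]<\infty$. For each $N\in\mathbb N$ define $\tilde V^N_N=X_N$ and $\tilde V^N_n=\max\{X_n,\hat{\mathbb E}_n[\tilde V^N_{n+1}]\}$ for $n\le N-1$, and let $\tilde V_n^\infty=\lim_{N\ge n,\,N\to\infty}\tilde V_n^N$ (an increasing limit). Let $\mathcal T_0$ be the collection of all $G$-stopping times $\tau$ taking values in $\{0,1,2,\dots\}$ with $\lim_{N\to\infty}c(\tau>N)=0$, and set $\tilde V_0=\sup_{\tau\in\mathcal T_0}\hat{\mathbb E}[X_\tau]$. Then $$\tilde V_0=\tilde V_0^\infty .$$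
   Context: Framework. Fix $0\le\underline\sigma\le\bar\sigma<\infty$ and $G(a)=\frac12(\bar\sigma^2a^+-\underline\sigma^2a^-)$. $\Omega=C_0([0,\infty);\mathbb R)$ is the space of continuous paths starting at $0$ (locally uniform topology, Borel $\sigma$-field $\mathcal B(\Omega)$), $B$ the canonical process, $\Omega_t=\{\omega_{\cdot\wedge t}:\omega\in\Omega\}$. $L_{ip}(\Omega_t)=\{\varphi(B_{t_1},\dots,B_{t_m}): m\ge1,\ t_i\in[0,t],\ \varphi \text{ bounded Lipschitz}\}$, $L_{ip}(\Omega)=\bigcup_tL_{ip}(\Omega_t)$. $\hat{\mathbb E}$ is the $G$-expectation, with conditional $G$-expectations $\hat{\mathbb E}_t$: for $X=\varphi(B_{t_1},B_{t_2}-B_{t_1},\dots,B_{t_m}-B_{t_{m-1}})$ one sets $\hat{\mathbb E}_{t_j}[X]=\varphi_j(B_{t_1},\dots,B_{t_j}-B_{t_{j-1}})$, where $\varphi_m=\varphi$ and $\varphi_{i-1}(x_1,\dots,x_{i-1})=u(t_i-t_{i-1},0)$ with $u$ the viscosity solution of $\partial_tu=G(\partial^2_{yy}u)$, $u(0,y)=\varphi_i(x_1,\dots,x_{i-1},y)$; $\hat{\mathbb E}=\hat{\mathbb E}_0$. $L_G^p(\Omega_t)$ is the completion of $L_{ip}(\Omega_t)$ under $\hat{\mathbb E}[|\cdot|^p]^{1/p}$, and $\hat{\mathbb E}_t$ is extended continuously to $L_G^1(\Omega)$. $\mathcal P$ is the weakly compact set of all probability measures $P$ on $\Omega$ with $E^P[X]\le\hat{\mathbb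 E}[X]$ for all $X\in L_{ip}(\Omega)$; it represents $\hat{\mathbb E}$, and for Borel $X$ such that $E^P[X]$ exists for all $P\in\mathcal P$ one sets $\hat{\mathbb E}[X]=\sup_{P\in\mathcal P}E^P[X]$. $c(A)=\sup_{P\in\mathcal P}P(A)$; ''q.s.'' means outside a set of capacity $c$ zero. Relations between random variables are q.s. $L_G^{1^*}(\Omega_t)$ is the set of $\mathcal B(\Omega_t)$-measurable $X$ with $\hat{\mathbb E}[|X|]<\infty$ for which there is $\{X_n\}\subset L_G^1(\Omega_t)$ with $X_n\downarrow X$ q.s. A random time $\tau:\Omega\to[0,\infty)$ is a $G$-stopping time if $I_{\{\tau\le t\}}\in L_G^{1^*}(\Omega_t)$ for each $t\ge0$. $X_\tau$ denotes $\omega\mapsto X_{\tau(\omega)}(\omega)$. *)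

(* Defs.v *)
From HB Require Import structures.
From mathcomp Require Import all_boot all_order all_algebra.
From mathcomp Require Import all_classical all_reals all_analysis.

Set Implicit Arguments.
Unset Strict Implicit.
Unset Printing Implicit Defensive.

Import Order.TTheory GRing.Theory Num.Theory.
Import numFieldNormedType.Exports.

Local Open Scope classical_set_scope.
Local Open Scope ring_scope.

(* A path on [0, +oo) starting at 0 is encoded by its extension by 0 to the
   negative half-line; the topology of uniform convergence on compact sets of R
   then restricts to the locally uniform topology of C_0([0, +oo); R). *)
Definition C0_paths (R : realType) : set {family compact, R -> R} :=
  [set w | continuous (w : R -> R) /\ forall t : R, t <= 0 -> w t = 0].

Definition path_space (R : realType) : Type := set_type (@C0_paths R).

HB.instance Definition _ (R : realType) :=
  Topological.copy (path_space R) (set_type (@C0_paths R)).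

Lemma C0_paths_cst0 (R : realType) : C0_paths (fun _ : R => 0).
Proof. by split=> // t; exact: cst_continuous. Qed.

HB.instance Definition _ (R : realType) := isPointed.Build (path_space R)
  (exist _ (fun _ : R => 0) (mem_set (C0_paths_cst0 R))).

Definition Omega (R : realType) :=
  g_sigma_algebraType (@open (path_space R)).

HB.instance Definition _ (R : realType) := Measurable.on (Omega R).

Definition B (R : realType) (t : R) (w : Omega R) : R :=
  (set_val (w : set_type (@C0_paths R)) : R -> R) t.

Lemma stop_subproof (R : realType) (t : R) (w : Omega R) :
  C0_paths (fun s : R => B (Num.min s t) w).
Proof.
have [cw w0] : @C0_paths R (fun s : R => B s w) := set_valP w.
split=> [s | s s0]; last by apply: w0; rewrite ge_min s0.
apply: (@continuous_comp _ _ _ (fun r : R => Num.min r t)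
  (fun r : R => B r w)); last exact: cw.
by apply: continuous_min; [exact: cvg_id | exact: cvg_cst].
Qed.

(* the stopped path w(. /\ t); its range is Omega_t *)
Definition stop (R : realType) (t : R) (w : Omega R) : Omega R :=
  exist _ (fun s : R => B (Num.min s t) w) (mem_set (stop_subproof t w)).

(* B(Omega_t)-measurability of a random variable defined on Omega *)
Definition adapted (R : realType) (t : R) (X : Omega R -> R) : Prop :=
  forall A : set R, measurable A ->
    preimage_set_system setT (@stop R t) measurable (X @^-1` A).

Definition Gfun (R : realType) (sl su : R) (a : R) : R :=
  2^-1 * (su ^+ 2 * Num.max a 0 - sl ^+ 2 * Num.max (- a) 0).

Definition dt (R : realType) (psi : R -> R -> R) (t y : R) : R :=
  derive1 (psi ^~ y) t.
Definition dy (R : realType) (psi : R -> R -> R) (t y : R) : R :=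
  derive1 (psi t) y.
Definition dyy (R : realType) (psi : R -> R -> R) (t y : R) : R :=
  derive1n 2 (psi t) y.

(* [psi] is of class C^{1,2} on (0, +oo) x R *)
Definition test_function (R : realType) (psi : R -> R -> R) : Prop :=
  forall t y : R, 0 < t ->
  [/\ derivable (psi ^~ y) t 1, derivable (psi t) y 1
    & derivable (derive1 (psi t)) y 1] /\
  [/\ {for (t, y), continuous (fun z : R * R => psi z.1 z.2)},
      {for (t, y), continuous (fun z : R * R => dt psi z.1 z.2)},
      {for (t, y), continuous (fun z : R * R => dy psi z.1 z.2)}
    & {for (t, y), continuous (fun z : R * R => dyy psi z.1 z.2)}].

Definition viscosity_subsolution (R : realType) (sl su : R)
    (u : R -> R -> R) : Prop :=
  forall (psi : R -> R -> R) (t y : R), 0 < t -> test_function psi ->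
  (\forall z \near (t, y), u z.1 z.2 - psi z.1 z.2 <= u t y - psi t y) ->
  dt psi t y <= Gfun sl su (dyy psi t y).

Definition viscosity_supersolution (R : realType) (sl su : R)
    (u : R -> R -> R) : Prop :=
  forall (psi : R -> R -> R) (t y : R), 0 < t -> test_function psi ->
  (\forall z \near (t, y), u t y - psi t y <= u z.1 z.2 - psi z.1 z.2) ->
  Gfun sl su (dyy psi t y) <= dt psi t y.

(* [u] is the viscosity solution of u_t = G(u_yy), u(0, .) = f, on
   [0, +oo) x R (the values [u t y] with t < 0 are irrelevant). As [f] is bounded
   in all uses, uniqueness is understood among bounded continuous functions:
   without a growth condition it fails. *)
Definition G_heat_solution (R : realType) (sl su : R) (f : R -> R)
    (u : R -> R -> R) : Prop :=
  [/\ {within [set z : R * R | 0 <= z.1], continuous (fun z => u z.1 z.2)},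
      exists M : R, forall t y : R, 0 <= t -> `|u t y| <= M,
      forall y : R, u 0 y = f y,
      viscosity_subsolution sl su u
    & viscosity_supersolution sl su u].

(* the Lipschitz condition is stated for the l^1 norm of R^n *)
Definition bounded_lipschitz (R : realType) (n : nat)
    (phi : n.-tuple R -> R) : Prop :=
  (exists M : R, forall x, `|phi x| <= M) /\
  (exists K : R, forall x y,
     `|phi x - phi y| <= K * \sum_(i < n) `|tnth x i - tnth y i|).

Definition Lip (R : realType) (t : R) (X : Omega R -> R) : Prop :=
  exists (m : nat) (s : 'I_m -> R) (phi : m.-tuple R -> R),
  [/\ (0 < m)%N, forall i, 0 <= s i <= t, bounded_lipschitz phi
    & X = fun w => phi [tuple B (s i) w | i < m]].

(* (B_{s_1} - B_{s_0}, ..., B_{s_m} - B_{s_{m-1}}) *)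
Definition increments (R : realType) (s : nat -> R) (m : nat) (w : Omega R) :
    m.-tuple R :=
  [tuple B (s i.+1) w - B (s i) w | i < m].

(* [Lip_cond_exp sl su t X Y]: X = phi_m(B_{s_1}, ..., B_{s_m} - B_{s_{m-1}})
   with phi_m bounded Lipschitz and s_0 = 0, and Y = E_t[X] is computed with
   t = s_j by the backward recursion
   phi_i(x_1, ..., x_i) = u(s_{i+1} - s_i, 0), where u solves the G-heat equation
   with u(0, y) = phi_{i+1}(x_1, ..., x_i, y). *)
Definition Lip_cond_exp (R : realType) (sl su : R) (t : R)
    (X Y : Omega R -> R) : Prop :=
  exists (m j : nat) (s : nat -> R) (phi : forall i : nat, i.-tuple R -> R),
  [/\ (0 < m)%N, (j <= m)%N, s 0%N = 0,
      forall i, (i < m)%N -> s i <= s i.+1 & bounded_lipschitz (phi m)] /\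
  [/\ X = (fun w => phi m (increments s m w)),
      forall i, (i < m)%N -> forall x : i.-tuple R,
        exists2 u : R -> R -> R,
          G_heat_solution sl su (fun y => phi i.+1 (rcons_tuple x y)) u
          & phi i x = u (s i.+1 - s i) 0,
      t = s j & Y = (fun w => phi j (increments s j w))].

(* E[X] = E_0[X] = e for X in L_ip(Omega) *)
Definition Lip_exp (R : realType) (sl su : R) (X : Omega R -> R) (e : R) :=
  Lip_cond_exp sl su 0 X (fun _ => e).

Definition PG (R : realType) (sl su : R) : set (probability (Omega R) R) :=
  [set P | forall (X : Omega R -> R) (e : R), Lip_exp sl su X e ->
     (\int[P]_w (X w)%:E <= e%:E)%E].

Definition Ehat (R : realType) (sl su : R) (X : Omega R -> \bar R) : \bar R :=
  ereal_sup [set (\int[P]_w X w)%E | P in PG sl su].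

Definition capacity (R : realType) (sl su : R) (A : set (Omega R)) : \bar R :=
  ereal_sup [set P A | P in PG sl su].

Definition quasi_surely (R : realType) (sl su : R) (Q : Omega R -> Prop) :
    Prop :=
  exists A : set (Omega R),
    [/\ measurable A, capacity sl su A = 0%E & forall w, ~ A w -> Q w].

Definition normG (R : realType) (sl su p : R) (X : Omega R -> R) : \bar R :=
  poweR (Ehat sl su (fun w => (`|X w| `^ p)%:E)) p^-1.

(* elements of the completion are represented by Borel functions *)
Definition LG (R : realType) (sl su p t : R) (X : Omega R -> R) : Prop :=
  measurable_fun setT X /\
  exists xi : nat -> Omega R -> R,
    (forall k, Lip t (xi k)) /\
    normG sl su p (fun w => xi k w - X w) @[k --> \oo] --> 0%E.

(* [cond_exp sl su t X Y]: X is in L_G^1(Omega) and Y is a version of E_t[X],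
   the extension by continuity of E_t from L_ip(Omega) *)
Definition cond_exp (R : realType) (sl su t : R) (X Y : Omega R -> R) : Prop :=
  [/\ measurable_fun setT X, measurable_fun setT Y
    & exists xi eta : nat -> Omega R -> R,
      [/\ forall k, Lip_cond_exp sl su t (xi k) (eta k),
          normG sl su 1 (fun w => xi k w - X w) @[k --> \oo] --> 0%E
        & normG sl su 1 (fun w => eta k w - Y w) @[k --> \oo] --> 0%E]].

Definition LG1star (R : realType) (sl su t : R) (X : Omega R -> R) : Prop :=
  [/\ adapted t X, (Ehat sl su (fun w => `|X w|%:E) < +oo)%E
    & exists Xk : nat -> Omega R -> R,
      (forall k, LG sl su 1 t (Xk k)) /\
      quasi_surely sl su (fun w =>
        nonincreasing_seq (Xk ^~ w) /\ Xk k w @[k --> \oo] --> X w)].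

Definition G_stopping_time (R : realType) (sl su : R) (tau : Omega R -> R) :
    Prop :=
  (forall w, 0 <= tau w) /\
  forall t : R, 0 <= t -> LG1star sl su t (\1_[set w | tau w <= t]).

Definition T0 (R : realType) (sl su : R) : set (Omega R -> nat) :=
  [set tau | G_stopping_time sl su (fun w => (tau w)%:R) /\
     capacity sl su [set w | (N < tau w)%N] @[N --> \oo] --> 0%E].

Definition V0 (R : realType) (sl su : R) (X : nat -> Omega R -> R) : \bar R :=
  ereal_sup [set Ehat sl su (fun w => (X (tau w) w)%:E) | tau in T0 sl su].

(* [V N n] is (a version of) the finite-horizon value V^N_n, n <= N *)
Definition finite_horizon_value (R : realType) (sl su : R)
    (X : nat -> Omega R -> R) (V : nat -> nat -> Omega R -> R) : Prop :=
  forall N : nat,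
    quasi_surely sl su (fun w => V N N w = X N w) /\
    forall n : nat, (n < N)%N ->
      exists2 Y : Omega R -> R, cond_exp sl su n%:R (V N n.+1) Y
        & quasi_surely sl su (fun w => V N n w = Num.max (X n w) (Y w)).

(* Main.v *)
(* Discretise the G-heat equation by the monotone scheme
   S f y = max_(s in {sl, su}) (f (y + s r) + f (y - s r)) / 2 with r = 2^-n and
   time step r^2. Comparing viscosity sub- and supersolutions with mollified
   iterates of S shows that S^j f converges to any bounded solution, so the
   conditional G-expectation of a cylinder function is the limit of the
   conditional upper expectations of a binary random walk whose volatility is
   controlled by its past. An ultrafilter limit of the expectations under given
   strategies is finitely additive, satisfies a fourth moment bound on increments
   and hence is realised by a probability on path space, which lies in PG. Thus
   strategies which are optimal for the walk yield measures in PG which nearly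
   attain finitely many conditional G-expectations simultaneously.

   Upper bound: if P is in PG, then E^P[Z (xi - E_t[xi])] <= 0 for every
   nonnegative cylinder function Z at time t, because the G-expectation of
   Z (xi - E_t[xi]) is 0; passing to limits, the process V^N stopped at a
   G-stopping time is a P-supermartingale that dominates X, and
   E^P[X_(tau /\ N)] tends to E^P[X_tau] by dominated convergence.

   Lower bound: V^N is nearly a Q-martingale up to the first time tau at which it
   equals X, for a suitable Q in PG. Replacing V^N_n - X_n by a version that
   depends only on the path stopped at n makes the indicator of {tau <= n} a
   pointwise decreasing limit of elements of L_G^1(Omega_n). *)

Require Import Defs.
From mathcomp Require Import all_boot all_order all_algebra.
From mathcomp Require Import all_classical all_reals all_analysis.
From mathcomp Require Import measurable_realfun.
From mathcomp Require Import ring lra.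

Set Implicit Arguments.
Unset Strict Implicit.
Unset Printing Implicit Defensive.

Import Order.TTheory GRing.Theory Num.Theory.
Import numFieldNormedType.Exports.

Local Open Scope classical_set_scope.
Local Open Scope ring_scope.

(** * Mollification *)

(** The solutions [u] are handed over by [Lip_cond_exp], and nothing is known of them beyond
    continuity, boundedness and the viscosity inequalities. The obstacle is the cost of
    mollification: it is of order [e] each time, while the number of steps tends to infinity.
    Mollification is monotone and commutes with the linear averages [avg2], so the mollified maximum
    dominates the maximum of the mollified averages. This one-sided relation carries upper bounds of
    [u] through all steps at a cost paid only at both ends. For bounds of the scheme by [u] it
    points the wrong way; there the volatility is frozen on blocks of steps ([coarse]), and the cost
    is paid once per block, the length of the blocks being fixed before the mesh is refined. For the
    lower bound one measure must serve all dates [k < N] at once. The strategy is therefore taken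
    optimal for the sum over all dates of [V_(k+1) - E_k[V_(k+1)]]. On the event [tau <= k] these
    differences have nonpositive expectation under every measure of [PG], so if the whole sum is
    nearly 0, what happens before [tau] loses almost nothing. *)

Lemma exists_antiderivative (R : realType) (f : R -> R) :
  continuous f -> exists F : R -> R, forall y, is_derive y (1 : R) F (f y).
Proof.
move=> cf.
pose I a b := \int[@lebesgue_measure R]_(x in `[a, b]) f x.
have itf a b : (@lebesgue_measure R).-integrable `[a, b] (EFin \o f).
  apply: continuous_compact_integrable; first exact: segment_compact.
  exact: continuous_subspaceT.
have IB a x b : a <= x -> x <= b -> I a b - I a x = I x b.
  move=> ax xb; rewrite /I Rintegral_itvB ?bnd_simp//.
  by rewrite Rintegral_itv_obnd_cbnd//; apply: integrableS (itf x b) => //;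
    apply: subset_itvr; rewrite bnd_simp.
pose F y := if 0 <= y then I 0 y else - I y 0.
exists F => y.
(* A base point to the left of both [y] and [0] merges the two cases of [F] near [y] into one
   integral with fixed lower end. *)
pose a := Num.min y 0 - 1.
have ay : a < y by rewrite /a; have := ge_min y y 0; rewrite lexx /=; lra.
have a0 : a <= 0 by rewrite /a; have := ge_min 0 y 0; rewrite lexx orbT /=; lra.
have FE z : a <= z -> F z = I a z - I a 0.
  move=> az; rewrite /F; case: (leP 0 z) => z0; first by rewrite IB.
  by rewrite -(IB a z 0)//; lra.
have [dI I'] : derivable (fun z => I a z) y 1 /\ derive1 (fun z => I a z) y = f y.
  by apply: (@continuous_FTC1_closed _ _ _ _ (y + 1)) => //; [lra | exact: cf].
apply: (@near_eq_is_derive _ _ _ (fun z => I a z - I a 0)).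
  near=> z; rewrite FE//; near: z.
  apply: filterS (lt_nbhsr ay) => z; exact: ltW.
rewrite -[f y]subr0; apply: is_deriveB.
by rewrite -I' derive1E; exact: derivableP.
Unshelve. all: by end_near. Qed.

Lemma is_derive_translate (R : realType) (f : R -> R) (x a d : R) :
  is_derive (x + a) (1 : R) f d -> is_derive x (1 : R) (fun y => f (y + a)) d.
Proof.
move=> df; rewrite -[d]mulr1.
apply: (@is_derive1_comp _ f (fun y => y + a)).
by apply: is_derive_eq; rewrite addr0.
Qed.

Lemma is_derive_continuous (R : realType) (f : R -> R) (x d : R) :
  is_derive x (1 : R) f d -> {for x, continuous f}.
Proof. by case=> df _; apply: differentiable_continuous; apply/derivable1_diffP. Qed.

Lemma ge0_is_derive_le (R : realType) (f f1 : R -> R) (a b : R) : a <= b ->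
  (forall x, is_derive x (1 : R) f (f1 x)) ->
  (forall x, a <= x <= b -> 0 <= f1 x) -> f a <= f b.
Proof.
move=> ab df f10.
have cf : {within `[a, b], continuous f}.
  by apply: continuous_subspaceT => x; exact: is_derive_continuous (df x).
have [c] := @MVT_segment R f f1 a b ab (fun x _ => df x) cf.
rewrite in_itv /= => cab e; rewrite -subr_ge0 e mulr_ge0 ?f10//.
by rewrite subr_ge0.
Qed.

Definition C2 (R : realType) (g g1 g2 : R -> R) : Prop :=
  (forall y, is_derive y (1 : R) g (g1 y)) /\
  (forall y, is_derive y (1 : R) g1 (g2 y)).

Definition diff2 (R : realType) (e : R) (f : R -> R) (y : R) : R :=
  f (y + 2 * e) - 2 * f (y + e) + f y.

Lemma is_derive_quad (R : realType) (c x : R) :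
  is_derive x (1 : R) (fun z : R => c / 2 * z ^+ 2) (c * x).
Proof.
apply: is_derive_eq; rewrite /GRing.scale /= ?mulr1 ?expr1; by field.
Qed.

Lemma is_derive_lin (R : realType) (c x : R) :
  is_derive x (1 : R) (fun z : R => c * z) c.
Proof. by apply: is_derive_eq; rewrite /GRing.scale /= mulr1. Qed.

Lemma C2B (R : realType) (f f1 f2 g g1 g2 : R -> R) :
  C2 f f1 f2 -> C2 g g1 g2 ->
  C2 (fun y => f y - g y) (fun y => f1 y - g1 y) (fun y => f2 y - g2 y).
Proof. by move=> [fa fb] [ga gb]; split=> y; exact: is_deriveB. Qed.

Lemma C2D (R : realType) (f f1 f2 g g1 g2 : R -> R) :
  C2 f f1 f2 -> C2 g g1 g2 ->
  C2 (fun y => f y + g y) (fun y => f1 y + g1 y) (fun y => f2 y + g2 y).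
Proof. by move=> [fa fb] [ga gb]; split=> y; exact: is_deriveD. Qed.

Lemma C2Z (R : realType) (c : R) (f f1 f2 : R -> R) : C2 f f1 f2 ->
  C2 (fun y => c * f y) (fun y => c * f1 y) (fun y => c * f2 y).
Proof. by move=> [fa fb]; split=> y; exact: is_deriveZ. Qed.

Lemma C2_translate (R : realType) (a : R) (f f1 f2 : R -> R) : C2 f f1 f2 ->
  C2 (fun y => f (y + a)) (fun y => f1 (y + a)) (fun y => f2 (y + a)).
Proof. by move=> [fa fb]; split=> y; exact: is_derive_translate. Qed.

Lemma C2_quad (R : realType) (c : R) :
  C2 (fun z : R => c / 2 * z ^+ 2) (fun z => c * z) (fun=> c).
Proof. by split=> y; [exact: is_derive_quad | exact: is_derive_lin]. Qed.

Lemma diff2_ge0 (R : realType) (g g1 g2 : R -> R) (e y : R) : 0 <= e ->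
  C2 g g1 g2 -> (forall z, y <= z <= y + 2 * e -> 0 <= g2 z) ->
  0 <= diff2 e g y.
Proof.
move=> e0 [dg dg1] g20.
suff : g (y + e) - g y <= g (y + e + e) - g (y + e).
  by rewrite /diff2 (_ : y + 2 * e = y + e + e); [lra | ring].
apply: (@ge0_is_derive_le _ (fun z => g (z + e) - g z)
  (fun z => g1 (z + e) - g1 z)); first lra.
  by move=> x; apply: is_deriveB; exact: is_derive_translate.
move=> x xy; rewrite subr_ge0.
apply: (@ge0_is_derive_le _ g1 g2) => //; first lra.
by move=> z zx; apply: g20; lra.
Qed.

(** The second difference of [c / 2 * z ^+ 2] is exactly [c * e ^+ 2], so both bounds reduce to
    [diff2_ge0] for the difference with a parabola. *)
Lemma diff2_bounds (R : realType) (g g1 g2 : R -> R) (e y lo hi : R) : 0 <= e ->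
  C2 g g1 g2 -> (forall z, y <= z <= y + 2 * e -> lo <= g2 z <= hi) ->
  lo * e ^+ 2 <= diff2 e g y <= hi * e ^+ 2.
Proof.
move=> e0 dg b; apply/andP; split.
  have := diff2_ge0 e0 (C2B dg (C2_quad lo)) (y := y).
  rewrite /diff2 => /(_ _)/wrap[z /b|]; lra.
have := diff2_ge0 e0 (C2B (C2_quad hi) dg) (y := y).
rewrite /diff2 => /(_ _)/wrap[z /b|]; lra.
Qed.

Definition lipschitz_with (R : realType) (K : R) (f : R -> R) : Prop :=
  forall x y, `|f x - f y| <= K * `|x - y|.

Lemma lipschitz_with_continuous (R : realType) (K : R) (f : R -> R) :
  lipschitz_with K f -> continuous f.
Proof.
move=> lf x; apply/cvgrPdist_le => /= e e0.
have K0 : 0 < `|K| + 1 by have := normr_ge0 K; lra.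
near=> y; apply: (le_trans (lf x y)).
apply: (@le_trans _ _ ((`|K| + 1) * `|x - y|)).
  by apply: ler_wpM2r => //; have := ler_norm K; lra.
rewrite mulrC -ler_pdivlMr//; near: y.
by apply: cvgr_dist_le; rewrite ?divr_gt0.
Unshelve. all: by end_near. Qed.

(** Since [F'' = f], the quotient is the average of [f] over [[y, y + 2 e]] against a triangular
    kernel (a box of width [e] applied twice). Written with a second antiderivative, it is visibly
    of class C^2 with second derivative [moll2 e f]. *)
Definition moll (R : realType) (e : R) (f g : R -> R) : Prop :=
  exists F F1, C2 F F1 f /\ forall y, g y = diff2 e F y / e ^+ 2.

Definition moll2 (R : realType) (e : R) (f : R -> R) (y : R) : R :=
  diff2 e f y / e ^+ 2.

Definition avg2 (R : realType) (a : R) (f : R -> R) (y : R) : R :=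
  (f (y + a) + f (y - a)) / 2.

Section Mollification.
Variables (R : realType) (e : R).
Hypothesis e0 : 0 < e.
Implicit Types (f g F : R -> R) (K : R).

Lemma moll_exists f : continuous f -> exists g, moll e f g.
Proof.
move=> cf; have [F1 dF1] := exists_antiderivative cf.
have [F dF] : exists F, forall y, is_derive y (1 : R) F (F1 y).
  by apply: exists_antiderivative => x; exact: is_derive_continuous (dF1 x).
by exists (fun y => diff2 e F y / e ^+ 2), F, F1.
Qed.

Lemma moll_C2 f g : moll e f g -> exists g1, C2 g g1 (moll2 e f).
Proof.
move=> [F [F1 [dF gE]]].
have -> : g = fun y => e ^- 2 * ((F (y + 2 * e) - 2 * F (y + e)) + F y).
  by apply/funext => y; rewrite gE mulrC.
have -> : moll2 e f = fun y => e ^- 2 * ((f (y + 2 * e) - 2 * f (y + e)) + f y).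
  by apply/funext => y; rewrite /moll2 mulrC.
exists (fun y => e ^- 2 * ((F1 (y + 2 * e) - 2 * F1 (y + e)) + F1 y)).
apply: C2Z; apply: C2D => //; apply: C2B; first exact: C2_translate.
by apply: C2Z; exact: C2_translate.
Qed.

Lemma moll_close K f g : 0 <= K -> lipschitz_with K f -> moll e f g ->
  forall y, `|g y - f y| <= 2 * K * e.
Proof.
move=> K0 lf [F [F1 [dF gE]]] y.
have e2 : 0 < e ^+ 2 by rewrite exprn_gt0.
have b z : y <= z <= y + 2 * e -> f y - 2 * K * e <= f z <= f y + 2 * K * e.
  move=> zy; have := lf z y; rewrite (ger0_norm (_ : 0 <= z - y)); last lra.
  have : K * (z - y) <= 2 * K * e by rewrite -mulrA mulrCA mulrA mulrC; nra.
  by rewrite ler_norml; lra.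
have /andP[] := diff2_bounds (ltW e0) dF b.
rewrite -ler_pdivlMr// => b1; rewrite -(ler_pdivrMr _ _ e2) => b2.
by rewrite gE ler_norml; lra.
Qed.

Lemma moll2_bound K f : lipschitz_with K f ->
  forall y, `|moll2 e f y| <= 2 * K / e.
Proof.
move=> lf y; rewrite /moll2 /diff2 normrM normrV ?unitfE ?gt_eqF ?exprn_gt0//.
rewrite (ger0_norm (_ : 0 <= e ^+ 2)) ?sqr_ge0//.
rewrite ler_pdivrMr ?exprn_gt0// (_ : _ * e ^+ 2 = K * e + K * e); last first.
  by field; rewrite gt_eqF.
have := lf (y + 2 * e) (y + e); have := lf (y + e) y.
rewrite (_ : y + e - y = e); last ring.
rewrite (_ : y + 2 * e - (y + e) = e); last ring.
by rewrite (gtr0_norm e0) !ler_norml; lra.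
Qed.

Lemma moll2_lip K f : lipschitz_with K f ->
  lipschitz_with (4 * K / e ^+ 2) (moll2 e f).
Proof.
move=> lf x y; rewrite /moll2 -mulrBl normrM normrV ?unitfE ?gt_eqF ?exprn_gt0//.
rewrite (ger0_norm (_ : 0 <= e ^+ 2)) ?sqr_ge0//.
rewrite mulrAC ler_pM2r ?invr_gt0 ?exprn_gt0//.
have := lf (x + 2 * e) (y + 2 * e); have := lf (x + e) (y + e); have := lf x y.
rewrite (_ : x + e - (y + e) = x - y); last ring.
rewrite (_ : x + 2 * e - (y + 2 * e) = x - y); last ring.
by rewrite /diff2 !ler_norml; lra.
Qed.

Lemma moll_le f f' g g' : (forall y, f y <= f' y) -> moll e f g -> moll e f' g' ->
  forall y, g y <= g' y.
Proof.
move=> ff' [F [F1 [dF gE]]] [F' [F1' [dF' g'E]]] y.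
rewrite gE g'E ler_pM2r ?invr_gt0 ?exprn_gt0//.
have := diff2_ge0 (ltW e0) (C2B dF' dF) (y := y).
by rewrite /diff2 => /(_ _)/wrap[z _|]; [have := ff' z; lra | lra].
Qed.

(** Averaging the second antiderivative gives a second antiderivative of the average. This exact
    commutation is what keeps mollification errors from accumulating over the steps of a linear
    scheme. *)
Lemma moll_avg2 a f g : moll e f g -> moll e (avg2 a f) (avg2 a g).
Proof.
move=> [F [F1 [dF gE]]].
exists (fun y => 2^-1 * (F (y + a) + F (y - a))).
exists (fun y => 2^-1 * (F1 (y + a) + F1 (y - a))); split.
  rewrite (_ : avg2 a f = fun y => 2^-1 * (f (y + a) + f (y - a))).
    by apply: C2Z; apply: C2D; exact: C2_translate.
  by apply/funext => y; rewrite /avg2 mulrC.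
move=> y; rewrite /avg2 !gE /diff2.
rewrite (_ : y + a + 2 * e = y + 2 * e + a); last ring.
rewrite (_ : y - a + 2 * e = y + 2 * e - a); last ring.
rewrite (_ : y + a + e = y + e + a); last ring.
rewrite (_ : y - a + e = y + e - a); last ring.
by field; rewrite gt_eqF.
Qed.

End Mollification.

(** * Comparison of subsolutions with barriers *)

(** The nonlinearity is a parameter because the opposite of a supersolution for [G] is a subsolution
    for [a |-> - G (- a)]: one comparison argument serves both inequalities. *)
Definition subsol (R : realType) (H : R -> R) (u : R -> R -> R) : Prop :=
  forall (psi : R -> R -> R) (t y : R), 0 < t -> test_function psi ->
  (\forall z \near (t, y), u z.1 z.2 - psi z.1 z.2 <= u t y - psi t y) ->
  dt psi t y <= H (dyy psi t y).

(** An expansion in time from [t0]: [q] stands for [H (g'')], the time derivative that the equation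
    prescribes, and the quadratic term absorbs the drift of the second space derivative. *)
Definition barrier (R : realType) (g q : R -> R) (t0 A t y : R) : R :=
  g y + (t - t0) * q y + A * (t - t0) ^+ 2.

Lemma cont_add (R : realType) (T : topologicalType) (f g : T -> R) :
  continuous f -> continuous g -> continuous (fun x => f x + g x).
Proof. by move=> cf cg z; apply: continuousD; [exact: cf | exact: cg]. Qed.

Lemma cont_mul (R : realType) (T : topologicalType) (f g : T -> R) :
  continuous f -> continuous g -> continuous (fun x => f x * g x).
Proof. by move=> cf cg z; apply: continuousM; [exact: cf | exact: cg]. Qed.

Lemma cont_opp (R : realType) (T : topologicalType) (f : T -> R) :
  continuous f -> continuous (fun x => - f x).
Proof. by move=> cf z; apply: continuousN; exact: cf. Qed.

Lemma cont_snd (R : realType) (f : R -> R) :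
  continuous f -> continuous (fun w : R * R => f w.2).
Proof.
move=> cf z; apply: (@continuous_comp _ _ _ (fun w : R * R => w.2) f z).
  exact: cvg_snd.
exact: cf.
Qed.

Lemma cont_cst (R : realType) (T : topologicalType) (c : R) :
  continuous (fun _ : T => c).
Proof. by move=> z; exact: cst_continuous. Qed.

Lemma is_derive_cont (R : realType) (f f1 : R -> R) :
  (forall x, is_derive x (1 : R) f (f1 x)) -> continuous f.
Proof. by move=> df x; exact: is_derive_continuous (df x). Qed.

Section BarrierDerivatives.
Variables (R : realType) (g g1 g2 q q1 q2 : R -> R) (t0 A : R).
Hypotheses (dg : C2 g g1 g2) (dq : C2 q q1 q2).
Hypotheses (cg2 : continuous g2) (cq2 : continuous q2).
Let psi := barrier g q t0 A.

Let dpsi_t t y : is_derive t (1 : R) (psi ^~ y) (q y + 2 * A * (t - t0)).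
Proof.
rewrite /psi /barrier; apply: is_derive_eq.
rewrite /GRing.scale /= ?mulr1 ?expr1; ring.
Qed.

Let dpsi_y t y : is_derive y (1 : R) (psi t) (g1 y + (t - t0) * q1 y).
Proof.
have [dg0 _] := dg; have [dq0 _] := dq.
rewrite -[X in is_derive _ _ _ X]addr0.
by apply: is_deriveD; apply: is_deriveD => //; apply: is_deriveZ.
Qed.

Let dpsi_yy t y : is_derive y (1 : R) (fun y => g1 y + (t - t0) * q1 y)
  (g2 y + (t - t0) * q2 y).
Proof.
have [_ dg0] := dg; have [_ dq0] := dq.
by apply: is_deriveD => //; apply: is_deriveZ.
Qed.

Lemma dt_barrier t y : dt psi t y = q y + 2 * A * (t - t0).
Proof. by rewrite /dt derive1E; apply: derive_val. Qed.

Lemma dy_barrier t y : dy psi t y = g1 y + (t - t0) * q1 y.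
Proof. by rewrite /dy derive1E; apply: derive_val. Qed.

Let derive1_psi t : derive1 (psi t) = fun y => g1 y + (t - t0) * q1 y.
Proof. by apply/funext => y; exact: dy_barrier. Qed.

Lemma dyy_barrier t y : dyy psi t y = g2 y + (t - t0) * q2 y.
Proof.
by rewrite /dyy /= derive1_psi derive1E; apply: derive_val.
Qed.

Let cont_time : continuous (fun w : R * R => w.1 - t0).
Proof. by apply: cont_add; [move=> z; exact: cvg_fst | exact: cont_cst]. Qed.

Lemma continuous_barrier : continuous (fun z : R * R => psi z.1 z.2).
Proof.
have [dg0 _] := dg; have [dq0 _] := dq.
rewrite /psi /barrier; apply: cont_add; last first.
  apply: cont_mul; first exact: cont_cst.
  by apply: cont_mul; exact: cont_time.
apply: cont_add; first by apply: cont_snd; exact: is_derive_cont dg0.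
by apply: cont_mul => //; apply: cont_snd; exact: is_derive_cont dq0.
Qed.

Lemma test_function_barrier : test_function psi.
Proof.
have [dg0 dg1] := dg; have [dq0 dq1] := dq.
move=> t y t_gt0; split; split.
- by have [] := dpsi_t t y.
- by have [] := dpsi_y t y.
- by rewrite derive1_psi; have [] := dpsi_yy t y.
- exact: continuous_barrier.
- rewrite (_ : (fun z : R * R => dt psi z.1 z.2) =
    (fun z : R * R => q z.2 + 2 * A * (z.1 - t0))); last first.
    by apply/funext => z; rewrite dt_barrier.
  apply: cont_add; first by apply: cont_snd; exact: is_derive_cont dq0.
  by apply: cont_mul => //; exact: cont_cst.
- rewrite (_ : (fun z : R * R => dy psi z.1 z.2) =
    (fun z : R * R => g1 z.2 + (z.1 - t0) * q1 z.2)); last first.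
    by apply/funext => z; rewrite dy_barrier.
  apply: cont_add; first by apply: cont_snd; exact: is_derive_cont dg1.
  by apply: cont_mul => //; apply: cont_snd; exact: is_derive_cont dq1.
- rewrite (_ : (fun z : R * R => dyy psi z.1 z.2) =
    (fun z : R * R => g2 z.2 + (z.1 - t0) * q2 z.2)); last first.
    by apply/funext => z; rewrite dyy_barrier.
  apply: cont_add; first exact: cont_snd.
  by apply: cont_mul => //; exact: cont_snd.
Qed.

End BarrierDerivatives.

Definition half_plane_continuous (R : realType) (u : R -> R -> R) : Prop :=
  {within [set z : R * R | 0 <= z.1], continuous (fun z => u z.1 z.2)}.

(* The quadratic growth of the barrier in time makes [u - barrier] attain its
   maximum over the closed half plane, so that no terminal time is needed. *)
Lemma subsol_le_barrier_perturbed (R : realType) (H : R -> R) (L M Mg Mq D : R)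
    (u : R -> R -> R) (g g1 g2 q q1 q2 : R -> R) (t0 k : R) :
  0 <= L -> (forall a b, H a <= H b + L * `|a - b|) ->
  subsol H u -> half_plane_continuous u ->
  (forall t y, 0 <= t -> `|u t y| <= M) ->
  C2 g g1 g2 -> C2 q q1 q2 -> continuous g2 -> continuous q2 ->
  (forall y, `|g y| <= Mg) -> (forall y, `|q y| <= Mq) ->
  (forall y, `|q2 y| <= D) -> (forall y, H (g2 y) <= q y) ->
  0 <= t0 -> (forall y, u t0 y <= g y) -> 0 < k ->
  forall s y, 0 <= s ->
  u (t0 + s) y <= g y + k + k * y ^+ 2 + s * (q y + (2 * L + 1) * k)
     + (L * D + k) * s ^+ 2.
Proof.
move=> L0 HL su cu uM dg dq cg2 cq2 gM qM q2D Hg t00 ug k0 s1 y1 s10.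
have D0 : 0 <= D by apply: le_trans (q2D 0); exact: normr_ge0.
have M0 : 0 <= M by apply: le_trans (uM 0 0 (lexx _)); exact: normr_ge0.
have Mg0 : 0 <= Mg by apply: le_trans (gM 0); exact: normr_ge0.
have Mq0 : 0 <= Mq by apply: le_trans (qM 0); exact: normr_ge0.
have dG : C2 (fun y => g y + (2 * k) / 2 * y ^+ 2 + k)
             (fun y => g1 y + 2 * k * y + 0) (fun y => g2 y + 2 * k + 0).
  by apply: C2D; [apply: C2D => //; exact: C2_quad |
    split=> z; exact: is_derive_cst].
have dQ : C2 (fun y => q y + (2 * L + 1) * k) (fun y => q1 y + 0)
             (fun y => q2 y + 0).
  by apply: C2D => //; split=> z; exact: is_derive_cst.
have cG : continuous (fun y => g2 y + 2 * k + 0).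
  by apply: cont_add; [apply: cont_add => //|]; exact: cont_cst.
have cQ : continuous (fun y => q2 y + 0).
  by apply: cont_add => //; exact: cont_cst.
pose psi := barrier (fun y => g y + (2 * k) / 2 * y ^+ 2 + k)
   (fun y => q y + (2 * L + 1) * k) t0 (L * D + k).
have psiE s y : psi (t0 + s) y = g y + k + k * y ^+ 2
    + s * (q y + (2 * L + 1) * k) + (L * D + k) * s ^+ 2.
  by rewrite /psi /barrier; field.
rewrite -psiE leNgt; apply/negP => contra.
(* Beyond [S] in time or [Y] in space the penalties outweigh the bounded quantities [u], [g] and
   [q]. [Y] is chosen after [S] because it has to absorb [s * q] for all [s < S]. *)
pose S := (Mq + Mg + M + 1) / k + 1.
pose Y := (Mq * S + Mg + M + 1) / k + 1.
have S1 : 1 <= S by rewrite /S lerDr divr_ge0//; lra.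
have Y1 : 1 <= Y by rewrite /Y lerDr divr_ge0//; nra.
have kS : k * (S - 1) = Mq + Mg + M + 1 by rewrite /S; field; rewrite gt_eqF.
have kY : k * (Y - 1) = Mq * S + Mg + M + 1 by rewrite /Y; field; rewrite gt_eqF.
have out s y : 0 <= s -> S <= s \/ Y <= `|y| -> u (t0 + s) y < psi (t0 + s) y.
  move=> s0 far; rewrite psiE.
  have uMs := uM (t0 + s) y (addr_ge0 t00 s0).
  have := gM y; have := qM y; rewrite !ler_norml => /andP[q_ge _] /andP[g_ge _].
  have LD : 0 <= L * D * s ^+ 2 by rewrite !mulr_ge0 ?sqr_ge0.
  have Lks : 0 <= s * ((2 * L + 1) * k) by rewrite !mulr_ge0//; lra.
  have sq : - (Mq * s) <= s * q y by nra.
  suff : Mg + M < k + k * y ^+ 2 - Mq * s + k * s ^+ 2.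
    by move: uMs; rewrite ler_norml => /andP[_ uMs]; lra.
  have y2 : y ^+ 2 = `|y| ^+ 2 by rewrite real_normK ?num_real.
  have [sS|sS] := leP S s.
    have ky : 0 <= k * y ^+ 2 by rewrite mulr_ge0 ?sqr_ge0// ltW.
    have : s * (k * s - Mq) >= 1 * (Mg + M + 1).
      have ks : k * S <= k * s by rewrite ler_pM2l.
      by apply: ler_pM; lra.
    by lra.
  case: far => [|Yy]; first lra.
  have : 0 <= k * s ^+ 2 by rewrite mulr_ge0 ?sqr_ge0// ltW.
  have : k * y ^+ 2 >= k * Y.
    by rewrite y2 ler_pM2l//; nra.
  have : Mq * s <= Mq * S by rewrite ler_wpM2l// ltW.
  lra.
pose f (z : R * R) := u z.1 z.2 - psi z.1 z.2.
pose A : set (R * R) := `[t0, t0 + S] `*` `[- Y, Y].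
have cA : compact A by apply: compact_setX; exact: segment_compact.
have A1 : A (t0 + s1, y1).
  have [Ss|sS] := leP S s1; first by have := out _ y1 s10 (or_introl Ss); lra.
  have [Yy|yY] := leP Y `|y1|; first by have := out s1 y1 s10 (or_intror Yy); lra.
  by split; rewrite /= in_itv /=; [lra | move: yY; rewrite ltr_norml; lra].
have cf : {within A, continuous f}.
  apply: (@cont_add R (subspace A) (fun z => u z.1 z.2)
      (fun z => - psi z.1 z.2)).
    apply: continuous_subspaceW cu.
    by move=> [t y] [/=]; rewrite !in_itv /=; lra.
  by apply: continuous_subspaceT; apply: cont_opp; exact: continuous_barrier dG dQ.
have [[tc yc]] := compact_EVT_max (ex_intro _ _ A1) cA cf.
rewrite inE => -[/= tcA ycA] fmax.
have fc : 0 < f (tc, yc).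
  by apply: lt_le_trans (fmax (t0 + s1, y1) (mem_set A1)); rewrite subr_gt0.
have tct0 : t0 < tc.
  rewrite lt_neqAle; move: tcA; rewrite in_itv /= => /andP[-> _]; rewrite andbT.
  apply/eqP => e; move: fc; rewrite /f /= -e -[t0 in psi t0]addr0 psiE.
  have : 0 <= k * yc ^+ 2 by rewrite mulr_ge0 ?sqr_ge0// ltW.
  have := ug yc; rewrite expr0n/= mulr0 mul0r; lra.
have tc0 : 0 < tc by lra.
have := su psi tc yc tc0 (test_function_barrier _ _ dG dQ cG cQ).
rewrite /psi dt_barrier (dyy_barrier _ _ dG dQ) => /(_ _)/wrap[|].
  have nt : \forall z \near (tc, yc), t0 < z.1.
    have cv : fst @ nbhs ((tc : R), (yc : R)) --> (tc : R) by exact: cvg_fst.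
    exact: (cv _ (lt_nbhsr tct0)).
  near=> z.
  have zt : t0 < z.1 by near: z.
  have [zA|zA] := pselect (A z); first by have := fmax z (mem_set zA).
  have : u (t0 + (z.1 - t0)) z.2 < psi (t0 + (z.1 - t0)) z.2.
    apply: out; first lra.
    have [|zS] := leP S (z.1 - t0); first by left.
    have [|zY] := leP Y `|z.2|; first by right.
    exfalso; apply: zA; move: zY; rewrite ltr_norml => zY.
    by split; rewrite /= in_itv /=; lra.
  rewrite (_ : t0 + (z.1 - t0) = z.1); last ring.
  by move: fc; rewrite /f /psi /=; lra.
(* The test at the maximum gives [q + (2L+1)k + 2(LD+k)s <= H (g2 + 2k + s q2)], and the right-hand
   side is at most [q + 2Lk + LDs]. The spare [k] in the slope and the factor 2 from differentiating
   the square make this impossible. *)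
set s := tc - t0; have s0 : 0 < s by rewrite /s; lra.
move=> key; have := HL (g2 yc + 2 * k + 0 + s * (q2 yc + 0)) (g2 yc).
rewrite (_ : _ - g2 yc = 2 * k + s * q2 yc); last ring.
have : `|2 * k + s * q2 yc| <= 2 * k + s * D.
  apply: (le_trans (ler_normD _ _)); rewrite gtr0_norm; last lra.
  by rewrite lerD2l normrM gtr0_norm// ler_pM2l.
move=> n1 n2; have n3 := Hg yc.
have : L * `|2 * k + s * q2 yc| <= L * (2 * k + s * D) by rewrite ler_wpM2l.
have : 0 < s * k by rewrite mulr_gt0.
have : 0 <= s * (L * D) by rewrite !mulr_ge0// ltW.
lra.
Unshelve. all: by end_near. Qed.

Lemma subsol_le_barrier (R : realType) (H : R -> R) (L M Mg Mq D : R)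
    (u : R -> R -> R) (g g1 g2 q q1 q2 : R -> R) (t0 : R) :
  0 <= L -> (forall a b, H a <= H b + L * `|a - b|) ->
  subsol H u -> half_plane_continuous u ->
  (forall t y, 0 <= t -> `|u t y| <= M) ->
  C2 g g1 g2 -> C2 q q1 q2 -> continuous g2 -> continuous q2 ->
  (forall y, `|g y| <= Mg) -> (forall y, `|q y| <= Mq) ->
  (forall y, `|q2 y| <= D) -> (forall y, H (g2 y) <= q y) ->
  0 <= t0 -> (forall y, u t0 y <= g y) ->
  forall s y, 0 <= s -> u (t0 + s) y <= g y + s * q y + L * D * s ^+ 2.
Proof.
move=> L0 HL su cu uM dg dq cg2 cq2 gM qM q2D Hg t00 ug s y s0.
apply/ler_addgt0Pr => e e0.
(* The terms of the perturbed bound that carry [k] add up to [k * E]. *)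
pose E := 1 + y ^+ 2 + s * (2 * L + 1) + s ^+ 2.
have E0 : 0 < E.
  have := sqr_ge0 y; have := sqr_ge0 s.
  have : 0 <= s * (2 * L + 1) by rewrite mulr_ge0//; lra.
  by rewrite /E; lra.
pose k := e / E; have k0 : 0 < k by rewrite divr_gt0.
have kE : k * E = e by rewrite divfK// gt_eqF.
have := subsol_le_barrier_perturbed L0 HL su cu uM dg dq cg2 cq2 gM qM q2D Hg
  t00 ug k0 y s0.
by rewrite -kE /E; lra.
Qed.

(** The coefficient [L * D] of [subsol_le_barrier] when the slope is [H (moll2 e f)] mollified at
    scale [eta / (4 L K2 + 1)]. Here [K2] is the Lipschitz constant of [moll2 e f], and the scale
    keeps the mollification error below [eta / 2]. *)
Definition step_const (R : realType) (L K e eta : R) : R :=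
  let K2 := 4 * K / e ^+ 2 in L * (2 * (L * K2) / (eta / (4 * (L * K2) + 1))).

Lemma step_const_ge0 (R : realType) (L K e eta : R) :
  0 <= L -> 0 <= K -> 0 < eta -> 0 <= step_const L K e eta.
Proof.
move=> L0 K0 eta0; rewrite /step_const /=.
have K20 : 0 <= L * (4 * K / e ^+ 2).
  by rewrite mulr_ge0// divr_ge0 ?sqr_ge0//; lra.
rewrite mulr_ge0// divr_ge0//; first lra.
by rewrite divr_ge0//; lra.
Qed.

(** The barrier needs a slope of class C^2, but [H (moll2 e f)] is only Lipschitz. It is mollified
    once more and raised by [eta / 2], so that it lies between [H (moll2 e f)] and
    [H (moll2 e f) + eta]. *)
Lemma subsol_one_step (R : realType) (H : R -> R) (L M Mf K e eta c : R)
    (u : R -> R -> R) (f g : R -> R) (t0 : R) :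
  0 <= L -> (forall a b, `|H a - H b| <= L * `|a - b|) ->
  subsol H u -> half_plane_continuous u ->
  (forall t y, 0 <= t -> `|u t y| <= M) ->
  0 <= K -> lipschitz_with K f -> (forall y, `|f y| <= Mf) ->
  0 < e -> moll e f g -> 0 < eta ->
  0 <= t0 -> (forall y, u t0 y <= g y + c) ->
  forall s y, 0 <= s -> u (t0 + s) y <=
    g y + c + s * (H (moll2 e f y) + eta) + step_const L K e eta * s ^+ 2.
Proof.
move=> L0 HL su cu uM K0 lf fM e0 mg eta0 t00 ug s y s0.
pose K2 := 4 * K / e ^+ 2; pose e' := eta / (4 * (L * K2) + 1).
have K20 : 0 <= K2 by rewrite /K2 divr_ge0 ?sqr_ge0//; lra.
have LK20 : 0 <= L * K2 by rewrite mulr_ge0.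
have e'0 : 0 < e' by rewrite /e' divr_gt0//; lra.
have lH : lipschitz_with (L * K2) (H \o moll2 e f).
  move=> a b /=; apply: (le_trans (HL _ _)).
  by rewrite -mulrA ler_wpM2l//; exact: moll2_lip.
have [q mq] := moll_exists e' (lipschitz_with_continuous lH).
have [g1 dg] := moll_C2 mg.
have [q1 dq] := moll_C2 mq.
have qc := moll_close e'0 LK20 lH mq.
have e'E : 2 * (L * K2) * e' <= eta / 2.
  rewrite /e' mulrA ler_pdivrMr; last lra.
  nra.
have dg' : C2 (fun y => g y + c) (fun y => g1 y + 0) (fun y => moll2 e f y + 0).
  by apply: C2D => //; split=> z; exact: is_derive_cst.
have dq' : C2 (fun y => q y + eta / 2) (fun y => q1 y + 0)
     (fun y => moll2 e' (H \o moll2 e f) y + 0).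
  by apply: C2D => //; split=> z; exact: is_derive_cst.
have gM z : `|g z + c| <= Mf + 2 * K * e + `|c|.
  apply: (le_trans (ler_normD _ _)); rewrite lerD2r.
  have := moll_close e0 K0 lf mg z; have := fM z.
  by rewrite !ler_norml; lra.
have HM z : `|H (moll2 e f z)| <= `|H 0| + L * (2 * K / e).
  have := HL (moll2 e f z) 0; rewrite subr0.
  have : L * `|moll2 e f z| <= L * (2 * K / e).
    by rewrite ler_wpM2l//; exact: moll2_bound.
  have := ler_norm (H 0); have := ler_norm (- H 0); rewrite normrN.
  by rewrite !ler_norml; lra.
have qM z : `|q z + eta / 2| <= `|H 0| + L * (2 * K / e) + eta.
  have := qc z; have := HM z; rewrite /= !ler_norml; lra.
have q2D z : `|moll2 e' (H \o moll2 e f) z + 0| <= 2 * (L * K2) / e'.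
  by rewrite addr0; exact: moll2_bound.
have Hg z : H (moll2 e f z + 0) <= q z + eta / 2.
  by rewrite addr0; have := qc z; rewrite /= ler_norml; lra.
have HL' a b : H a <= H b + L * `|a - b|.
  by have := HL a b; rewrite ler_norml; lra.
have cg2 : continuous (fun y => moll2 e f y + 0).
  apply: cont_add; last exact: cont_cst.
  exact: lipschitz_with_continuous (moll2_lip e0 lf).
have cq2 : continuous (fun y => moll2 e' (H \o moll2 e f) y + 0).
  apply: cont_add; last exact: cont_cst.
  exact: lipschitz_with_continuous (moll2_lip e'0 lH).
have := subsol_le_barrier L0 HL' su cu uM dg' dq' cg2 cq2 gM qM q2D Hg t00 ug y s0.
move=> /le_trans; apply; rewrite /step_const -/K2 -/e' lerD2r lerD2l.
by rewrite ler_wpM2l//; have := qc y; rewrite /= ler_norml; lra.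
Qed.

(** * The binary scheme for the G-heat equation *)

Section ViscositySupersolution.
Variable R : realType.
Implicit Types (psi u : R -> R -> R).

Lemma derivable_opp (f : R -> R) (x : R) : derivable f x 1 ->
  derivable (fun z => - f z) x 1.
Proof. by move=> d; exact: derivableN d. Qed.

Lemma derive1_opp (f : R -> R) (x : R) : derivable f x 1 ->
  derive1 (fun z => - f z) x = - derive1 f x.
Proof. by move=> d; rewrite !derive1E; exact: deriveN d. Qed.

Lemma dt_opp psi t y : derivable (psi ^~ y) t 1 ->
  dt (fun t y => - psi t y) t y = - dt psi t y.
Proof. by move=> d; exact: derive1_opp d. Qed.

Lemma dy_opp psi t y : derivable (psi t) y 1 ->
  dy (fun t y => - psi t y) t y = - dy psi t y.
Proof. by move=> d; exact: derive1_opp d. Qed.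

Lemma derive1_opp_fun (f : R -> R) : (forall z, derivable f z 1) ->
  derive1 (fun z => - f z) = fun z => - derive1 f z.
Proof. by move=> d; apply/funext => z; exact: (derive1_opp (d z)). Qed.

Lemma dyy_opp psi t y : (forall z, derivable (psi t) z 1) ->
  derivable (derive1 (psi t)) y 1 ->
  dyy (fun t y => - psi t y) t y = - dyy psi t y.
Proof.
move=> d d'; rewrite /dyy (_ : derive1n 2 _ = derive1 (derive1 (fun z => - psi t z))) //.
by rewrite (derive1_opp_fun d); exact: (derive1_opp d').
Qed.

Lemma near_continuous (T : topologicalType) (f g : T -> R) (z : T) :
  (\forall w \near z, f w = g w) -> {for z, continuous f} ->
  {for z, continuous g}.
Proof.
move=> fg cf; rewrite /prop_for /continuous_at -(nbhs_singleton fg).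
apply: cvg_trans cf; apply: near_eq_cvg; exact: fg.
Qed.

Lemma near_time_gt0 (t y : R) : 0 < t -> \forall z \near (t, y), 0 < z.1.
Proof.
move=> t0; have cv : fst @ nbhs (t, y) --> t by exact: cvg_fst.
exact: (cv _ (lt_nbhsr t0)).
Qed.

Lemma test_function_opp psi :
  test_function psi -> test_function (fun t y => - psi t y).
Proof.
move=> tp t y t0; have [[d1 d2 d3] [c0 c1 c2 c3]] := tp t y t0.
have nt := near_time_gt0 y t0.
have dpsi s z : 0 < s -> derivable (psi s) z 1.
  by move=> s0; have [[]] := tp s z s0.
split; split.
- exact: (derivable_opp d1).
- exact: (derivable_opp d2).
- rewrite (derive1_opp_fun (fun z => dpsi t z t0)); exact: (derivable_opp d3).
- exact: (continuousN c0).
- apply: near_continuous (continuousN c1); apply: filterS nt => z z0.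
  have [[d _ _] _] := tp z.1 z.2 z0; exact: esym (dt_opp d).
- apply: near_continuous (continuousN c2); apply: filterS nt => z z0.
  have [[_ d _] _] := tp z.1 z.2 z0; exact: esym (dy_opp d).
- apply: near_continuous (continuousN c3); apply: filterS nt => z z0.
  have [[_ _ d] _] := tp z.1 z.2 z0.
  exact: esym (dyy_opp (fun x => dpsi z.1 x z0) d).
Qed.

Lemma supersolution_subsol (sl su : R) u : viscosity_supersolution sl su u ->
  subsol (fun a => - Gfun sl su (- a)) (fun t y => - u t y).
Proof.
move=> super psi t y t0 tp loc.
have dpsi z : derivable (psi t) z 1 by have [[]] := tp t z t0.
have [[d1 d2 d3] _] := tp t y t0.
have := super _ t y t0 (test_function_opp tp).
rewrite (dt_opp d1) (dyy_opp dpsi d3) => key.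
by rewrite lerNr; apply: key; apply: filterS loc => z; lra.
Qed.

End ViscositySupersolution.

Section GFunction.
Variables (R : realType) (sl su : R).
Hypotheses (sl0 : 0 <= sl) (slu : sl <= su).

Let sl2su2 : 0 <= sl ^+ 2 <= su ^+ 2.
Proof. by rewrite sqr_ge0 /= ler_sqr ?nnegrE// (le_trans sl0). Qed.

(** In this form [G] is visibly what a scheme choosing between the two extreme volatilities
    approximates. *)
Lemma Gfun_max a : Gfun sl su a = Num.max (sl ^+ 2 / 2 * a) (su ^+ 2 / 2 * a).
Proof.
have /andP[s0 s1] := sl2su2; rewrite /Gfun; case: (leP 0 a) => a0.
  have e1 : Num.max (sl ^+ 2 / 2 * a) (su ^+ 2 / 2 * a) = su ^+ 2 / 2 * a.
    by rewrite max_r// ler_wpM2r//; lra.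
  have e2 : Num.max (- a) 0 = 0 by rewrite max_r//; lra.
  by rewrite e1 e2; field.
have e1 : Num.max (sl ^+ 2 / 2 * a) (su ^+ 2 / 2 * a) = sl ^+ 2 / 2 * a.
  by rewrite max_l// ler_wnM2r//; lra.
have e2 : Num.max (- a) 0 = - a by rewrite max_l//; lra.
by rewrite e1 e2; field.
Qed.

Lemma Gfun_ge_lower a : sl ^+ 2 / 2 * a <= Gfun sl su a.
Proof. by rewrite Gfun_max le_max lexx. Qed.

Lemma Gfun_ge_upper a : su ^+ 2 / 2 * a <= Gfun sl su a.
Proof. by rewrite Gfun_max le_max lexx orbT. Qed.

Lemma Gfun_lipschitz a b :
  `|Gfun sl su a - Gfun sl su b| <= su ^+ 2 / 2 * `|a - b|.
Proof.
have /andP[s1 s2] := sl2su2.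
have key c d : Gfun sl su c <= Gfun sl su d + su ^+ 2 / 2 * `|c - d|.
  rewrite [Gfun sl su c]Gfun_max ge_max; apply/andP; split.
    have : sl ^+ 2 / 2 * (c - d) <= su ^+ 2 / 2 * `|c - d|.
      apply: le_trans (ler_norm _) _; rewrite normrM ger0_norm; last lra.
      by rewrite ler_wpM2r//; lra.
    by have := Gfun_ge_lower d; lra.
  have : su ^+ 2 / 2 * (c - d) <= su ^+ 2 / 2 * `|c - d|.
    by rewrite ler_wpM2l ?ler_norm//; lra.
  by have := Gfun_ge_upper d; lra.
by rewrite ler_norml; have := key a b; have := key b a; rewrite distrC; lra.
Qed.

Lemma GfunZ c a : 0 <= c -> Gfun sl su (c * a) = c * Gfun sl su a.
Proof.
move=> c0; rewrite /Gfun.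
have e (b : R) : Num.max (c * b) 0 = c * Num.max b 0.
  by rewrite maxr_pMr// mulr0.
have -> : - (c * a) = c * - a by rewrite mulrN.
by rewrite (e a) (e (- a)); ring.
Qed.

Lemma Gfun0 : Gfun sl su 0 = 0.
Proof. by rewrite -[0 in LHS](mulr0 (0 : R)) GfunZ// mul0r. Qed.

End GFunction.

Section Scheme.
Variables (R : realType).
Implicit Types (f g : R -> R).

(* One step of the binary scheme with step [r = sqrt h] and volatility chosen
   between [s1] and [s2]. *)
Definition scheme s1 s2 r f : R -> R :=
  fun y => Num.max (avg2 (s1 * r) f y) (avg2 (s2 * r) f y).

Lemma avg2_le a f g : (forall y, f y <= g y) -> forall y, avg2 a f y <= avg2 a g y.
Proof.
by move=> fg y; rewrite /avg2; have := fg (y + a); have := fg (y - a); lra.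
Qed.

Lemma scheme_le s1 s2 r f g : (forall y, f y <= g y) ->
  forall y, scheme s1 s2 r f y <= scheme s1 s2 r g y.
Proof.
move=> fg y; rewrite /scheme ge_max !le_max.
by rewrite (avg2_le (s1 * r) fg) (avg2_le (s2 * r) fg) orbT.
Qed.

Lemma scheme_ge_lower s1 s2 r f y : avg2 (s1 * r) f y <= scheme s1 s2 r f y.
Proof. by rewrite /scheme le_max lexx. Qed.

Lemma scheme_ge_upper s1 s2 r f y : avg2 (s2 * r) f y <= scheme s1 s2 r f y.
Proof. by rewrite /scheme le_max lexx orbT. Qed.

Lemma schemeD s1 s2 r f g y :
  scheme s1 s2 r (fun z => f z + g z) y <= scheme s1 s2 r f y + scheme s1 s2 r g y.
Proof.
rewrite {1}/scheme ge_max; apply/andP; split.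
  have := scheme_ge_lower s1 s2 r f y; have := scheme_ge_lower s1 s2 r g y.
  by rewrite /avg2; lra.
have := scheme_ge_upper s1 s2 r f y; have := scheme_ge_upper s1 s2 r g y.
by rewrite /avg2; lra.
Qed.

Lemma scheme_addc s1 s2 r f c y :
  scheme s1 s2 r (fun z => f z + c) y = scheme s1 s2 r f y + c.
Proof.
by rewrite /scheme addr_maxl; congr (Num.max _ _); rewrite /avg2; field.
Qed.

Lemma schemeZ s1 s2 r f c y : 0 <= c ->
  scheme s1 s2 r (fun z => c * f z) y = c * scheme s1 s2 r f y.
Proof.
by move=> c0; rewrite /scheme maxr_pMr//; congr (Num.max _ _); rewrite /avg2; field.
Qed.

Lemma iter_scheme_le s1 s2 r k f g : (forall y, f y <= g y) ->
  forall y, iter k (scheme s1 s2 r) f y <= iter k (scheme s1 s2 r) g y.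
Proof. by move=> fg; elim: k => [//|k IH] y /=; exact: scheme_le. Qed.

Lemma iter_scheme_addc s1 s2 r k f c y :
  iter k (scheme s1 s2 r) (fun z => f z + c) y = iter k (scheme s1 s2 r) f y + c.
Proof.
elim: k y => [//|k IH] y /=; rewrite -scheme_addc; congr (scheme _ _ _ _ _).
by apply/funext => z; rewrite IH.
Qed.

Lemma iter_schemeZ s1 s2 r k f c y : 0 <= c ->
  iter k (scheme s1 s2 r) (fun z => c * f z) y = c * iter k (scheme s1 s2 r) f y.
Proof.
move=> c0; elim: k y => [//|k IH] y /=; rewrite -schemeZ//.
by congr (scheme _ _ _ _ _); apply/funext => z; rewrite IH.
Qed.

Lemma iter_schemeD s1 s2 r k f g y :
  iter k (scheme s1 s2 r) (fun z => f z + g z) y <=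
  iter k (scheme s1 s2 r) f y + iter k (scheme s1 s2 r) g y.
Proof.
elim: k y => [//|k IH] y /=; apply: le_trans (schemeD _ _ _ _ _ _).
exact: scheme_le.
Qed.

Lemma iter_scheme_le_addc s1 s2 r k f g c : (forall y, f y <= g y + c) ->
  forall y, iter k (scheme s1 s2 r) f y <= iter k (scheme s1 s2 r) g y + c.
Proof. by move=> fg y; rewrite -iter_scheme_addc; exact: iter_scheme_le. Qed.

Lemma avg2_lipschitz a K f : lipschitz_with K f -> lipschitz_with K (avg2 a f).
Proof.
move=> lf x y; have := lf (x + a) (y + a); have := lf (x - a) (y - a).
rewrite (_ : x + a - (y + a) = x - y); last ring.
rewrite (_ : x - a - (y - a) = x - y); last ring.
by rewrite /avg2 !ler_norml; lra.
Qed.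

Lemma max_lipschitz K f g : lipschitz_with K f -> lipschitz_with K g ->
  lipschitz_with K (fun y => Num.max (f y) (g y)).
Proof.
move=> lf lg; have key x y : Num.max (f x) (g x) <= Num.max (f y) (g y) + K * `|x - y|.
  rewrite ge_max addr_maxl !le_max; apply/andP; split; apply/orP.
    by left; have := lf x y; rewrite ler_norml; lra.
  by right; have := lg x y; rewrite ler_norml; lra.
by move=> x y; rewrite ler_norml; have := key x y; have := key y x;
  rewrite distrC; lra.
Qed.

Lemma scheme_lipschitz s1 s2 r K f :
  lipschitz_with K f -> lipschitz_with K (scheme s1 s2 r f).
Proof. by move=> lf; apply: max_lipschitz; exact: avg2_lipschitz. Qed.

Lemma iter_scheme_lipschitz s1 s2 r k K f :
  lipschitz_with K f -> lipschitz_with K (iter k (scheme s1 s2 r) f).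
Proof. by move=> lf; elim: k => //= k IH; exact: scheme_lipschitz. Qed.

Lemma avg2_bounded a M f : (forall y, `|f y| <= M) -> forall y, `|avg2 a f y| <= M.
Proof.
move=> fM y; have := fM (y + a); have := fM (y - a).
by rewrite /avg2 !ler_norml; lra.
Qed.

Lemma max_bounded M f g : (forall y, `|f y| <= M) -> (forall y, `|g y| <= M) ->
  forall y, `|Num.max (f y) (g y)| <= M.
Proof. by move=> fM gM y; case: (leP (f y) (g y)). Qed.

Lemma scheme_bounded s1 s2 r M f : (forall y, `|f y| <= M) ->
  forall y, `|scheme s1 s2 r f y| <= M.
Proof. by move=> fM; apply: max_bounded; exact: avg2_bounded. Qed.

Lemma iter_scheme_bounded s1 s2 r k M f : (forall y, `|f y| <= M) ->
  forall y, `|iter k (scheme s1 s2 r) f y| <= M.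
Proof. by move=> fM; elim: k => //= k IH; exact: scheme_bounded. Qed.

Lemma scheme_same s r f : scheme s s r f = avg2 (s * r) f.
Proof. by apply/funext => y; rewrite /scheme maxxx. Qed.

Section Bounds.
Variables (s1 s2 r : R).
Hypotheses (s10 : 0 <= s1) (s12 : s1 <= s2) (r0 : 0 <= r).

Lemma iter_scheme_quad k c b y0 y : 0 <= c ->
  iter k (scheme s1 s2 r) (fun z => c * (z - y0) ^+ 2 + b) y <=
  c * (y - y0) ^+ 2 + c * (k%:R * (s2 ^+ 2 * r ^+ 2)) + b.
Proof.
move=> c0; elim: k b y => [|k IH] b y; first by rewrite /= mul0r mulr0 addr0.
have step z : scheme s1 s2 r (fun z => c * (z - y0) ^+ 2 + b) z <=
    c * (z - y0) ^+ 2 + (c * (s2 ^+ 2 * r ^+ 2) + b).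
  have : s1 ^+ 2 * r ^+ 2 <= s2 ^+ 2 * r ^+ 2.
    by rewrite ler_wpM2r ?sqr_ge0// ler_sqr ?nnegrE// (le_trans s10).
  move=> /(ler_wpM2l c0) s12c.
  rewrite /scheme ge_max /avg2; apply/andP; split; lra.
rewrite iterSr; apply: (le_trans (iter_scheme_le s1 s2 r k step y)).
apply: (le_trans (IH _ _)); rewrite -[k.+1]addn1 natrD; lra.
Qed.

(** By [|z - y| <= rho / 2 + (z - y)^2 / (2 rho)] the function [f] lies below a parabola, and the
    scheme raises a parabola by at most the accumulated variance. The parameter [rho] is left free
    for later balancing. *)
Lemma iter_scheme_lip_le k K f rho y : 0 <= K -> lipschitz_with K f -> 0 < rho ->
  iter k (scheme s1 s2 r) f y <=
  f y + K * (rho / 2 + s2 ^+ 2 * (k%:R * r ^+ 2) / (2 * rho)).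
Proof.
move=> K0 lf rho0.
have le z : f z <= K / (2 * rho) * (z - y) ^+ 2 + (f y + K * (rho / 2)).
  have : `|z - y| <= rho / 2 + (z - y) ^+ 2 / (2 * rho).
    rewrite -subr_ge0 -[(z - y) ^+ 2]real_normK ?num_real//.
    rewrite (_ : _ - _ = (`|z - y| - rho) ^+ 2 / (2 * rho)).
      by rewrite divr_ge0 ?sqr_ge0//; lra.
    by field; rewrite gt_eqF.
  move=> /(ler_wpM2l K0); have := lf z y; rewrite ler_norml.
  rewrite (_ : K / (2 * rho) * (z - y) ^+ 2 = K * ((z - y) ^+ 2 / (2 * rho))).
    by lra.
  by ring.
apply: (le_trans (iter_scheme_le s1 s2 r k le y)).
have c0 : 0 <= K / (2 * rho) by rewrite divr_ge0//; lra.
apply: (le_trans (iter_scheme_quad k _ y y c0)).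
rewrite subrr expr0n /= mulr0 le_eqVlt; apply/orP; left; apply/eqP.
by field; rewrite gt_eqF.
Qed.

(** The centred second difference is the forward one started at [y - a]. On that interval the second
    derivative [moll2 e f] differs from its value at [y] by at most its Lipschitz constant times
    [a], whence a cubic error. *)
Lemma avg2_moll e K f g a y : 0 < e -> 0 <= K -> lipschitz_with K f -> moll e f g ->
  0 <= a -> `|avg2 a g y - g y - a ^+ 2 / 2 * moll2 e f y| <=
            4 * K / e ^+ 2 * a ^+ 3 / 2.
Proof.
move=> e0 K0 lf mg a0; have [g1 dg] := moll_C2 mg.
have b z : y - a <= z <= y - a + 2 * a ->
    moll2 e f y - 4 * K / e ^+ 2 * a <= moll2 e f z <=
    moll2 e f y + 4 * K / e ^+ 2 * a.
  move=> zy; have zy' : `|z - y| <= a by rewrite ler_norml; lra.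
  have C0 : 0 <= 4 * K / e ^+ 2 by rewrite divr_ge0 ?sqr_ge0//; lra.
  have := moll2_lip e0 lf z y; have := ler_wpM2l C0 zy'.
  by rewrite !ler_norml; lra.
have := diff2_bounds a0 dg b; rewrite /diff2 /avg2.
rewrite (_ : y - a + 2 * a = y + a); last ring.
rewrite (_ : y - a + a = y); last ring.
set C := 4 * K / e ^+ 2; set m := moll2 e f y.
by rewrite ler_norml; lra.
Qed.

(* Sublinearity turns the increment [S^(i+1) g - S^i g] into a bound by
   [S^i (S g - g)]. *)
Lemma iter_scheme_moll k e K f g rho y :
  0 < e -> 0 <= K -> lipschitz_with K f -> moll e f g -> 0 < rho ->
  iter k (scheme s1 s2 r) g y <= g y + k%:R * r ^+ 2 * Gfun s1 s2 (moll2 e f y)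
   + k%:R * r ^+ 2 * (4 * K / e ^+ 2 * s2 ^+ 3 * r / 2 +
      s2 ^+ 2 / 2 * (4 * K / e ^+ 2) *
        (rho / 2 + s2 ^+ 2 * (k%:R * r ^+ 2) / (2 * rho))).
Proof.
move=> e0 K0 lf mg rho0.
set C := 4 * K / e ^+ 2; have C0 : 0 <= C by rewrite divr_ge0 ?sqr_ge0//; lra.
have s20 : 0 <= s2 by exact: le_trans s12.
pose q z := Gfun s1 s2 (moll2 e f z).
have lq : lipschitz_with (s2 ^+ 2 / 2 * C) q.
  move=> z w; apply: (le_trans (Gfun_lipschitz s10 s12 _ _)).
  by rewrite -[leRHS]mulrA ler_wpM2l ?divr_ge0 ?sqr_ge0//; exact: moll2_lip.
have sC0 : 0 <= s2 ^+ 2 / 2 * C by rewrite mulr_ge0// divr_ge0 ?sqr_ge0.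
have one z : scheme s1 s2 r g z <= g z + r ^+ 2 * q z + C * s2 ^+ 3 * r ^+ 3 / 2.
  have h1 := Gfun_ge_lower s10 s12 (moll2 e f z).
  have h2 := Gfun_ge_upper s10 s12 (moll2 e f z).
  have r20 : 0 <= r ^+ 2 by rewrite sqr_ge0.
  have := ler_wpM2l r20 h1; have := ler_wpM2l r20 h2.
  have c3 : C * (s1 * r) ^+ 3 <= C * (s2 ^+ 3 * r ^+ 3).
    by rewrite ler_wpM2l// exprMn ler_wpM2r ?exprn_ge0// lerXn2r ?nnegrE.
  have := avg2_moll z e0 K0 lf mg (mulr_ge0 s10 r0).
  have := avg2_moll z e0 K0 lf mg (mulr_ge0 s20 r0).
  rewrite -/C !ler_norml {1}/scheme ge_max /q => a2 a1 b2 b1.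
  by apply/andP; split; lra.
set E := s2 ^+ 2 / 2 * C * (rho / 2 + s2 ^+ 2 * (k%:R * r ^+ 2) / (2 * rho)).
suff : forall i, (i <= k)%N -> iter i (scheme s1 s2 r) g y <= g y +
    i%:R * (r ^+ 2 * q y) + i%:R * r ^+ 2 * (C * s2 ^+ 3 * r / 2 + E).
  by move=> /(_ k (leqnn k)) /le_trans; apply; rewrite /q; lra.
elim=> [|i IH] ik; first by rewrite /= !mul0r !addr0.
have := IH (ltnW ik); rewrite iterSr => IH'.
apply: (le_trans (iter_scheme_le s1 s2 r i one y)).
rewrite iter_scheme_addc.
have := iter_schemeD s1 s2 r i g (fun z => r ^+ 2 * q z) y.
rewrite iter_schemeZ ?sqr_ge0//.
have := iter_scheme_lip_le i y sC0 lq rho0.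
have iE : s2 ^+ 2 / 2 * C * (rho / 2 + s2 ^+ 2 * (i%:R * r ^+ 2) / (2 * rho)) <= E.
  rewrite /E ler_wpM2l// lerD2l ler_pM2r ?invr_gt0; last lra.
  by rewrite ler_wpM2l ?sqr_ge0// ler_wpM2r ?sqr_ge0// ler_nat ltnW.
move=> l1 l2.
have : r ^+ 2 * iter i (scheme s1 s2 r) q y <= r ^+ 2 * (q y + E).
  by rewrite ler_wpM2l ?sqr_ge0//; lra.
by rewrite -[i.+1]addn1 natrD; lra.
Qed.

End Bounds.
End Scheme.

Lemma lipschitz_with_opp (R : realType) (K : R) (f : R -> R) :
  lipschitz_with K f -> lipschitz_with K (fun z => - f z).
Proof. by move=> lf x y; rewrite -opprD normrN; exact: lf. Qed.

Section SchemeVersusViscosity.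
Variables (R : realType) (sl su : R).
Hypotheses (sl0 : 0 <= sl) (slu : sl <= su).
Let L := su ^+ 2 / 2.
Let L0 : 0 <= L. Proof. by rewrite divr_ge0 ?sqr_ge0. Qed.
Let su0 : 0 <= su. Proof. exact: le_trans slu. Qed.

(** Error per unit of time for steps of length [r^2]: the slope error [eta], the quadratic term of
    the barrier at time [r^2], and the error of [avg2_moll] with [a = su * r], each divided by
    [r^2]. *)
Definition step_rate (K e eta r : R) : R :=
  eta + step_const (su ^+ 2 / 2) K e eta * r ^+ 2 + 4 * K / e ^+ 2 * su ^+ 3 * r / 2.

Definition block_rate (K e rho r : R) (k : nat) : R :=
  4 * K / e ^+ 2 * su ^+ 3 * r / 2 + su ^+ 2 / 2 * (4 * K / e ^+ 2) *
    (rho / 2 + su ^+ 2 * (k%:R * r ^+ 2) / (2 * rho)).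

(** The volatility is frozen for [k] steps. Inside such a block the averages are linear and commute
    with mollification, which the maximum taken at every step does not. *)
Definition coarse (r : R) (k : nat) (f : R -> R) : R -> R :=
  fun y => Num.max (iter k (avg2 (sl * r)) f y) (iter k (avg2 (su * r)) f y).

Lemma iter_avg2E s r k (f : R -> R) : iter k (avg2 (s * r)) f = iter k (scheme s s r) f.
Proof. by elim: k => //= k ->; rewrite scheme_same. Qed.

Lemma moll_iter_avg2 e a k (f g : R -> R) :
  moll e f g -> 0 < e -> moll e (iter k (avg2 a) f) (iter k (avg2 a) g).
Proof. by move=> mg e0; elim: k => //= k IH; exact: moll_avg2. Qed.

Lemma coarse_lipschitz r k K (f : R -> R) :
  lipschitz_with K f -> lipschitz_with K (coarse r k f).
Proof.
by move=> lf; apply: max_lipschitz; rewrite iter_avg2E; exact: iter_scheme_lipschitz.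
Qed.

Lemma iter_coarse_lipschitz r k j K (f : R -> R) :
  lipschitz_with K f -> lipschitz_with K (iter j (coarse r k) f).
Proof. by move=> lf; elim: j => //= j IH; exact: coarse_lipschitz. Qed.

Lemma coarse_bounded r k M (f : R -> R) : (forall y, `|f y| <= M) ->
  forall y, `|coarse r k f y| <= M.
Proof.
by move=> fM; apply: max_bounded; rewrite iter_avg2E; exact: iter_scheme_bounded.
Qed.

Lemma iter_coarse_bounded r k j M (f : R -> R) : (forall y, `|f y| <= M) ->
  forall y, `|iter j (coarse r k) f y| <= M.
Proof. by move=> fM; elim: j => //= j IH; exact: coarse_bounded. Qed.

Section Bounds.
Variables (K Mf e r : R) (f : R -> R).
Hypotheses (K0 : 0 <= K) (lf : lipschitz_with K f) (fM : forall y, `|f y| <= Mf).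
Hypotheses (e0 : 0 < e) (r0 : 0 <= r).

Let s3 s : 0 <= s -> s <= su -> 4 * K / e ^+ 2 * (s * r) ^+ 3 / 2 <=
  4 * K / e ^+ 2 * su ^+ 3 * r ^+ 3 / 2.
Proof.
move=> s0 ssu; rewrite ler_pM2r ?invr_gt0// -[leRHS]mulrA ler_wpM2l//.
  by rewrite divr_ge0 ?sqr_ge0// mulr_ge0.
by rewrite exprMn ler_wpM2r ?exprn_ge0// lerXn2r ?nnegrE.
Qed.

(** The induction bounds [u] by any mollification [g] of the current iterate. A mollification of the
    next iterate dominates every linear average of [g], hence, up to the error of [avg2_moll],
    [g + r^2 G(m)] with [m] the second derivative of [g]; this is what one step of the barrier
    produces. Mollifying costs [2 K e] at the start and [2 K e] at the end. *)
Lemma subsol_le_iter_scheme (M eta c t0 : R) (u : R -> R -> R) :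
  viscosity_subsolution sl su u -> half_plane_continuous u ->
  (forall t y, 0 <= t -> `|u t y| <= M) -> 0 < eta -> 0 <= t0 ->
  (forall y, u t0 y <= f y + c) ->
  forall j y, u (t0 + j%:R * r ^+ 2) y <= iter j (scheme sl su r) f y
    + c + 4 * K * e + j%:R * r ^+ 2 * step_rate K e eta r.
Proof.
move=> su_u cu uM eta0 t00 uf.
set E := step_rate K e eta r.
pose S := scheme sl su r.
suff main : forall j g, moll e (iter j S f) g -> forall y,
    u (t0 + j%:R * r ^+ 2) y <= g y + (c + 2 * K * e + j%:R * r ^+ 2 * E).
  move=> j y; have lj := iter_scheme_lipschitz sl su r j lf.
  have [g mg] := moll_exists e (lipschitz_with_continuous lj).
  have := main j g mg y; have := moll_close e0 K0 lj mg y.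
  by rewrite ler_norml -/S; lra.
elim=> [|j IH] g' mg' y.
  rewrite !mul0r !addr0; have := uf y; have := moll_close e0 K0 lf mg' y.
  by rewrite ler_norml; lra.
have lj := iter_scheme_lipschitz sl su r j lf.
have [g mg] := moll_exists e (lipschitz_with_continuous lj).
have jr : 0 <= t0 + j%:R * r ^+ 2 by rewrite addr_ge0// mulr_ge0 ?sqr_ge0.
have step := subsol_one_step L0 (Gfun_lipschitz sl0 slu) su_u cu uM K0 lj
  (iter_scheme_bounded sl su r j fM) e0 mg eta0 jr (IH g mg) y (sqr_ge0 r).
rewrite (_ : t0 + j.+1%:R * r ^+ 2 = t0 + j%:R * r ^+ 2 + r ^+ 2); last first.
  by rewrite -[j.+1]addn1 natrD; ring.
apply: (le_trans step); rewrite -/S.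
set m := moll2 e (iter j S f) y.
have le_g' s : 0 <= s -> s <= su -> (forall z, avg2 (s * r) (iter j S f) z <=
    iter j.+1 S f z) -> g y + r ^+ 2 * (s ^+ 2 / 2 * m) <=
    g' y + 4 * K / e ^+ 2 * su ^+ 3 * r ^+ 3 / 2.
  move=> s0 ssu le_it; have := s3 s0 ssu.
  have := avg2_moll y e0 K0 lj mg (mulr_ge0 s0 r0).
  have := moll_le e0 le_it (moll_avg2 e0 (s * r) mg) mg' y.
  by rewrite ler_norml -/m; lra.
have G1 : g y + r ^+ 2 * Gfun sl su m <=
    g' y + 4 * K / e ^+ 2 * su ^+ 3 * r ^+ 3 / 2.
  rewrite (Gfun_max sl0 slu) maxr_pMr ?sqr_ge0// addr_maxr ge_max.
  rewrite le_g' ?le_g'//=.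
    by move=> z; exact: scheme_ge_upper.
  by move=> z; exact: scheme_ge_lower.
have : c + 2 * K * e + j.+1%:R * r ^+ 2 * E = c + 2 * K * e + j%:R * r ^+ 2 * E
    + r ^+ 2 * eta + step_const (su ^+ 2 / 2) K e eta * r ^+ 2 ^+ 2 +
    4 * K / e ^+ 2 * su ^+ 3 * r ^+ 3 / 2.
  by rewrite -[j.+1]addn1 natrD /E /step_rate; field; rewrite gt_eqF.
by rewrite -/L; lra.
Qed.

(** With a fixed volatility the iterates of the mollified datum are the mollified iterates, so
    mollification is paid for twice, whatever the number of steps. The barrier argument is applied
    to [- u]. *)
Lemma iter_avg2_le_supersol (M eta c t0 s : R) (u : R -> R -> R) :
  0 <= s -> s <= su -> (forall a, s ^+ 2 / 2 * a <= Gfun sl su a) ->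
  viscosity_supersolution sl su u -> half_plane_continuous u ->
  (forall t y, 0 <= t -> `|u t y| <= M) -> 0 < eta -> 0 <= t0 ->
  (forall y, f y <= u t0 y + c) ->
  forall k y, iter k (avg2 (s * r)) f y <= u (t0 + k%:R * r ^+ 2) y
    + c + 4 * K * e + k%:R * r ^+ 2 * step_rate K e eta r.
Proof.
move=> s0 ssu sG su_u cu uM eta0 t00 uf.
set E := step_rate K e eta r.
pose S := avg2 (s * r).
have lS k : lipschitz_with K (iter k S f).
  by rewrite /S iter_avg2E; exact: iter_scheme_lipschitz.
have [g0 mg0] := moll_exists e (lipschitz_with_continuous lf).
have mg k : moll e (iter k S f) (iter k S g0) by exact: moll_iter_avg2.
suff main : forall k y, iter k S g0 y <=
    u (t0 + k%:R * r ^+ 2) y + (c + 2 * K * e + k%:R * r ^+ 2 * E).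
  move=> k y; have := main k y; have := moll_close e0 K0 (lS k) (mg k) y.
  by rewrite ler_norml -/S; lra.
elim=> [|k IH] y.
  rewrite /= !mul0r !addr0; have := uf y; have := moll_close e0 K0 lf mg0 y.
  by rewrite ler_norml; lra.
have kr : 0 <= t0 + k%:R * r ^+ 2 by rewrite addr_ge0// mulr_ge0 ?sqr_ge0.
set f' := fun z => - iter k S f z; set g' := fun z => - iter k S g0 z.
have lf' : lipschitz_with K f'.
  exact: lipschitz_with_opp.
have fM' z : `|f' z| <= Mf.
  by rewrite normrN /S iter_avg2E; exact: iter_scheme_bounded.
have mg' : moll e f' g'.
  have [F [F1 [dF gE]]] := mg k.
  exists (fun z => -1 * F z), (fun z => -1 * F1 z); split.
    rewrite (_ : f' = fun z => -1 * iter k S f z); first exact: C2Z.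
    by apply/funext => z; rewrite mulN1r.
  by move=> z; rewrite /g' gE /diff2; ring.
have HL a b : `|- Gfun sl su (- a) - - Gfun sl su (- b)| <= L * `|a - b|.
  rewrite -opprD normrN; apply: le_trans (Gfun_lipschitz sl0 slu _ _) _.
  by rewrite -opprD normrN.
have IH' z : - u (t0 + k%:R * r ^+ 2) z <=
    g' z + (c + 2 * K * e + k%:R * r ^+ 2 * E).
  by rewrite /g'; have := IH z; lra.
have cu' : half_plane_continuous (fun t y => - u t y).
  exact: (@cont_opp _ (subspace _)).
have uM' t z : 0 <= t -> `|- u t z| <= M by rewrite normrN; exact: uM.
have := subsol_one_step L0 HL (supersolution_subsol su_u) cu' uM' K0 lf'
  fM' e0 mg' eta0 kr IH' y (sqr_ge0 r).
rewrite (_ : t0 + k.+1%:R * r ^+ 2 = t0 + k%:R * r ^+ 2 + r ^+ 2); last first.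
  by rewrite -[k.+1]addn1 natrD; ring.
have m2 : - moll2 e f' y = moll2 e (iter k S f) y.
  by rewrite /moll2 /diff2 /f'; ring.
rewrite m2; set m := moll2 e (iter k S f) y; rewrite /g' => step.
have := ler_wpM2l (sqr_ge0 r) (sG m).
have := avg2_moll y e0 K0 (lS k) (mg k) (mulr_ge0 s0 r0).
have := s3 s0 ssu; rewrite ler_norml -/m /= -/S.
have : c + 2 * K * e + k.+1%:R * r ^+ 2 * E = c + 2 * K * e + k%:R * r ^+ 2 * E
    + r ^+ 2 * eta + step_const (su ^+ 2 / 2) K e eta * r ^+ 2 ^+ 2 +
    4 * K / e ^+ 2 * su ^+ 3 * r ^+ 3 / 2.
  by rewrite -[k.+1]addn1 natrD /E /step_rate; field; rewrite gt_eqF.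
by rewrite -/L in step *; lra.
Qed.

End Bounds.

(** The maximum at the end of a block destroys smoothness, so every block mollifies anew: this is
    the cost [4 K e] per block. *)
Lemma iter_coarse_le_supersol (K Mf e r : R) (f : R -> R) (M eta c t0 : R)
    (u : R -> R -> R) (k : nat) :
  0 <= K -> lipschitz_with K f -> (forall y, `|f y| <= Mf) -> 0 < e -> 0 <= r ->
  viscosity_supersolution sl su u -> half_plane_continuous u ->
  (forall t y, 0 <= t -> `|u t y| <= M) -> 0 < eta -> 0 <= t0 ->
  (forall y, f y <= u t0 y + c) ->
  forall j y, iter j (coarse r k) f y <= u (t0 + j%:R * (k%:R * r ^+ 2)) y
    + c + j%:R * (4 * K * e + k%:R * r ^+ 2 * step_rate K e eta r).
Proof.
move=> K0 lf fM e0 r0 su_u cu uM eta0 t00 uf.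
elim=> [|j IH] y; first by rewrite /= !mul0r !addr0.
have kr : 0 <= t0 + j%:R * (k%:R * r ^+ 2).
  by rewrite addr_ge0// !mulr_ge0 ?sqr_ge0.
have lj := iter_coarse_lipschitz r k j lf.
have fj := iter_coarse_bounded r k j fM.
have IH' z : iter j (coarse r k) f z <= u (t0 + j%:R * (k%:R * r ^+ 2)) z
  + (c + j%:R * (4 * K * e + k%:R * r ^+ 2 * step_rate K e eta r)).
  by rewrite addrA.
have b s (s0 : 0 <= s) (ssu : s <= su) (sG : forall a, s ^+ 2 / 2 * a <= Gfun sl su a) :=
  iter_avg2_le_supersol K0 lj fj e0 r0 s0 ssu sG su_u cu uM eta0 kr IH' k y.
rewrite iterS /coarse -/(coarse r k) ge_max.
rewrite (_ : t0 + j.+1%:R * (k%:R * r ^+ 2) =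
   t0 + j%:R * (k%:R * r ^+ 2) + k%:R * r ^+ 2); last first.
  by rewrite -[j.+1]addn1 natrD; ring.
rewrite -[j.+1]addn1 natrD.
have := b sl sl0 slu (Gfun_ge_lower sl0 slu).
have := b su su0 (lexx _) (Gfun_ge_upper sl0 slu).
by move=> b1 b2; apply/andP; split; lra.
Qed.

Lemma iter_scheme_le_coarse (K e rho r : R) (f : R -> R) (k : nat) :
  0 <= K -> lipschitz_with K f -> 0 < e -> 0 < rho -> 0 <= r ->
  forall j y, iter (j * k) (scheme sl su r) f y <= iter j (coarse r k) f y
    + 4 * K * e + j%:R * (k%:R * r ^+ 2) * (2 * block_rate K e rho r k).
Proof.
move=> K0 lf e0 rho0 r0.
set E := block_rate K e rho r k.
pose D := coarse r k; pose S := scheme sl su r.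
have lD j : lipschitz_with K (iter j D f) by exact: iter_coarse_lipschitz.
suff main : forall j g, moll e (iter j D f) g -> forall y, iter (j * k) S f y <=
    g y + (2 * K * e + j%:R * (k%:R * r ^+ 2) * (2 * E)).
  move=> j y; have [g mg] := moll_exists e (lipschitz_with_continuous (lD j)).
  have := main j g mg y; have := moll_close e0 K0 (lD j) mg y.
  by rewrite ler_norml -/D -/S; lra.
elim=> [|j IH] g' mg' y.
  rewrite mul0n /= !mul0r addr0; have := moll_close e0 K0 lf mg' y.
  by rewrite ler_norml; lra.
have [g mg] := moll_exists e (lipschitz_with_continuous (lD j)).
rewrite mulSn iterD.
apply: (le_trans (iter_scheme_le_addc sl su r k (IH g mg) y)).
have fine := iter_scheme_moll sl0 slu r0 k y e0 K0 (lD j) mg rho0.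
set m := moll2 e (iter j D f) y in fine.
pose G z := -1 * g z; pose F z := -1 * iter j D f z.
have mG : moll e F G.
  have [F0 [F1 [dF gE]]] := mg.
  exists (fun z => -1 * F0 z), (fun z => -1 * F1 z); split; first exact: C2Z.
  by move=> z; rewrite /G gE /diff2; ring.
have lF : lipschitz_with K F.
  by move=> x z; rewrite /F !mulN1r; exact: (lipschitz_with_opp (lD j)).
have mF : moll2 e F y = - m by rewrite /moll2 /diff2 /F /m /moll2 /diff2; ring.
have lin s : 0 <= s -> s <= su -> (forall z, iter k (avg2 (s * r)) (iter j D f) z
     <= iter j.+1 D f z) ->
   g y + k%:R * r ^+ 2 * (s ^+ 2 / 2 * m) <= g' y + k%:R * r ^+ 2 * E.
  move=> s0 ssu le_it.
  (* With both volatilities equal to [s] the scheme is linear; the upper bound applied to [- g] is a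
     lower bound for the averages of [g]. *)
  have := iter_scheme_moll s0 (lexx s) r0 k y e0 K0 lF mG rho0.
  have -> : iter k (scheme s s r) G y = - iter k (avg2 (s * r)) g y.
    rewrite -iter_avg2E; elim: k {IH fine E le_it D lD g' mg' mg m mG F lF mF}y.
      by move=> y; rewrite /= /G mulN1r.
    by move=> k IH y /=; rewrite /avg2 !IH; field.
  rewrite mF (Gfun_max s0 (lexx s)) maxxx.
  have := moll_le e0 le_it (moll_iter_avg2 (s * r) k mg e0) mg' y.
  have kr : 0 <= k%:R * r ^+ 2 by rewrite mulr_ge0 ?sqr_ge0.
  have C0 : 0 <= 4 * K / e ^+ 2 by rewrite divr_ge0 ?sqr_ge0// mulr_ge0.
  have h3 : 4 * K / e ^+ 2 * s ^+ 3 * r / 2 <= 4 * K / e ^+ 2 * su ^+ 3 * r / 2.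
    rewrite ler_pM2r ?invr_gt0// ler_wpM2r// ler_wpM2l// lerXn2r ?nnegrE//.
  have s2 : s ^+ 2 <= su ^+ 2 by rewrite ler_sqr ?nnegrE.
  have h4 : s ^+ 2 / 2 * (4 * K / e ^+ 2) *
      (rho / 2 + s ^+ 2 * (k%:R * r ^+ 2) / (2 * rho)) <=
      su ^+ 2 / 2 * (4 * K / e ^+ 2) *
      (rho / 2 + su ^+ 2 * (k%:R * r ^+ 2) / (2 * rho)).
    have r20 : 0 < 2 * rho by rewrite mulr_gt0.
    apply: ler_pM.
    - by rewrite mulr_ge0// divr_ge0 ?sqr_ge0.
    - by rewrite addr_ge0// divr_ge0// ?mulr_ge0 ?sqr_ge0// ltW.
    - by rewrite ler_wpM2r// ler_pM2r ?invr_gt0.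
    - by rewrite lerD2l ler_pM2r ?invr_gt0// ler_wpM2r.
  have := ler_wpM2l kr (lerD h3 h4); rewrite /E /block_rate /G /=; lra.
have G1 : g y + k%:R * r ^+ 2 * Gfun sl su m <= g' y + k%:R * r ^+ 2 * E.
  rewrite (Gfun_max sl0 slu) maxr_pMr ?mulr_ge0 ?sqr_ge0// addr_maxr ge_max.
  rewrite lin ?lin//=.
    by move=> z; rewrite /D /coarse le_max lexx orbT.
  by move=> z; rewrite /D /coarse le_max lexx.
move: fine; rewrite -/(block_rate K e rho r k) -/E -[j.+1]addn1 natrD; lra.
Qed.

End SchemeVersusViscosity.

(** Dyadic space steps make each time step [rstep m ^+ 2] an exact multiple of the finer ones, so
    that blocks consist of whole steps. *)
Definition rstep (R : realType) (n : nat) : R := 2^-1 ^+ n.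

Section Steps.
Variable R : realType.
Local Notation rstep := (rstep R).

Lemma rstep_gt0 n : 0 < rstep n.
Proof. by rewrite exprn_gt0// invr_gt0. Qed.

Lemma rstep_le1 n : rstep n <= 1.
Proof. by rewrite exprn_ile1//; lra. Qed.

Lemma rstep_le m n : (m <= n)%N -> rstep n <= rstep m.
Proof. by move=> mn; rewrite /rstep ler_wiXn2l//; lra. Qed.

Lemma rstep_small (d : R) : 0 < d -> exists n0, forall n, (n0 <= n)%N -> rstep n <= d.
Proof.
move=> d0; exists (Num.truncn d^-1).+1 => n n0n.
rewrite /rstep exprVn -[d]invrK lef_pV2 ?posrE ?exprn_gt0 ?invr_gt0//.
have : d^-1 < (Num.truncn d^-1).+1%:R by apply: truncnS_gt.
move=> /ltW/le_trans; apply; rewrite -natrX ler_nat.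
by apply: leq_trans (ltnW (ltn_expl n (ltnSn 1))).
Qed.

Lemma rstep_coarse m n : (m <= n)%N ->
  (4 ^ (n - m))%N%:R * rstep n ^+ 2 = rstep m ^+ 2.
Proof.
move=> mn; rewrite /rstep -!exprM natrX -{2}(subnK mn) mulnDl exprD mulrA.
rewrite [((n - m) * 2)%N]mulnC exprM -exprMn (_ : 4 * _ = 1) ?expr1n ?mul1r//.
by field.
Qed.

End Steps.

(** * Convergence of the scheme to bounded viscosity solutions *)

Section Convergence.
Variables (R : realType) (sl su : R).
Hypotheses (sl0 : 0 <= sl) (slu : sl <= su).
Local Notation S n := (scheme sl su (rstep R n)).
Let su0 : 0 <= su. Proof. exact: le_trans slu. Qed.
Let L0 : 0 <= su ^+ 2 / 2. Proof. by rewrite divr_ge0 ?sqr_ge0. Qed.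

(** One barrier step from time 0. The delay [d] is the same for all [u] and all data with Lipschitz
    constant [K]; this makes the convergence of the scheme uniform over the data met in the backward
    recursion. *)
Lemma subsol_initial (K eps : R) : 0 <= K -> 0 < eps -> exists2 d : R, 0 < d &
  forall (H : R -> R) (u : R -> R -> R) (f : R -> R) (M Mf : R),
    (forall a b, `|H a - H b| <= su ^+ 2 / 2 * `|a - b|) -> H 0 = 0 ->
    subsol H u -> half_plane_continuous u ->
    (forall t y, 0 <= t -> `|u t y| <= M) -> lipschitz_with K f ->
    (forall y, `|f y| <= Mf) -> (forall y, u 0 y <= f y) ->
  forall t y, 0 <= t <= d -> u t y <= f y + eps.
Proof.
move=> K0 eps0.
pose e := eps / (8 * (K + 1)).
have e0 : 0 < e by rewrite divr_gt0// mulr_gt0//; lra.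
have Ke : 4 * K * e <= eps / 2.
  rewrite /e mulrA ler_pdivrMr; last by rewrite mulr_gt0//; lra.
  by have epsK : 0 <= eps * K by [rewrite mulr_ge0// ltW]; lra.
pose C := step_const (su ^+ 2 / 2) K e 1.
have C0 : 0 <= C by exact: step_const_ge0.
pose B := su ^+ 2 / 2 * (2 * K / e) + 1 + C.
have B0 : 0 < B.
  have : 0 <= su ^+ 2 / 2 * (2 * K / e) by exact: (mulr_ge0 L0 (divr_ge0 (mulr_ge0 (ler0n _ 2) K0) (ltW e0))).
  by rewrite /B; lra.
exists (Num.min 1 (eps / 2 / B)).
  by rewrite lt_min ltr01 !divr_gt0.
move=> H u f M Mf HL H0 su_u cu uM lf fM uf t y /andP[t0].
rewrite le_min ler_pdivlMr// => /andP[t1 tB].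
have [g mg] := moll_exists e (lipschitz_with_continuous lf).
have ug z : u 0 z <= g z + 2 * K * e.
  by have := uf z; have := moll_close e0 K0 lf mg z; rewrite ler_norml; lra.
have := subsol_one_step L0 HL su_u cu uM K0 lf fM e0 mg ltr01 (lexx 0) ug y t0.
rewrite add0r -/C => h.
have Hm : H (moll2 e f y) <= su ^+ 2 / 2 * (2 * K / e).
  have := HL (moll2 e f y) 0; rewrite H0 !subr0 => /(le_trans (ler_norm _)).
  by move=> /le_trans; apply; rewrite ler_wpM2l//; exact: moll2_bound.
have : t * (H (moll2 e f y) + 1) <= t * (su ^+ 2 / 2 * (2 * K / e) + 1).
  by rewrite ler_wpM2l// lerD2r.
have : C * t ^+ 2 <= C * t by rewrite ler_wpM2l// expr2 ler_piMl.
have := moll_close e0 K0 lf mg y; rewrite ler_norml.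
rewrite /B in tB; lra.
Qed.

Lemma G_heat_solution_initial (K eps : R) : 0 <= K -> 0 < eps ->
  exists2 d : R, 0 < d & forall (f : R -> R) (u : R -> R -> R) (Mf : R),
    lipschitz_with K f -> (forall y, `|f y| <= Mf) -> G_heat_solution sl su f u ->
  forall t y, 0 <= t <= d -> `|u t y - f y| <= eps.
Proof.
move=> K0 eps0; have [d d0 dP] := subsol_initial K0 eps0.
exists d => // f u Mf lf fM [cu [M uM] u0 usub usup] t y td.
rewrite ler_norml; apply/andP; split; last first.
  have := dP _ u f M Mf (Gfun_lipschitz sl0 slu) (Gfun0 sl su) usub cu uM lf fM.
  by move=> /(_ _ t y td)/wrap[z|]; [rewrite u0 | lra].
have HL a b : `|- Gfun sl su (- a) - - Gfun sl su (- b)| <= su ^+ 2 / 2 * `|a - b|.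
  rewrite -opprD normrN; apply: le_trans (Gfun_lipschitz sl0 slu _ _) _.
  by rewrite -opprD normrN.
have H0 : - Gfun sl su (- 0) = 0 by rewrite oppr0 Gfun0 oppr0.
have cu' : half_plane_continuous (fun t y => - u t y).
  exact: (@cont_opp _ (subspace _)).
have uM' s z : 0 <= s -> `|- u s z| <= M by rewrite normrN; exact: uM.
have fM' z : `|- f z| <= Mf by rewrite normrN.
have := dP _ _ _ M Mf HL H0 (supersolution_subsol usup) cu' uM'
  (lipschitz_with_opp lf) fM'.
by move=> /(_ _ t y td)/wrap[z|]; [rewrite u0 | lra].
Qed.

Lemma scheme_cvg_lower (K t eps : R) : 0 <= K -> 0 <= t -> 0 < eps ->
  exists n0, forall n, (n0 <= n)%N ->
  forall j : nat, `|j%:R * rstep R n ^+ 2 - t| <= rstep R n ^+ 2 ->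
  forall (f : R -> R) (u : R -> R -> R) (Mf : R),
    lipschitz_with K f -> (forall y, `|f y| <= Mf) -> G_heat_solution sl su f u ->
  forall y, u t y <= iter j (S n) f y + eps.
Proof.
move=> K0 t0 eps0.
have eps4 : 0 < eps / 4 by lra.
have [d d0 dP] := G_heat_solution_initial K0 eps4.
pose e := eps / (16 * (K + 1)).
have e0 : 0 < e by rewrite divr_gt0// mulr_gt0//; lra.
have Ke : 4 * K * e <= eps / 4.
  rewrite /e mulrA ler_pdivrMr; last by rewrite mulr_gt0//; lra.
  by have epsK : 0 <= eps * K by [rewrite mulr_ge0// ltW]; lra.
pose eta := eps / (8 * (t + 1)).
have eta0 : 0 < eta by rewrite divr_gt0// mulr_gt0//; lra.
have etaE : (t + 1) * eta = eps / 8 by rewrite /eta; field; rewrite gt_eqF//; lra.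
pose C := step_const (su ^+ 2 / 2) K e eta.
have C0 : 0 <= C by exact: step_const_ge0.
pose C' := 4 * K / e ^+ 2 * su ^+ 3 / 2.
have C'0 : 0 <= C' by rewrite /C' !mulr_ge0 ?invr_ge0 ?exprn_ge0// ltW.
have Ksu : 0 <= K * su by exact: mulr_ge0.
pose B := (t + 1) * (C + C') + K * su + 1.
have tC : 0 <= (t + 1) * (C + C') by rewrite mulr_ge0//; lra.
have B0 : 0 < B by rewrite /B; lra.
have dmin : 0 < Num.min (d / 2) (eps / 8 / B) by rewrite lt_min !divr_gt0.
have [n0 n0P] := rstep_small dmin.
exists n0 => n n0n j jt f u Mf lf fM uf y.
have := n0P n n0n; set r := rstep R n; rewrite le_min !ler_pdivlMr// => /andP[rd rB].
have r0 : 0 < r by exact: rstep_gt0.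
have r1 : r <= 1 by exact: rstep_le1.
have r2 : r ^+ 2 <= r by rewrite expr2 ler_piMl// ltW.
have r20 : 0 < r ^+ 2 by rewrite exprn_gt0.
move: jt; rewrite -/r ler_norml => /andP[jt1 jt2].
have [cu [M uM] u0 usub usup] := uf.
(* The time [j * r^2] may exceed [t] by [r^2]. Dropping one step makes [s] nonnegative, and the
   comparison starts at time [s], where the solution is still close to [f]. *)
set q := j.-1; pose s := t - q%:R * r ^+ 2.
have qj : iter q (scheme sl su r) f y <= iter j (scheme sl su r) f y + K * su * r.
  rewrite /q; case: j {q s jt1 jt2} => [|j] /=.
    by rewrite lerDl mulr_ge0// ltW.
  set w := iter j _ f; have lw : lipschitz_with K w by exact: iter_scheme_lipschitz.
  have := scheme_ge_upper sl su r w y; rewrite /avg2.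
  have sr : 0 <= su * r by rewrite mulr_ge0// ltW.
  have := lw (y + su * r) y; have := lw (y - su * r) y.
  rewrite addrAC subrr add0r addrAC subrr add0r normrN (ger0_norm sr).
  by rewrite !ler_norml -/r; lra.
have qr : q%:R * r ^+ 2 <= t + 1.
  have : q%:R * r ^+ 2 <= j%:R * r ^+ 2 by rewrite ler_pM2r// ler_nat leq_pred.
  by lra.
have s02 : 0 <= s <= 2 * r ^+ 2.
  rewrite /s /q; case: j jt1 jt2 {q s qj qr} => [|j] /=.
    by rewrite !mul0r !subr0 => jt1 jt2; lra.
  by rewrite -[j.+1]addn1 natrD => jt1 jt2; lra.
have sd : 0 <= s <= d by lra.
have us z : u s z <= f z + eps / 4.
  by have := dP f u Mf lf fM uf s z sd; rewrite ler_norml; lra.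
have s0 : 0 <= s by lra.
have := subsol_le_iter_scheme sl0 slu K0 lf fM e0 (ltW r0) usub cu uM eta0 s0 us q y.
rewrite (_ : s + q%:R * r ^+ 2 = t); last by rewrite /s; ring.
have rate : step_rate su K e eta r <= eta + (C + C') * r.
  rewrite /step_rate -/C (_ : _ * r / 2 = C' * r); last by rewrite /C'; ring.
  by have := ler_wpM2l C0 r2; lra.
have rate0 : 0 <= eta + (C + C') * r by exact: (addr_ge0 (ltW eta0) (mulr_ge0 (addr_ge0 C0 C'0) (ltW r0))).
have : q%:R * r ^+ 2 * step_rate su K e eta r <= (t + 1) * (eta + (C + C') * r).
  apply: (@le_trans _ _ (q%:R * r ^+ 2 * (eta + (C + C') * r))).
    by rewrite ler_wpM2l// mulr_ge0// ltW.
  by rewrite ler_wpM2r.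
rewrite /B in rB; rewrite -/r; lra.
Qed.

(** The route is: scheme below coarse scheme below solution. The scales are fixed in the order [e],
    block length [rho^2], [e'], mesh [r]. Taking the square root of the block length as the
    parameter of [block_rate] makes both terms of its last factor of order [rho]. *)
Lemma scheme_cvg_upper (K t eps : R) : 0 <= K -> 0 <= t -> 0 < eps ->
  exists n0, forall n, (n0 <= n)%N ->
  forall j : nat, `|j%:R * rstep R n ^+ 2 - t| <= rstep R n ^+ 2 ->
  forall (f : R -> R) (u : R -> R -> R) (Mf : R),
    lipschitz_with K f -> (forall y, `|f y| <= Mf) -> G_heat_solution sl su f u ->
  forall y, iter j (S n) f y <= u t y + eps.
Proof.
move=> K0 t0 eps0.
have eps8 : 0 < eps / 8 by lra.
have [d d0 dP] := G_heat_solution_initial K0 eps8.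
pose e := eps / (32 * (K + 1)).
have e0 : 0 < e by rewrite divr_gt0// mulr_gt0//; lra.
have Ke : 4 * K * e <= eps / 8.
  rewrite /e mulrA ler_pdivrMr; last by rewrite mulr_gt0//; lra.
  by have epsK : 0 <= eps * K by [rewrite mulr_ge0// ltW]; lra.
have su20 : 0 <= su ^+ 2 by rewrite sqr_ge0.
have Q0 a : 0 <= 4 * K / a ^+ 2 by rewrite divr_ge0 ?sqr_ge0// mulr_ge0.
pose A1 := 4 * K / e ^+ 2 * su ^+ 3 / 2.
have A10 : 0 <= A1 by rewrite /A1 !mulr_ge0 ?invr_ge0 ?exprn_ge0// ltW.
pose A2 := su ^+ 2 / 2 * (4 * K / e ^+ 2).
have A20 : 0 <= A2 by rewrite /A2 mulr_ge0.
pose B1 := (t + 1) * 2 * (A1 + A2 * ((1 + su ^+ 2) / 2)) + K * ((1 + su ^+ 2) / 2) + 1.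
have A2' : 0 <= A2 * ((1 + su ^+ 2) / 2) by rewrite mulr_ge0//; lra.
have K' : 0 <= K * ((1 + su ^+ 2) / 2) by rewrite mulr_ge0//; lra.
have tA : 0 <= (t + 1) * 2 * (A1 + A2 * ((1 + su ^+ 2) / 2)) by rewrite !mulr_ge0//; lra.
have B10 : 0 < B1 by rewrite /B1; lra.
have dmin : 0 < Num.min (d / 2) (eps / 8 / B1) by rewrite lt_min !divr_gt0//; lra.
have [m0 m0P] := rstep_small dmin.
have := m0P m0 (leqnn _); set rho := rstep R m0.
rewrite le_min !ler_pdivlMr// => /andP[rhod rhoB].
have rho0 : 0 < rho by exact: rstep_gt0.
have rho1 : rho <= 1 by exact: rstep_le1.
have rho2 : rho ^+ 2 <= rho by rewrite expr2 ler_piMl// ltW.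
have rho20 : 0 < rho ^+ 2 by rewrite exprn_gt0.
(* There are at most [(t + 1) / rho^2] blocks, each costing [4 K e']. *)
pose e' := eps * rho ^+ 2 / (32 * (K + 1) * (t + 1)).
have e'0 : 0 < e' by rewrite divr_gt0 ?mulr_gt0//; lra.
have Ke' : (t + 1) * (4 * K * e') <= eps / 8 * rho ^+ 2.
  rewrite (_ : _ * _ = K / (K + 1) * (eps / 8 * rho ^+ 2)); last first.
    by rewrite /e'; field; rewrite !gt_eqF//=; lra.
  have K1 : K / (K + 1) <= 1 by rewrite ler_pdivrMr; lra.
  by rewrite ler_piMl// mulr_ge0 ?(ltW rho20)// ltW.
pose eta := eps / (8 * (t + 1)).
have eta0 : 0 < eta by rewrite divr_gt0// mulr_gt0//; lra.
have etaE : (t + 1) * eta = eps / 8 by rewrite /eta; field; rewrite gt_eqF//; lra.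
pose C := step_const (su ^+ 2 / 2) K e' eta.
have C0 : 0 <= C by exact: step_const_ge0.
pose C' := 4 * K / e' ^+ 2 * su ^+ 3 / 2.
have C'0 : 0 <= C' by rewrite /C' !mulr_ge0 ?invr_ge0 ?exprn_ge0// ltW.
pose B := (t + 1) * (C + C') + 1.
have tC : 0 <= (t + 1) * (C + C') by rewrite mulr_ge0//; lra.
have B0 : 0 < B by rewrite /B; lra.
have epsB : 0 < eps / 8 / B by rewrite divr_gt0.
have [n0 n0P] := rstep_small epsB.
exists (maxn m0 n0) => n; rewrite geq_max => /andP[m0n n0n] j jt f u Mf lf fM uf y.
have := n0P n n0n; set r := rstep R n; rewrite ler_pdivlMr// => rB.
have r0 : 0 < r by exact: rstep_gt0.
have r1 : r <= 1 by exact: rstep_le1.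
have rrho : r <= rho by exact: rstep_le.
have r2 : r ^+ 2 <= r by rewrite expr2 ler_piMl// ltW.
have r20 : 0 < r ^+ 2 by rewrite exprn_gt0.
move: jt; rewrite -/r ler_norml => /andP[jt1 jt2].
have [cu [M uM] u0 usub usup] := uf.
pose k := (4 ^ (n - m0))%N.
have k0 : (0 < k)%N by rewrite expn_gt0.
have krho : k%:R * r ^+ 2 = rho ^+ 2 by exact: rstep_coarse.
(* As before, [j.-1] keeps the starting time nonnegative. The remaining [rem <= k] steps last at
   most one block and move [f] little, by [iter_scheme_lip_le]. *)
pose q := (j.-1 %/ k)%N; pose rem := (j - q * k)%N.
have qkj1 : (q * k <= j.-1)%N by exact: leq_trunc_div.
have qkj : (q * k <= j)%N by apply: leq_trans qkj1 (leq_pred _).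
have remk : (rem <= k)%N.
  rewrite /rem; case: j {jt1 jt2 qkj rem} @q qkj1 => [//|j] q qkj1 /=.
  have := ltn_ceil j k0; rewrite -/q /= => h.
  by rewrite leq_subLR addnC -mulSn.
pose s := t - q%:R * rho ^+ 2.
have qr2 : q%:R * rho ^+ 2 = (q * k)%N%:R * r ^+ 2 by rewrite -krho natrM mulrA.
have qr : q%:R * rho ^+ 2 <= t + 1.
  have : (q * k)%N%:R * r ^+ 2 <= j%:R * r ^+ 2 by rewrite ler_pM2r// ler_nat.
  by rewrite -qr2; lra.
have s0 : 0 <= s.
  rewrite /s qr2; case: j {qr qr2 s remk rem qkj} @q jt1 jt2 qkj1 => [|j] q jt1 jt2 qkj1.
    by move: qkj1; rewrite leqn0 => /eqP ->; rewrite mul0r subr0.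
  have : (q * k)%N%:R * r ^+ 2 <= j%:R * r ^+ 2 by rewrite ler_pM2r// ler_nat.
  by move: jt2; rewrite -[j.+1]addn1 natrD; lra.
have sd : s <= 2 * rho ^+ 2.
  have : j%:R * r ^+ 2 <= (q * k)%N%:R * r ^+ 2 + k%:R * r ^+ 2.
    by rewrite -mulrDl -natrD ler_pM2r// ler_nat -leq_subLR.
  have : r ^+ 2 <= rho ^+ 2 by rewrite ler_sqr ?nnegrE// ltW.
  by rewrite /s krho -qr2; lra.
have us z : f z <= u s z + eps / 8.
  have sd' : 0 <= s <= d by lra.
  by have := dP f u Mf lf fM uf s z sd'; rewrite ler_norml; lra.
have h1 := iter_coarse_le_supersol sl0 slu k K0 lf fM e'0 (ltW r0) usup cu uM eta0 s0 us q y.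
have h2 := iter_scheme_le_coarse sl0 slu k K0 lf e0 rho0 (ltW r0) q y.
have h3 z : iter rem (scheme sl su r) f z <= f z + eps / 8.
  have := iter_scheme_lip_le r sl0 slu rem z K0 lf rho0.
  have : su ^+ 2 * (rem%:R * r ^+ 2) / (2 * rho) <= su ^+ 2 * rho / 2.
    rewrite ler_pdivrMr ?mulr_gt0//.
    rewrite (_ : su ^+ 2 * rho / 2 * (2 * rho) = su ^+ 2 * rho ^+ 2); last by field.
    by rewrite ler_wpM2l// -krho ler_pM2r// ler_nat.
  move=> /(lerD (lexx (rho / 2)))/(ler_wpM2l K0) => a b.
  apply: (le_trans b); rewrite lerD2l; apply: (le_trans a).
  have := mulr_ge0 tA (ltW rho0); rewrite /B1 in rhoB; lra.
have h4 : iter j (scheme sl su r) f y <= iter (q * k) (scheme sl su r) f y + eps / 8.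
  rewrite -(subnKC qkj) iterD -/rem.
  exact: (iter_scheme_le_addc sl su r (q * k) h3).
rewrite krho in h1 h2; move: h1.
rewrite (_ : s + q%:R * rho ^+ 2 = t); last by rewrite /s; ring.
have rate : step_rate su K e' eta r <= eta + (C + C') * r.
  rewrite /step_rate -/C (_ : _ * r / 2 = C' * r); last by rewrite /C'; ring.
  by have := ler_wpM2l C0 r2; lra.
have rate0 : 0 <= eta + (C + C') * r by exact: (addr_ge0 (ltW eta0) (mulr_ge0 (addr_ge0 C0 C'0) (ltW r0))).
have : q%:R * (rho ^+ 2 * step_rate su K e' eta r) <= (t + 1) * (eta + (C + C') * r).
  rewrite mulrA; apply: (@le_trans _ _ (q%:R * rho ^+ 2 * (eta + (C + C') * r))).
    by rewrite ler_wpM2l// mulr_ge0// ltW.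
  by rewrite ler_wpM2r.
have : q%:R * (4 * K * e') <= eps / 8.
  rewrite -(ler_pM2r rho20) mulrAC; apply: le_trans Ke'.
  exact: (ler_wpM2r (mulr_ge0 (mulr_ge0 (ler0n _ 4) K0) (ltW e'0)) qr).
have blk : block_rate su K e rho r k <= (A1 + A2 * ((1 + su ^+ 2) / 2)) * rho.
  rewrite /block_rate krho -/A2 (_ : _ * r / 2 = A1 * r); last by rewrite /A1; ring.
  rewrite (_ : rho / 2 + su ^+ 2 * rho ^+ 2 / (2 * rho) = (1 + su ^+ 2) / 2 * rho).
    by have := ler_wpM2l A10 rrho; lra.
  by field; rewrite gt_eqF.
have blk0 : 0 <= (A1 + A2 * ((1 + su ^+ 2) / 2)) * rho by exact: (mulr_ge0 (addr_ge0 A10 A2') (ltW rho0)).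
have : q%:R * rho ^+ 2 * (2 * block_rate su K e rho r k) <=
    (t + 1) * (2 * ((A1 + A2 * ((1 + su ^+ 2) / 2)) * rho)).
  apply: (@le_trans _ _ (q%:R * rho ^+ 2 * (2 * ((A1 + A2 * ((1 + su ^+ 2) / 2)) * rho)))).
    by apply: (ler_wpM2l (mulr_ge0 (ler0n _ q) (ltW rho20))); rewrite ler_pM2l.
  exact: (ler_wpM2r (mulr_ge0 (ler0n _ 2) blk0) qr).
have Krho : 0 <= K * ((1 + su ^+ 2) / 2) * rho by exact: (mulr_ge0 K' (ltW rho0)).
rewrite /B in rB; rewrite /B1 in rhoB; rewrite -/r; lra.
Qed.

Lemma scheme_cvg (K t eps : R) : 0 <= K -> 0 <= t -> 0 < eps ->
  exists n0, forall n, (n0 <= n)%N ->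
  forall j : nat, `|j%:R * rstep R n ^+ 2 - t| <= rstep R n ^+ 2 ->
  forall (f : R -> R) (u : R -> R -> R) (Mf : R),
    lipschitz_with K f -> (forall y, `|f y| <= Mf) -> G_heat_solution sl su f u ->
  forall y, `|iter j (S n) f y - u t y| <= eps.
Proof.
move=> K0 t0 eps0.
have [n1 n1P] := scheme_cvg_lower K0 t0 eps0.
have [n2 n2P] := scheme_cvg_upper K0 t0 eps0.
exists (maxn n1 n2) => n; rewrite geq_max => /andP[a b] j jt f u Mf lf fM uf y.
have := n1P n a j jt f u Mf lf fM uf y; have := n2P n b j jt f u Mf lf fM uf y.
by rewrite ler_norml; lra.
Qed.

End Convergence.

(** * Controlled binary walks *)

Section WalkOperators.
Variables (R : realType) (s1 s2 r : R).
Implicit Types (F G : seq R -> R) (l : seq R) (al : seq R -> bool).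

Definition wavg (s : R) F l : R :=
  (F (rcons l (s * r)) + F (rcons l (- (s * r)))) / 2.

(* The state of the walk is the list of its past increments. *)
Definition wstep F : seq R -> R := fun l => Num.max (wavg s1 F l) (wavg s2 F l).

Definition lstep al F : seq R -> R :=
  fun l => wavg (if al l then s2 else s1) F l.

Lemma wavg_le s F G l : (forall x, F (rcons l x) <= G (rcons l x)) ->
  wavg s F l <= wavg s G l.
Proof.
by move=> FG; rewrite /wavg; have := FG (s * r); have := FG (- (s * r)); lra.
Qed.

Lemma iter_wstep_le k F G l :
  (forall l', size l' = k -> F (l ++ l') <= G (l ++ l')) ->
  iter k wstep F l <= iter k wstep G l.
Proof.
elim: k l => [|k IH] l FG; first by have := FG [::] erefl; rewrite cats0.
have ih x : iter k wstep F (rcons l x) <= iter k wstep G (rcons l x).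
  by apply: IH => l' sl'; rewrite cat_rcons; apply: FG; rewrite /= sl'.
by rewrite /= /wstep ge_max !le_max !wavg_le// orbT.
Qed.

Lemma eq_iter_wstep k F G l :
  (forall l', size l' = k -> F (l ++ l') = G (l ++ l')) ->
  iter k wstep F l = iter k wstep G l.
Proof.
by move=> FG; apply/eqP; rewrite eq_le !iter_wstep_le// => l' /FG ->.
Qed.

Lemma iter_wstep_addc k F c l :
  iter k wstep (fun l => F l + c) l = iter k wstep F l + c.
Proof.
elim: k l => [//|k IH] l /=; rewrite /wstep addr_maxl.
by congr (Num.max _ _); rewrite /wavg !IH; field.
Qed.

Lemma iter_wstep_cst k c l : iter k wstep (fun=> c) l = c.
Proof.
elim: k l => [//|k IH] l /=; rewrite /wstep /wavg !IH.
by rewrite (_ : (c + c) / 2 = c) ?maxxx//; field.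
Qed.

Lemma iter_wstepD k F G l :
  iter k wstep (fun l => F l + G l) l <= iter k wstep F l + iter k wstep G l.
Proof.
elim: k l => [//|k IH] l /=; rewrite {1}/wstep.
have h s : wavg s (iter k wstep (fun l => F l + G l)) l <=
    wavg s (iter k wstep F) l + wavg s (iter k wstep G) l.
  by rewrite /wavg; have := IH (rcons l (s * r)); have := IH (rcons l (- (s * r))); lra.
rewrite ge_max; apply/andP; split; apply: (le_trans (h _)); apply: lerD;
  by rewrite /wstep le_max lexx ?orbT.
Qed.

Lemma iter_lstepD al k F G l :
  iter k (lstep al) (fun l => F l + G l) l =
  iter k (lstep al) F l + iter k (lstep al) G l.
Proof. by elim: k l => [//|k IH] l /=; rewrite /lstep /wavg !IH; field. Qed.

Lemma iter_lstepZ al k F c l :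
  iter k (lstep al) (fun l => c * F l) l = c * iter k (lstep al) F l.
Proof. by elim: k l => [//|k IH] l /=; rewrite /lstep /wavg !IH; field. Qed.

Lemma iter_lstep_cst al k c l : iter k (lstep al) (fun=> c) l = c.
Proof. by elim: k l => [//|k IH] l /=; rewrite /lstep /wavg !IH; field. Qed.

Lemma iter_lstep_le_wstep al k F l : iter k (lstep al) F l <= iter k wstep F l.
Proof.
elim: k l => [//|k IH] l /=; apply: (@le_trans _ _ (lstep al (iter k wstep F) l)).
  by apply: wavg_le => x; exact: IH.
by rewrite /lstep /wstep le_max; case: (al l); rewrite lexx ?orbT.
Qed.

Lemma iter_lstep_le al k F G l : (forall l, F l <= G l) ->
  iter k (lstep al) F l <= iter k (lstep al) G l.
Proof.
move=> FG; elim: k l => [//|k IH] l /=; by apply: wavg_le => x; exact: IH.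
Qed.

(** Dynamic programming: at history [l] the strategy compares the two averages of the value with
    [N - size l - 1] steps to go. The horizon is fixed in advance, so the length of the history
    tells how many steps remain. *)
Lemma optimal_strategy (N : nat) F : exists al, forall k l,
  (size l + k)%N = N -> iter k (lstep al) F l = iter k wstep F l.
Proof.
exists (fun l => let F' := iter (N - (size l).+1) wstep F in
  wavg s1 F' l <= wavg s2 F' l) => k.
elim: k => [//|k IH] l lN /=.
have E : (N - (size l).+1 = k)%N by rewrite -lN addnS -addSn addKn.
rewrite /lstep /= E.
set b := wavg s1 _ l <= wavg s2 _ l.
have e s : wavg s (iter k (lstep (fun l => let F' := iter (N - (size l).+1) wstep F in
   wavg s1 F' l <= wavg s2 F' l)) F) l = wavg s (iter k wstep F) l.
  by rewrite /wavg !IH// size_rcons -lN addnS addSn.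
rewrite e /wstep; case: (boolP b) => [h|]; first by rewrite max_r.
by rewrite -ltNge => /ltW h; rewrite max_l.
Qed.

Definition psum l (k : nat) : R := \sum_(i < k) nth 0 l i.

Lemma psum_cat l l' k : (k <= size l)%N -> psum (l ++ l') k = psum l k.
Proof.
move=> kl; apply: eq_bigr => i _; rewrite nth_cat.
by rewrite (leq_trans (ltn_ord i) kl).
Qed.

Lemma psum_rcons_last l x : psum (rcons l x) (size l).+1 = psum l (size l) + x.
Proof.
rewrite /psum big_ord_recr /= nth_rcons ltnn eqxx; congr (_ + _).
by rewrite -cats1; apply: psum_cat.
Qed.

(** A functional of the displacement since step [a] sees the history only through the present
    displacement, so the operator on lists reduces to the scheme on the line. *)
Lemma iter_wstep_scheme f a k l : (a <= size l)%N ->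
  iter k wstep (fun l' => f (psum l' (size l + k) - psum l' a)) l =
  iter k (scheme s1 s2 r) f (psum l (size l) - psum l a).
Proof.
elim: k l => [|k IH] l al; first by rewrite /= addn0.
have step x : iter k wstep (fun l' => f (psum l' (size l + k.+1) - psum l' a)) (rcons l x)
   = iter k (scheme s1 s2 r) f (psum l (size l) - psum l a + x).
  have := IH (rcons l x); rewrite size_rcons addSnnS => ->; last exact: leqW.
  by rewrite psum_rcons_last -cats1 psum_cat// addrAC.
by rewrite /= /wstep /scheme /wavg /avg2 !step.
Qed.

End WalkOperators.

Section Walk.
Variables (R : realType) (sl su : R).
Hypotheses (sl0 : 0 <= sl) (slu : sl <= su).
Let su0 : 0 <= su. Proof. exact: le_trans slu. Qed.

(** The number of steps of duration [4^-n = rstep n ^+ 2] completed by time [t]. *)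
Definition tick (n : nat) (t : R) : nat := Num.truncn (t * 4 ^+ n).

Definition wpath (n : nat) (l : seq R) (t : R) : R := psum l (tick n t).

Lemma rstep_sq n : rstep R n ^+ 2 = (4 ^+ n)^-1.
Proof.
rewrite /rstep -exprM mulnC exprM -exprVn; congr (_ ^+ _); by field.
Qed.

Lemma tickP n t : 0 <= t ->
  (tick n t)%:R * rstep R n ^+ 2 <= t < (tick n t)%:R * rstep R n ^+ 2 + rstep R n ^+ 2.
Proof.
move=> t0; have p0 : 0 < (4 : R) ^+ n by rewrite exprn_gt0.
rewrite rstep_sq ler_pdivrMr// -[X in _ < _ + X]mul1r -mulrDl ltr_pdivlMr//.
by rewrite natr1 truncn_itv// mulr_ge0// ltW.
Qed.

Lemma tick_le n s t : s <= t -> (tick n s <= tick n t)%N.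
Proof. by move=> st; apply: le_truncn; rewrite ler_wpM2r// exprn_ge0. Qed.

Lemma tick_nat n (p : nat) : tick n p%:R = (p * 4 ^ n)%N.
Proof. by rewrite /tick -natrX -natrM natrK. Qed.

Lemma tick0 n : tick n 0 = 0%N.
Proof. by rewrite /tick mul0r truncn0. Qed.

Lemma tick_diff n s t : 0 <= s -> s <= t ->
  `|(tick n t - tick n s)%N%:R * rstep R n ^+ 2 - (t - s)| <= rstep R n ^+ 2.
Proof.
move=> s0 st; rewrite natrB ?tick_le// mulrBl.
have := tickP n s0; have := tickP n (le_trans s0 st).
by rewrite ler_norml; lra.
Qed.

Definition pincr (s : nat -> R) (m : nat) (x : R -> R) : m.-tuple R :=
  [tuple x (s i.+1) - x (s i) | i < m].

Lemma pincr_rcons s m x :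
  pincr s m.+1 x = rcons_tuple (pincr s m x) (x (s m.+1) - x (s m)).
Proof.
apply: eq_from_tnth => i; rewrite tnth_mktuple (tnth_nth 0) /= nth_rcons size_map.
rewrite size_enum_ord; case: ltngtP => [im|im|im].
- by rewrite (nth_map (Ordinal im)) ?size_enum_ord// nth_enum_ord.
- by have := ltn_ord i; rewrite ltnS leqNgt im.
- by rewrite im.
Qed.

Lemma sum_rcons_tuple (i : nat) (x y : i.-tuple R) (a b : R) :
  \sum_(k < i.+1) `|tnth (rcons_tuple x a) k - tnth (rcons_tuple y b) k| =
  \sum_(k < i) `|tnth x k - tnth y k| + `|a - b|.
Proof.
rewrite big_ord_recr /=; congr (_ + _).
  apply: eq_bigr => k _; rewrite !(tnth_nth 0) /= !nth_rcons !size_tuple.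
  by rewrite ltn_ord.
by rewrite !(tnth_nth 0) /= !nth_rcons !size_tuple ltnn eqxx.
Qed.

Definition backward_step (s : nat -> R) (phi : forall i : nat, i.-tuple R -> R)
    (i : nat) : Prop :=
  forall x : i.-tuple R, exists2 u : R -> R -> R,
    G_heat_solution sl su (fun y => phi i.+1 (rcons_tuple x y)) u
    & phi i x = u (s i.+1 - s i) 0.

Definition lip_bound (K M : R) (i : nat) (f : i.-tuple R -> R) : Prop :=
  (forall x, `|f x| <= M) /\
  (forall x y, `|f x - f y| <= K * \sum_(k < i) `|tnth x k - tnth y k|).

Lemma bounded_lipschitzP (i : nat) (f : i.-tuple R -> R) :
  bounded_lipschitz f -> exists K M, [/\ 0 <= K, 0 <= M & lip_bound K M f].
Proof.
move=> [[M fM] [K fK]]; exists `|K|, `|M|; split => //; split => [x|x y].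
  by apply: le_trans (ler_norm _).
apply: (le_trans (fK x y)); rewrite ler_wpM2r ?ler_norm//.
by apply: sumr_ge0.
Qed.

Lemma lip_bound_lipschitz K M i (f : i.+1.-tuple R -> R) (x : i.-tuple R) :
  lip_bound K M f -> lipschitz_with K (fun y => f (rcons_tuple x y)).
Proof.
move=> [_ fK] a b; apply: (le_trans (fK _ _)); rewrite sum_rcons_tuple.
by rewrite big1 ?add0r// => k _; rewrite subrr normr0.
Qed.

Lemma scheme_backward K (s : nat -> R) phi M i (eps : R) : 0 <= K ->
  s i <= s i.+1 -> backward_step s phi i -> lip_bound K M (phi i.+1) -> 0 < eps ->
  exists n0, forall n, (n0 <= n)%N -> forall j : nat,
   `|j%:R * rstep R n ^+ 2 - (s i.+1 - s i)| <= rstep R n ^+ 2 ->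
   forall x : i.-tuple R,
   `|iter j (scheme sl su (rstep R n)) (fun y => phi i.+1 (rcons_tuple x y)) 0
     - phi i x| <= eps.
Proof.
move=> K0 ss bs lb eps0.
have t0 : 0 <= s i.+1 - s i by rewrite subr_ge0.
have [n0 n0P] := scheme_cvg sl0 slu K0 t0 eps0.
exists n0 => n nn j jt x; have [u uf ->] := bs x.
have [fM _] := lb.
exact: (n0P n nn j jt _ _ M (lip_bound_lipschitz x lb)).
Qed.

(** The scheme is monotone and commutes with adding constants, so it preserves both bounds exactly;
    convergence hands them over from the iterates to [phi i]. The constants do not deteriorate along
    the recursion. *)
Lemma lip_bound_backward K (s : nat -> R) phi M i : 0 <= K ->
  s i <= s i.+1 -> backward_step s phi i -> lip_bound K M (phi i.+1) ->
  lip_bound K M (phi i).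
Proof.
move=> K0 ss bs lb; have [fM fK] := lb.
have t0 : 0 <= s i.+1 - s i by rewrite subr_ge0.
split=> [x|x y].
  apply/ler_addgt0Pr => e e0.
  have [n0 /(_ n0 (leqnn _)) h] := scheme_backward K0 ss bs lb e0.
  have jt : `|(tick n0 (s i.+1 - s i))%:R * rstep R n0 ^+ 2 - (s i.+1 - s i)|
      <= rstep R n0 ^+ 2 by have := tickP n0 t0; rewrite ler_norml; lra.
  have := h _ jt x.
  have := iter_scheme_bounded sl su (rstep R n0) (tick n0 (s i.+1 - s i))
    (fun z => fM (rcons_tuple x z)) 0.
  by rewrite !ler_norml; lra.
set D := \sum_(k < i) _.
have half a b : (forall e, 0 < e -> phi i a - phi i b <= K * D + 2 * e) ->
    phi i a - phi i b <= K * D.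
  move=> h; apply/ler_addgt0Pr => e e0; have := h (e / 2).
  by rewrite mulrCA divff ?mulr1 ?pnatr_eq0//; apply; lra.
have main e : 0 < e -> `|phi i x - phi i y| <= K * D + 2 * e.
  move=> e0.
  have [n0 /(_ n0 (leqnn _)) h] := scheme_backward K0 ss bs lb e0.
  have jt : `|(tick n0 (s i.+1 - s i))%:R * rstep R n0 ^+ 2 - (s i.+1 - s i)|
      <= rstep R n0 ^+ 2 by have := tickP n0 t0; rewrite ler_norml; lra.
  have cmp a b : \sum_(k < i) `|tnth a k - tnth b k| = D -> forall z,
      phi i.+1 (rcons_tuple a z) <= phi i.+1 (rcons_tuple b z) + K * D.
    move=> ab z; have := fK (rcons_tuple a z) (rcons_tuple b z).
    by rewrite sum_rcons_tuple ab subrr normr0 addr0 ler_norml; lra.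
  have yx : \sum_(k < i) `|tnth y k - tnth x k| = D.
    by apply: eq_bigr => k _; rewrite distrC.
  have := h _ jt x; have := h _ jt y.
  set j := tick _ _; set r := rstep R n0.
  have := iter_scheme_le_addc sl su r j (cmp x y erefl) 0.
  have := iter_scheme_le_addc sl su r j (cmp y x yx) 0.
  by rewrite !ler_norml; lra.
rewrite ler_norml; apply/andP; split.
  rewrite lerNl opprB; apply: half => e e0.
  by have := main e e0; rewrite ler_norml; lra.
by apply: half => e e0; have := main e e0; rewrite ler_norml; lra.
Qed.

Lemma lip_bound_chain K (s : nat -> R) phi M m : 0 <= K ->
  (forall i, (i < m)%N -> s i <= s i.+1) ->
  (forall i, (i < m)%N -> backward_step s phi i) -> lip_bound K M (phi m) ->
  forall i, (i <= m)%N -> lip_bound K M (phi i).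
Proof.
move=> K0 ss bs lb i im; rewrite -(subKn im).
have := leq_subr i m; move: (m - i)%N => d.
elim: d => [|d IH] dm; first by rewrite subn0.
have e : (m - d = (m - d.+1).+1)%N by rewrite subnSK.
have lt : (m - d.+1 < m)%N by rewrite -e leq_subr.
have := IH (ltnW dm); rewrite e => lbd.
exact: (lip_bound_backward K0 (ss _ lt) (bs _ lt) lbd).
Qed.

Definition wstepn (n : nat) := wstep sl su (rstep R n).

(** Backward induction over the grid: on one interval only the new increment is random, so
    [iter_wstep_scheme] and the convergence of the scheme apply, uniformly in the earlier
    increments. Each interval costs at most [eps / (m + 1)]. *)
Lemma walk_cond_exp K (s : nat -> R) (phi : forall i : nat, i.-tuple R -> R)
    M m (eps : R) : 0 <= K -> s 0%N = 0 ->
  (forall i, (i < m)%N -> s i <= s i.+1) ->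
  (forall i, (i < m)%N -> backward_step s phi i) -> lip_bound K M (phi m) ->
  0 < eps ->
  exists n0, forall n, (n0 <= n)%N -> forall N, (tick n (s m) <= N)%N ->
  forall j, (j <= m)%N -> forall l, size l = tick n (s j) ->
  `|iter (N - tick n (s j)) (wstepn n) (fun l' => phi m (pincr s m (wpath n l'))) l
    - phi j (pincr s j (wpath n l))| <= eps.
Proof.
move=> K0 s00 ss bs lb eps0.
have lbi := lip_bound_chain K0 ss bs lb.
pose e := eps / m.+1%:R.
have e0 : 0 < e by rewrite divr_gt0.
have [n0 n0P] : exists n0, forall n, (n0 <= n)%N -> forall i, (i < m)%N ->
   forall j : nat,
   `|j%:R * rstep R n ^+ 2 - (s i.+1 - s i)| <= rstep R n ^+ 2 ->
   forall x : i.-tuple R,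
   `|iter j (scheme sl su (rstep R n)) (fun y => phi i.+1 (rcons_tuple x y)) 0
     - phi i x| <= e.
  have : (m <= m)%N by [].
  move: {1 3}m => p; elim: p => [|p IH] pm; first by exists 0%N.
  have [n1 n1P] := IH (ltnW pm).
  have [n2 n2P] := scheme_backward K0 (ss _ pm) (bs _ pm) (lbi _ pm) e0.
  exists (maxn n1 n2) => n; rewrite geq_max => /andP[nn1 nn2] i.
  rewrite ltnS leq_eqVlt => /predU1P[->|ip]; first exact: n2P.
  exact: n1P.
exists n0 => n nn N mN.
have s_ge0 i : (i <= m)%N -> 0 <= s i.
  elim: i => [|i IH] im; first by rewrite s00.
  exact: le_trans (IH (ltnW im)) (ss _ im).
have s_le i : (i <= m)%N -> s i <= s m.
  move=> im; rewrite -(subKn im); have := leq_subr i m; move: (m - i)%N => d.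
  elim: d => [|d IH] dm; first by rewrite subn0.
  apply: le_trans (IH (ltnW dm)).
  have e' : (m - d = (m - d.+1).+1)%N by rewrite subnSK.
  by rewrite e'; apply: ss; rewrite -e' leq_subr.
set X := fun l' => phi m (pincr s m (wpath n l')).
have pincr_cat i l l' : (i <= m)%N -> size l = tick n (s i) ->
    pincr s i (wpath n (l ++ l')) = pincr s i (wpath n l).
  move=> im li; apply: eq_from_tnth => k; rewrite !tnth_mktuple /wpath.
  have tk p : (p <= i)%N -> (tick n (s p) <= size l)%N.
    rewrite li => pi; apply: tick_le.
    rewrite -(subKn pi); have := leq_subr p i; move: (i - p)%N => d.
    elim: d => [|d IH] di; first by rewrite subn0.
    apply: le_trans (IH (ltnW di)).
    have e' : (i - d = (i - d.+1).+1)%N by rewrite subnSK.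
    rewrite e'; apply: ss; rewrite -e'; apply: leq_trans (leq_subr _ _) im.
  by rewrite !psum_cat// tk// ltnW.
suff main : forall d, (d <= m)%N -> forall l, size l = tick n (s (m - d)%N) ->
    `|iter (N - tick n (s (m - d)%N)) (wstepn n) X l
      - phi (m - d)%N (pincr s (m - d) (wpath n l))| <= d%:R * e.
  move=> j jm l lj; have := main (m - j)%N (leq_subr _ _) l.
  rewrite subKn// => /(_ lj)/le_trans; apply.
  rewrite /e mulrA ler_pdivrMr// mulrC ler_pM2l// ler_nat.
  by apply: leq_trans (leq_subr _ _) _.
elim=> [|d IH] dm l ld.
  rewrite subn0 in ld *; rewrite mul0r normr_le0 subr_eq0; apply/eqP.
  transitivity (iter (N - tick n (s m)) (wstepn n) (fun=> X l) l).
    by apply: eq_iter_wstep => l' _; rewrite /X pincr_cat.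
  exact: iter_wstep_cst.
set i := (m - d.+1)%N in ld *.
have e' : (m - d = i.+1)%N by rewrite /i subnSK.
have im : (i < m)%N by rewrite -e' leq_subr.
rewrite e' in IH.
have kk : (tick n (s i) <= tick n (s i.+1))%N by apply: tick_le; exact: ss.
have kN : (tick n (s i.+1) <= N)%N.
  by apply: leq_trans mN; apply: tick_le; exact: s_le.
set k := (tick n (s i.+1) - tick n (s i))%N.
have -> : (N - tick n (s i) = k + (N - tick n (s i.+1)))%N.
  by rewrite /k addnC addnBA// subnK.
rewrite iterD.
set x := pincr s i (wpath n l).
have E l' : size l' = k -> pincr s i.+1 (wpath n (l ++ l')) =
    rcons_tuple x (psum (l ++ l') (size l + k) - psum (l ++ l') (size l)).
  move=> l'k; rewrite pincr_rcons pincr_cat//; last exact: ltnW.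
  by rewrite /wpath ld /k subnKC.
have szl l' : size l' = k -> size (l ++ l') = tick n (s i.+1).
  by move=> l'k; rewrite size_cat ld l'k /k subnKC.
have jt := tick_diff n (s_ge0 _ (ltnW im)) (ss _ im).
have := n0P n nn i im k jt x.
have := iter_wstep_scheme sl su (rstep R n) (fun y => phi i.+1 (rcons_tuple x y)) k
  (leqnn (size l)).
rewrite subrr => <-; rewrite -/(wstepn n).
set f := fun l' => phi i.+1 _.
have up : iter k (wstepn n) (iter (N - tick n (s i.+1)) (wstepn n) X) l <=
    iter k (wstepn n) f l + d%:R * e.
  rewrite -iter_wstep_addc; apply: iter_wstep_le => l' l'k.
  have := IH (ltnW dm) (l ++ l') (szl _ l'k).
  by rewrite /f E// ler_norml; lra.
have lo : iter k (wstepn n) f l <=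
    iter k (wstepn n) (iter (N - tick n (s i.+1)) (wstepn n) X) l + d%:R * e.
  rewrite -iter_wstep_addc; apply: iter_wstep_le => l' l'k.
  have := IH (ltnW dm) (l ++ l') (szl _ l'k).
  by rewrite /f E// ler_norml; lra.
by rewrite -[d.+1]addn1 natrD mulrDl mul1r !ler_norml; lra.
Qed.

End Walk.

(** * Cylinder functionals and limits of walk expectations *)

Section Cylinders.
Variable R : realType.
Implicit Types (F G : (R -> R) -> R) (x y : R -> R) (t : R).

(* The paths are arbitrary functions, so that the functionals apply both to [B]
   and to the step functions [wpath]. *)
Definition cyl t F : Prop := exists (ts : seq R) (K M : R),
  [/\ forall s, s \in ts -> 0 <= s <= t, 0 <= K, forall x, `|F x| <= M &
      forall x y, `|F x - F y| <= K * \sum_(s <- ts) `|x s - y s|].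

Lemma cyl_le t t' F : t <= t' -> cyl t F -> cyl t' F.
Proof.
move=> tt' [ts [K [M [ts0 K0 FM FK]]]]; exists ts, K, M; split => // s /ts0.
by move=> /andP[-> /le_trans]; apply.
Qed.

Lemma cyl_cst t c : cyl t (fun=> c).
Proof.
exists [::], 0, `|c|; split => // x y; by rewrite subrr normr0 mul0r.
Qed.

Lemma cyl_bounded t F : cyl t F -> exists2 M, 0 <= M & forall x, `|F x| <= M.
Proof.
by move=> [ts [K [M [_ _ FM _]]]]; exists M => //; apply: le_trans (FM (fun=> 0)).
Qed.

Lemma cyl_comp t F (L : R) (h : R -> R) : lipschitz_with L h -> cyl t F ->
  cyl t (fun x => h (F x)).
Proof.
move=> lh [ts [K [M [ts0 K0 FM FK]]]].
exists ts, (`|L| * K), (`|h 0| + `|L| * M); split => //.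
- by rewrite mulr_ge0.
- move=> x; have := lh (F x) 0; rewrite subr0.
  have : L * `|F x| <= `|L| * M.
    apply: (@le_trans _ _ (`|L| * `|F x|)).
      by rewrite ler_wpM2r// ler_norm.
    by rewrite ler_wpM2l.
  have := ler_normB (h (F x) - h 0) (- h 0); rewrite opprK subrK normrN; lra.
- move=> x y; apply: (le_trans (lh _ _)).
  apply: (@le_trans _ _ (`|L| * `|F x - F y|)).
    by rewrite ler_wpM2r// ler_norm.
  by rewrite -mulrA ler_wpM2l.
Qed.

Lemma cylD t F G : cyl t F -> cyl t G -> cyl t (fun x => F x + G x).
Proof.
move=> [ts [K [M [ts0 K0 FM FK]]]] [ts' [K' [M' [ts0' K0' FM' FK']]]].
exists (ts ++ ts'), (K + K'), (M + M'); split.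
- by move=> s; rewrite mem_cat => /orP[/ts0|/ts0'].
- exact: addr_ge0.
- by move=> x; apply: (le_trans (ler_normD _ _)); exact: lerD.
- move=> x y; rewrite big_cat /= opprD addrACA.
  apply: (le_trans (ler_normD _ _)).
  set a := \sum_(s <- ts) _; set b := \sum_(s <- ts') _.
  have a0 : 0 <= a by apply: sumr_ge0.
  have b0 : 0 <= b by apply: sumr_ge0.
  have := FK x y; have := FK' x y; rewrite -/a -/b.
  have := mulr_ge0 K0 b0; have := mulr_ge0 K0' a0; lra.
Qed.

Lemma cylM t F G : cyl t F -> cyl t G -> cyl t (fun x => F x * G x).
Proof.
move=> [ts [K [M [ts0 K0 FM FK]]]] [ts' [K' [M' [ts0' K0' FM' FK']]]].
have M0 : 0 <= M by apply: le_trans (FM (fun=> 0)).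
have M'0 : 0 <= M' by apply: le_trans (FM' (fun=> 0)).
exists (ts ++ ts'), (K * M' + K' * M), (M * M'); split.
- by move=> s; rewrite mem_cat => /orP[/ts0|/ts0'].
- by rewrite addr_ge0 ?mulr_ge0.
- by move=> x; rewrite normrM; apply: ler_pM.
- move=> x y; rewrite big_cat /=.
  rewrite (_ : _ - _ = (F x - F y) * G x + F y * (G x - G y)); last ring.
  apply: (le_trans (ler_normD _ _)); rewrite !normrM.
  set a := \sum_(s <- ts) _; set b := \sum_(s <- ts') _.
  have a0 : 0 <= a by apply: sumr_ge0.
  have b0 : 0 <= b by apply: sumr_ge0.
  have h1 : `|F x - F y| * `|G x| <= K * a * M' by apply: ler_pM.
  have h2 : `|F y| * `|G x - G y| <= M * (K' * b) by apply: ler_pM.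
  have := mulr_ge0 (mulr_ge0 K0 M'0) b0; have := mulr_ge0 (mulr_ge0 K0' M0) a0.
  lra.
Qed.

Lemma cyl_scale t (c : R) F : cyl t F -> cyl t (fun x => c * F x).
Proof. by move=> cF; apply: cylM cF; exact: cyl_cst. Qed.

Lemma cylB t F G : cyl t F -> cyl t G -> cyl t (fun x => F x - G x).
Proof.
move=> cF cG; apply: cylD cF _.
rewrite (_ : (fun x => - G x) = fun x => -1 * G x); first exact: cyl_scale.
by apply/funext => x; rewrite mulN1r.
Qed.

Lemma cyl_abs t F : cyl t F -> cyl t (fun x => `|F x|).
Proof.
move=> cF; apply: (@cyl_comp t F 1 (fun a => `|a|)) => // a b.
by rewrite mul1r ler_dist_dist.
Qed.

Lemma cyl_sum t (I : Type) (r : seq I) (F : I -> (R -> R) -> R) :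
  (forall i, cyl t (F i)) -> cyl t (fun x => \sum_(i <- r) F i x).
Proof.
move=> cF; elim: r => [|i r IH].
  rewrite (_ : (fun _ => _) = fun=> 0); first exact: cyl_cst.
  by apply/funext => x; rewrite big_nil.
rewrite (_ : (fun _ => _) = fun x => F i x + \sum_(i <- r) F i x).
  exact: cylD.
by apply/funext => x; rewrite big_cons.
Qed.

End Cylinders.

(** * Limits of bounded sequences along an ultrafilter *)

Section UltraLimit.
Variables (R : realType) (U : set_system nat).
Hypotheses (UU : UltraFilter U) (Uoo : \oo `<=` U).
Implicit Types (a b : nat -> R).

Definition bounded_seq a := exists M, forall n, `|a n| <= M.

Lemma ultra_cvg a : bounded_seq a -> exists l : R, a @ U --> l.
Proof.
move=> [M aM].
have := @segment_compact R (- M) M.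
move=> /(_ (a @ U) (fmap_proper_filter a ultra_proper))[|l [_ cl]].
  rewrite /fmap /=; apply: filterE => n /=; rewrite in_itv /=.
  by have := aM n; rewrite ler_norml.
exists l => V Vl; have [//|UV] := in_ultra_setVsetC (a @^-1` V) UU.
by have [x [/=]] := cl (~` V) V UV Vl.
Qed.

Definition ulim a : R := lim (a @ U).

Lemma ulim_cvg a : bounded_seq a -> a @ U --> ulim a.
Proof. by move=> /ultra_cvg[l al]; rewrite /ulim; apply/cvg_ex; exists l. Qed.

Lemma ulimE a l : a @ U --> l -> ulim a = l.
Proof. by move=> al; apply: cvg_lim al; exact: Rhausdorff. Qed.

Lemma ulimD a b : bounded_seq a -> bounded_seq b ->
  ulim (fun n => a n + b n) = ulim a + ulim b.
Proof.
by move=> /ulim_cvg ca /ulim_cvg cb; apply: ulimE; exact: cvgD.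
Qed.

Lemma ulimZ a c : bounded_seq a -> ulim (fun n => c * a n) = c * ulim a.
Proof.
by move=> /ulim_cvg ca; apply: ulimE; apply: cvgM => //; exact: cvg_cst.
Qed.

Lemma ulim_cst c : ulim (fun=> c) = c.
Proof. by apply: ulimE; exact: cvg_cst. Qed.

Lemma ulim_le a b n0 : bounded_seq a -> bounded_seq b ->
  (forall n, (n0 <= n)%N -> a n <= b n) -> ulim a <= ulim b.
Proof.
move=> ba bb ab.
have ca := ulim_cvg ba; have cb := ulim_cvg bb.
rewrite /ulim; apply: ler_lim.
- by apply/cvg_ex; exists (ulim a).
- by apply/cvg_ex; exists (ulim b).
- by apply: Uoo; exists n0.
Qed.

End UltraLimit.

Section FiniteExpectation.
Variables (R : realType) (W : Type).
Implicit Types (F G : W -> R).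

Definition bounded_fct F := exists M : R, forall x, `|F x| <= M.

(* A finitely additive probability, as a functional on bounded functions. *)
Record fin_expectation (E : (W -> R) -> R) : Prop := FinExpectation {
  fin_exp_add : forall F G, bounded_fct F -> bounded_fct G ->
    E (fun x => F x + G x) = E F + E G;
  fin_exp_scale : forall c F, bounded_fct F -> E (fun x => c * F x) = c * E F;
  fin_exp_le : forall F G, bounded_fct F -> bounded_fct G ->
    (forall x, F x <= G x) -> E F <= E G;
  fin_exp_cst : forall c, E (fun=> c) = c }.

Definition ind (A : W -> Prop) (x : W) : R := (asbool (A x))%:R.

Lemma ind_bounded A : bounded_fct (ind A).
Proof.
by exists 1 => x; rewrite /ind; case: asbool; rewrite ?normr1 ?normr0.
Qed.

Lemma ind_ge0 A x : 0 <= ind A x.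
Proof. by rewrite /ind ler0n. Qed.

Lemma ind_true (A : W -> Prop) x : A x -> ind A x = 1.
Proof. by rewrite /ind => /asboolT ->. Qed.

Lemma ind_le (A : W -> Prop) x c : 0 <= c -> (A x -> 1 <= c) -> ind A x <= c.
Proof.
by move=> c0 Ac; rewrite /ind; case: asboolP => [/Ac //|_].
Qed.

End FiniteExpectation.

Section LimitFunctional.
Variables (R : realType) (sl su : R).
Hypotheses (sl0 : 0 <= sl) (slu : sl <= su).
Let su0 : 0 <= su. Proof. exact: le_trans slu. Qed.
Variables (U : set_system nat) (al : nat -> seq R -> bool).
Hypotheses (UU : UltraFilter U) (Uoo : \oo `<=` U).
Implicit Types (F G : (R -> R) -> R).

(** Walk number [n] runs until time [n], so every cylinder functional is decided by it for [n]
    large. *)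
Definition horizon (n : nat) : nat := (n * 4 ^ n)%N.

Definition walk_exp (n : nat) F : R :=
  iter (horizon n) (lstep sl su (rstep R n) (al n)) (fun l => F (wpath n l)) [::].

Definition walk_supexp (n : nat) F : R :=
  iter (horizon n) (wstepn sl su n) (fun l => F (wpath n l)) [::].

Definition limit_exp F : R := ulim U (fun n => walk_exp n F).

Lemma walk_exp_le n F G : (forall x, F x <= G x) -> walk_exp n F <= walk_exp n G.
Proof. by move=> FG; apply: iter_lstep_le => l; exact: FG. Qed.

Lemma walk_exp_cst n c : walk_exp n (fun=> c) = c.
Proof. exact: iter_lstep_cst. Qed.

Lemma walk_expD n F G :
  walk_exp n (fun x => F x + G x) = walk_exp n F + walk_exp n G.
Proof. exact: (iter_lstepD _ _ _ _ _ (fun l => F (wpath n l))). Qed.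

Lemma walk_expZ n c F : walk_exp n (fun x => c * F x) = c * walk_exp n F.
Proof. exact: (iter_lstepZ _ _ _ _ _ (fun l => F (wpath n l))). Qed.

Lemma walk_exp_le_sup n F : walk_exp n F <= walk_supexp n F.
Proof. exact: iter_lstep_le_wstep. Qed.

Lemma walk_exp_bounded F : bounded_fct F -> bounded_seq (fun n => walk_exp n F).
Proof.
move=> [M FM]; exists M => n; rewrite ler_norml; apply/andP; split.
  rewrite -(walk_exp_cst n (- M)); apply: walk_exp_le => x.
  by have := FM x; rewrite ler_norml; lra.
rewrite -[leRHS](walk_exp_cst n M); apply: walk_exp_le => x.
by have := FM x; rewrite ler_norml; lra.
Qed.

Lemma limit_exp_fin : fin_expectation limit_exp.
Proof.
split.
- move=> F G bF bG; rewrite /limit_exp -ulimD//; try exact: walk_exp_bounded.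
  by congr (ulim _ _); apply/funext => n; exact: walk_expD.
- move=> c F bF; rewrite /limit_exp -ulimZ//; last exact: walk_exp_bounded.
  by congr (ulim _ _); apply/funext => n; exact: walk_expZ.
- move=> F G bF bG FG; apply: (@ulim_le _ _ _ _ _ _ 0%N) => //;
    try exact: walk_exp_bounded.
  by move=> n _; exact: walk_exp_le.
- move=> c; rewrite /limit_exp (_ : (fun n => _) = fun=> c) ?ulim_cst//.
  by apply/funext => n; exact: walk_exp_cst.
Qed.

Lemma tick_horizon n (t : R) : t <= n%:R -> (tick n t <= horizon n)%N.
Proof. by move=> tn; rewrite /horizon -(tick_nat R); exact: tick_le. Qed.

Lemma walk_supexp_increment n (f : R -> R) s t : s <= t -> t <= n%:R ->
  walk_supexp n (fun x => f (x t - x s)) =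
  iter (tick n t - tick n s) (scheme sl su (rstep R n)) f 0.
Proof.
move=> st tn; rewrite /walk_supexp.
have kst := tick_le n st; have ktN := tick_horizon tn.
have -> : horizon n = (tick n s + ((tick n t - tick n s) + (horizon n - tick n t)))%N.
  by rewrite addnA subnKC// subnKC.
rewrite iterD; set c := RHS.
rewrite -(iter_wstep_cst sl su (rstep R n) (tick n s) c [::]).
apply: eq_iter_wstep => l szl /=; rewrite iterD.
have e := iter_wstep_scheme sl su (rstep R n) f (tick n t - tick n s) (leqnn (size l)).
rewrite subrr in e; rewrite /c -e; apply: eq_iter_wstep => l' szl'.
rewrite szl subnKC// -[RHS](iter_wstep_cst sl su (rstep R n) (horizon n - tick n t)
  _ (l ++ l')).
apply: eq_iter_wstep => l'' _; rewrite /wpath.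
have sz : size (l ++ l') = tick n t by rewrite size_cat szl szl' subnKC.
by rewrite !(psum_cat l'') ?sz.
Qed.

(** The right-hand side is the fourth moment [y^4 + 6 v y^2 + 3 v^2] of a Gaussian with mean [y] and
    variance [v = k (su r)^2]; one step of the scheme raises it by no more than an increase of [v]
    by [(su r)^2]. *)
Lemma iter_scheme_quartic r k y : 0 <= r ->
  iter k (scheme sl su r) (fun z => z ^+ 4) y <=
  y ^+ 4 + 6 * (k%:R * (su * r) ^+ 2) * y ^+ 2 + 3 * (k%:R * (su * r) ^+ 2) ^+ 2.
Proof.
move=> r0; elim: k y => [|k IH] y.
  by rewrite /= !mul0r mulr0 mul0r addr0 expr0n /= mulr0 addr0.
rewrite iterS; apply: (le_trans (scheme_le sl su r IH y)).
have a0 : 0 <= (sl * r) ^+ 2 by rewrite sqr_ge0.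
have ab : (sl * r) ^+ 2 <= (su * r) ^+ 2.
  by rewrite ler_sqr ?nnegrE ?mulr_ge0// ler_wpM2r.
set b := (su * r) ^+ 2 in ab *.
have k0 : 0 <= (k%:R : R) by [].
have y0 : 0 <= y ^+ 2 by rewrite sqr_ge0.
have one (a : R) : a ^+ 2 <= b ->
   ((y + a) ^+ 4 + 6 * (k%:R * b) * (y + a) ^+ 2 + 3 * (k%:R * b) ^+ 2 +
   ((y - a) ^+ 4 + 6 * (k%:R * b) * (y - a) ^+ 2 + 3 * (k%:R * b) ^+ 2)) / 2 <=
   y ^+ 4 + 6 * (k.+1%:R * b) * y ^+ 2 + 3 * (k.+1%:R * b) ^+ 2.
  move=> ha; have a20 : 0 <= a ^+ 2 by rewrite sqr_ge0.
  have b0 : 0 <= b by exact: le_trans ha.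
  have h1 : a ^+ 2 * y ^+ 2 <= b * y ^+ 2 by rewrite ler_wpM2r.
  have h2 : a ^+ 2 * a ^+ 2 <= b * b by rewrite ler_pM.
  have h3 : k%:R * b * a ^+ 2 <= k%:R * b * b by rewrite ler_wpM2l// mulr_ge0.
  have h4 : 0 <= b * b by rewrite mulr_ge0.
  by rewrite -[k.+1]addn1 natrD; lra.
by rewrite /scheme /avg2 ge_max; apply/andP; split; apply: one.
Qed.

(* Markov's inequality for the fourth power of the increment *)
Lemma limit_exp_increment s t lam : 0 <= s -> s <= t -> 0 < lam ->
  limit_exp (ind R (fun x => lam < `|x t - x s|)) <=
  12 * su ^+ 4 * (t - s) ^+ 2 / lam ^+ 4.
Proof.
move=> s0; rewrite le_eqVlt => /predU1P[<-|st] lam0.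
  rewrite subrr expr0n /= mulr0 mul0r -[leRHS](fin_exp_cst limit_exp_fin).
  apply: (fin_exp_le limit_exp_fin); [exact: ind_bounded| by exists 0 => x; rewrite normr0|].
  by move=> x; apply: ind_le => //; rewrite subrr normr0; lra.
have ts0 : 0 < t - s by lra.
have [n1 n1P] := rstep_small ts0.
pose n0 := maxn n1 (Num.truncn t).+1.
set B := 12 * _ * _ / _.
rewrite -[leRHS](fin_exp_cst limit_exp_fin) /limit_exp.
apply: (@ulim_le _ _ _ _ _ _ n0) => //.
- apply: walk_exp_bounded; exact: ind_bounded.
- by apply: walk_exp_bounded; exists `|B|.
move=> n; rewrite geq_max => /andP[n1n tn]; rewrite walk_exp_cst.
have tn' : t <= n%:R.
  by apply: (le_trans (ltW (truncnS_gt t))); rewrite ler_nat.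
apply: (@le_trans _ _ (walk_exp n (fun x => lam ^- 4 * (x t - x s) ^+ 4))).
  apply: walk_exp_le => x; apply: ind_le.
    by rewrite mulr_ge0 ?invr_ge0 ?exprn_even_ge0// exprn_ge0// ltW.
  move=> h; rewrite mulrC ler_pdivlMr ?exprn_gt0// mul1r.
  rewrite -[leRHS]ger0_norm ?exprn_even_ge0// normrX lerXn2r ?nnegrE ?(ltW lam0)//.
  exact: ltW.
rewrite walk_expZ mulrC ler_pdivrMr ?exprn_gt0// divfK ?gt_eqF ?exprn_gt0//.
apply: (le_trans (walk_exp_le_sup _ _)).
rewrite (walk_supexp_increment (fun z => z ^+ 4) (ltW st) tn').
have r0 : 0 < rstep R n by exact: rstep_gt0.
apply: (le_trans (iter_scheme_quartic _ _ (ltW r0))).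
rewrite !expr0n /= mulr0 add0r add0r.
have := tick_diff n s0 (ltW st); set k := (_ - _)%N; rewrite ler_norml => /andP[_ kr].
have r1 := rstep_le1 R n.
have r2 : rstep R n ^+ 2 <= t - s.
  apply: le_trans (n1P n n1n); rewrite expr2 ler_piMl// ltW//.
have kr' : 0 <= k%:R * rstep R n ^+ 2 by rewrite mulr_ge0 ?sqr_ge0.
rewrite (_ : 3 * _ = 3 * su ^+ 4 * (k%:R * rstep R n ^+ 2) ^+ 2); last ring.
(* Rounding to ticks adds at most [rstep n ^+ 2 <= t - s] to the elapsed time, which at most doubles
   it: hence [12 = 3 * 2^2]. *)
rewrite (_ : 12 * _ * _ = 3 * su ^+ 4 * (2 * (t - s)) ^+ 2); last ring.
rewrite ler_wpM2l ?mulr_ge0 ?exprn_ge0// ler_sqr ?nnegrE; lra.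
Qed.

Lemma limit_exp_at0 : limit_exp (ind R (fun x => x 0 <> 0)) = 0.
Proof.
rewrite /limit_exp (_ : (fun n => _) = fun=> 0) ?ulim_cst//.
apply/funext => n; rewrite -[RHS](walk_exp_cst n 0) /walk_exp; congr (iter _ _ _ _).
apply/funext => l; rewrite /ind asboolF// /wpath /psum tick0 big_ord0.
by move=> /(_ erefl).
Qed.

End LimitFunctional.

(** * Realisation of finitely additive expectations on path space *)

Section PathTopology.
Variable R : realType.
Implicit Types (w : Omega R).

(** These sets form a countable neighbourhood basis of [w]; with them openness and measurability on
    path space become statements about inequalities. *)
Definition path_close (m : nat) (w w' : Omega R) : Prop :=
  forall s : R, `|s| <= m%:R -> `|B s w' - B s w| < m.+1%:R^-1.

Definition path_val (w : Omega R) : {family compact, R -> R} :=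
  set_val (w : set_type (@C0_paths R)).

Lemma path_val_nbhs w (V : set {family compact, R -> R}) :
  nbhs (path_val w) V -> exists m : nat, forall w', path_close m w w' -> V (path_val w').
Proof.
move=> nV.
pose A (m : nat) : set {family compact, R -> R} :=
  [set g | forall s : R, `|s| <= m%:R -> `|g s - path_val w s| < m.+1%:R^-1].
(* This filter converges to the path uniformly on compact sets, so every neighbourhood contains some
   [A m]. *)
pose F := filter_from [set: nat] A.
have FF : Filter F.
  apply: filter_from_filter; first by exists 0%N.
  move=> i j _ _; exists (maxn i j) => // g gA; split => s sm; apply: lt_le_trans.
  - apply: gA; apply: (le_trans sm); by rewrite ler_nat leq_maxl.
  - by rewrite lef_pV2 ?posrE ?ltr0n// ler_nat ltnS leq_maxl.
  - apply: gA; apply: (le_trans sm); by rewrite ler_nat leq_maxr.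
  - by rewrite lef_pV2 ?posrE ?ltr0n// ler_nat ltnS leq_maxr.
have cF : {family compact, F --> path_val w}.
  apply/fam_cvgP => K cK P /uniform_nbhs[E [entE EP]].
  have [e /= e0 eE] := entE.
  have [M [_ Mb]] := compact_bounded cK.
  pose M1 := `|M| + 1.
  have KM s : K s -> `|s| <= M1 by apply: Mb; rewrite /M1; have := ler_norm M; lra.
  pose m := maxn (Num.truncn M1).+1 (Num.truncn e^-1).+1.
  exists m => // g gA; apply: EP => s Ks; apply: eE => /=.
  rewrite /ball /= distrC; apply: lt_le_trans.
    apply: gA; apply: (le_trans (KM s Ks)); apply: (le_trans (ltW (truncnS_gt M1))).
    by rewrite ler_nat leq_maxl.
  rewrite -[leRHS]invrK lef_pV2 ?posrE ?ltr0n ?invr_gt0//.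
  apply: (le_trans (ltW (truncnS_gt e^-1))); rewrite ler_nat.
  by apply: leq_trans (leq_maxr _ _) (leqnSn _).
have [m _ mV] := cF V nV.
by exists m => w' cw; apply: mV => s sm; exact: cw.
Qed.

Lemma open_pathP (U : set (Omega R)) : @open (path_space R) U <->
  forall w, U w -> exists m : nat, forall w', path_close m w w' -> U w'.
Proof.
split=> [[V oV VU] w Uw|h].
  have Vw : V (path_val w) by rewrite -VU in Uw.
  have [m mV] := path_val_nbhs (open_nbhs_nbhs (conj oV Vw)).
  by exists m => w' /mV; rewrite -VU.
rewrite openE => w /h[m mU]; rewrite /interior.
pose A : set {family compact, R -> R} :=
  [set g | forall s : R, `[- m%:R, m%:R]%classic s -> `|path_val w s - g s| < m.+1%:R^-1].
have nA : nbhs (path_val w) A.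
  apply: (@fam_nbhs R R compact `[- m%:R, m%:R]%classic
     [set xy | `|xy.1 - xy.2| < m.+1%:R^-1]).
    by exists m.+1%:R^-1 => /=; [rewrite invr_gt0 | move=> [a b]].
  exact: segment_compact.
have : nbhs (w : path_space R) (path_val @^-1` A).
  exact: (@initial_continuous _ _ (set_val : set_type (@C0_paths R) -> {family compact, R -> R}) w).
apply: filterS => w' Aw; apply: mU => s sm; rewrite distrC; apply: Aw.
by rewrite /= in_itv /=; move: sm; rewrite ler_norml.
Qed.

Lemma measurable_path_fct d (T : measurableType d) (f : T -> Omega R) :
  (forall U : set (Omega R), @open (path_space R) U -> measurable (f @^-1` U)) ->
  measurable_fun setT f.
Proof.
move=> h; apply: (@measurability d _ T (Omega R) setT f (@open (path_space R) : set (set (Omega R)))).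
  by [].
by move=> _ [U oU <-]; rewrite setTI; exact: h.
Qed.

Lemma open_path_measurable (U : set (Omega R)) :
  @open (path_space R) U -> measurable U.
Proof. by move=> oU; apply: sub_sigma_algebra. Qed.

Lemma B_continuous t : forall w (e : R), 0 < e ->
  exists m : nat, forall w', path_close m w w' -> `|B t w' - B t w| < e.
Proof.
move=> w e e0.
pose m := maxn (Num.truncn `|t|).+1 (Num.truncn e^-1).+1.
exists m => w' cw; apply: lt_le_trans.
  apply: cw; apply: (le_trans (ltW (truncnS_gt `|t|))).
  by rewrite ler_nat leq_maxl.
rewrite -[leRHS]invrK lef_pV2 ?posrE ?ltr0n ?invr_gt0//.
apply: (le_trans (ltW (truncnS_gt e^-1))); rewrite ler_nat.
by apply: leq_trans (leq_maxr _ _) (leqnSn _).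
Qed.

Lemma B_stop s t w : B s (stop t w) = B (Num.min s t) w.
Proof. by []. Qed.

Lemma measurable_stop (t : R) : measurable_fun setT (@stop R t).
Proof.
apply: measurable_path_fct => U /open_pathP oU; apply: open_path_measurable.
apply/open_pathP => w /oU[m mU].
exists (m + (Num.truncn `|t|).+1)%N => w' cw; apply: mU => s sm.
rewrite !B_stop; apply: lt_le_trans.
  apply: cw; rewrite natrD; have := truncnS_gt `|t|.
  have : `|Num.min s t| <= `|s| + `|t|.
    by case: (leP s t) => _; rewrite ?lerDl ?lerDr.
  lra.
by rewrite lef_pV2 ?posrE ?ltr0n// ler_nat ltnS leq_addr.
Qed.

Lemma path_ext w w' : (forall s, B s w = B s w') -> w = w'.
Proof.
move=> e; apply: val_inj; apply/funext => s; exact: e.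
Qed.

End PathTopology.

(** * Real-valued expectations under a probability measure *)

Section RealExpectation.
Context d (T : measurableType d) (R : realType) (P : probability T R).
Implicit Types (f g : T -> R) (A : set T).

Definition integ f : Prop := P.-integrable setT (EFin \o f).

Definition Ex f : R := \int[P]_x f x.

Lemma Ex_EFin f : integ f -> (\int[P]_x (f x)%:E)%E = (Ex f)%:E.
Proof. by move=> fi; rewrite /Ex /Rintegral fineK//; exact: integrable_fin_num. Qed.

Lemma integ_bounded f (M : R) : measurable_fun setT f -> (forall x, `|f x| <= M) ->
  integ f.
Proof.
move=> mf fM; apply: measurable_bounded_integrable => //.
  by rewrite -ge0_fin_numE//; exact: fin_num_measure.
by exists M; split; [exact: num_real | move=> x Mx t _; apply: le_trans (fM t) (ltW Mx)].
Qed.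

Lemma integ_measurable f : integ f -> measurable_fun setT f.
Proof. by move=> /integrableP[/measurable_EFinP]. Qed.

Lemma integ_cst c : integ (fun=> c).
Proof. by apply: (@integ_bounded _ `|c|). Qed.

Lemma integD f g : integ f -> integ g -> integ (fun x => f x + g x).
Proof. by move=> fi gi; exact: (integrableD measurableT fi gi). Qed.

Lemma integB f g : integ f -> integ g -> integ (fun x => f x - g x).
Proof. by move=> fi gi; exact: (integrableB measurableT fi gi). Qed.

Lemma integZ c f : integ f -> integ (fun x => c * f x).
Proof. by move=> fi; exact: (integrableZl measurableT c fi). Qed.

Lemma integ_abs f : integ f -> integ (fun x => `|f x|).
Proof. by move=> fi; exact: (integrable_norm fi). Qed.

Lemma integ_le f g : measurable_fun setT f -> (forall x, `|f x| <= `|g x|) ->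
  integ g -> integ f.
Proof.
move=> mf fg; apply: le_integrable => //; first exact/measurable_EFinP.
by move=> x _ /=; rewrite lee_fin.
Qed.

Lemma integ_sum (I : Type) (r : seq I) (f : I -> T -> R) :
  (forall i, integ (f i)) -> integ (fun x => \sum_(i <- r) f i x).
Proof.
move=> fi; elim: r => [|i r IH].
  by rewrite (_ : (fun _ => _) = fun=> 0); [exact: integ_cst |
    apply/funext => x; rewrite big_nil].
rewrite (_ : (fun _ => _) = fun x => f i x + \sum_(i <- r) f i x).
  exact: integD.
by apply/funext => x; rewrite big_cons.
Qed.

Lemma integM_bounded f g (M : R) : measurable_fun setT f ->
  (forall x, `|f x| <= M) -> integ g -> integ (fun x => f x * g x).
Proof.
move=> mf fM gi; apply: (@integ_le _ (fun x => M * g x)); last exact: integZ.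
  by apply: measurable_funM => //; exact: integ_measurable.
move=> x; rewrite !normrM ler_wpM2r//.
by apply: le_trans (fM x) (ler_norm _).
Qed.

Lemma ExD f g : integ f -> integ g -> Ex (fun x => f x + g x) = Ex f + Ex g.
Proof. by move=> fi gi; rewrite /Ex RintegralD. Qed.

Lemma ExB f g : integ f -> integ g -> Ex (fun x => f x - g x) = Ex f - Ex g.
Proof. by move=> fi gi; rewrite /Ex RintegralB. Qed.

Lemma ExZ c f : integ f -> Ex (fun x => c * f x) = c * Ex f.
Proof. by move=> fi; rewrite /Ex RintegralZl. Qed.

Lemma Ex_cst c : Ex (fun=> c) = c.
Proof. by rewrite /Ex Rintegral_cst//= probability_setT mulr1. Qed.

Lemma Ex_le f g : integ f -> integ g -> (forall x, f x <= g x) -> Ex f <= Ex g.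
Proof. by move=> fi gi fg; apply: le_Rintegral. Qed.

Lemma Ex_ge0 f : (forall x, 0 <= f x) -> 0 <= Ex f.
Proof. by move=> f0; apply: Rintegral_ge0 => x _; exact: f0. Qed.

Lemma Ex_abs f : integ f -> `|Ex f| <= Ex (fun x => `|f x|).
Proof. by move=> fi; exact: le_normr_Rintegral. Qed.

Lemma Ex_sum (I : Type) (r : seq I) (f : I -> T -> R) : (forall i, integ (f i)) ->
  Ex (fun x => \sum_(i <- r) f i x) = \sum_(i <- r) Ex (f i).
Proof.
move=> fi; elim: r => [|i r IH].
  rewrite big_nil (_ : (fun _ => _) = fun=> 0) ?Ex_cst//.
  by apply/funext => x; rewrite big_nil.
rewrite big_cons -IH -ExD//; last exact: integ_sum.
by congr Ex; apply/funext => x; rewrite big_cons.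
Qed.

Lemma Ex_indic A : measurable A -> (Ex \1_A)%:E = P A.
Proof.
move=> mA; rewrite -Ex_EFin; last exact: integrable_indic.
by rewrite integral_indic// setIT.
Qed.

Lemma integ_indic A : measurable A -> integ \1_A.
Proof. by move=> mA; exact: integrable_indic. Qed.

Lemma Ex_ae_eq f g A : measurable A -> P A = 0%E -> integ f -> integ g ->
  (forall x, ~ A x -> f x = g x) -> Ex f = Ex g.
Proof.
move=> mA PA fi gi fg; rewrite /Ex /Rintegral; congr fine.
apply: ae_eq_integral => //; try exact: measurable_int (fi); try exact: measurable_int (gi).
exists A; split => // x /= nfg; apply: contrapT => nA; apply: nfg => _.
by rewrite fg.
Qed.

End RealExpectation.

Section FiniteExpectationFacts.
Variables (R : realType) (W : Type) (E : (W -> R) -> R).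
Hypothesis FE : fin_expectation E.
Implicit Types (F G : W -> R) (A : W -> Prop).

Lemma fin_exp_ge0 F : bounded_fct F -> (forall x, 0 <= F x) -> 0 <= E F.
Proof.
move=> bF F0; rewrite -(fin_exp_cst FE 0); apply: (fin_exp_le FE) => //.
by exists 0 => x; rewrite normr0.
Qed.

Lemma bounded_fctD F G : bounded_fct F -> bounded_fct G ->
  bounded_fct (fun x => F x + G x).
Proof.
move=> [M FM] [M' GM]; exists (M + M') => x.
by apply: (le_trans (ler_normD _ _)); exact: lerD.
Qed.

Lemma bounded_fctZ c F : bounded_fct F -> bounded_fct (fun x => c * F x).
Proof.
by move=> [M FM]; exists (`|c| * M) => x; rewrite normrM ler_wpM2l.
Qed.

Lemma bounded_fct_cst c : bounded_fct (fun _ : W => c : R).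
Proof. by exists `|c|. Qed.

Lemma bounded_fct_abs F : bounded_fct F -> bounded_fct (fun x => `|F x|).
Proof. by move=> [M FM]; exists M => x; rewrite normr_id. Qed.

Lemma bounded_fct_sum (I : Type) (r : seq I) (F : I -> W -> R) :
  (forall i, bounded_fct (F i)) -> bounded_fct (fun x => \sum_(i <- r) F i x).
Proof.
move=> bF; elim: r => [|i r IH].
  by exists 0 => x; rewrite big_nil normr0.
have := bounded_fctD (bF i) IH; congr bounded_fct.
by apply/funext => x; rewrite big_cons.
Qed.

Lemma fin_exp_sum (I : Type) (r : seq I) (F : I -> W -> R) :
  (forall i, bounded_fct (F i)) ->
  E (fun x => \sum_(i <- r) F i x) = \sum_(i <- r) E (F i).
Proof.
move=> bF; elim: r => [|i r IH].
  rewrite big_nil (_ : (fun _ => _) = fun=> 0) ?(fin_exp_cst FE)//.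
  by apply/funext => x; rewrite big_nil.
rewrite big_cons -IH -(fin_exp_add FE)//; last exact: bounded_fct_sum.
by congr E; apply/funext => x; rewrite big_cons.
Qed.

Lemma fin_expB F G : bounded_fct F -> bounded_fct G ->
  E (fun x => F x - G x) = E F - E G.
Proof.
move=> bF bG; rewrite (_ : (fun x => F x - G x) = fun x => F x + -1 * G x).
  rewrite (fin_exp_add FE)// ?(fin_exp_scale FE)// ?mulN1r//.
  exact: bounded_fctZ.
by apply/funext => x; rewrite mulN1r.
Qed.

Lemma fin_exp_abs F : bounded_fct F -> `|E F| <= E (fun x => `|F x|).
Proof.
move=> bF; have bA := bounded_fct_abs bF; rewrite ler_norml; apply/andP; split.
  rewrite lerNl -mulN1r -(fin_exp_scale FE)//.
  apply: (fin_exp_le FE) => //; first exact: bounded_fctZ.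
  by move=> x; rewrite mulN1r -normrN ler_norm.
by apply: (fin_exp_le FE) => // x; exact: ler_norm.
Qed.

Lemma ind_or A A' : E (ind R (fun x => A x \/ A' x)) <= E (ind R A) + E (ind R A').
Proof.
rewrite -(fin_exp_add FE); try exact: ind_bounded.
apply: (fin_exp_le FE); first exact: ind_bounded.
  by apply: bounded_fctD; exact: ind_bounded.
move=> x; apply: ind_le; first by rewrite addr_ge0 ?ind_ge0.
by case=> h; rewrite (ind_true R h) ?lerDl ?lerDr ind_ge0.
Qed.

Lemma ind_exists (I : eqType) (r : seq I) (A : I -> W -> Prop) :
  E (ind R (fun x => exists2 i, i \in r & A i x)) <= \sum_(i <- r) E (ind R (A i)).
Proof.
rewrite -fin_exp_sum; last by move=> i; exact: ind_bounded.
apply: (fin_exp_le FE); first exact: ind_bounded.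
  by apply: bounded_fct_sum => i; exact: ind_bounded.
move=> x; apply: ind_le; first by apply: sumr_ge0 => i _; exact: ind_ge0.
move=> [i ir Ai]; rewrite (big_rem i)//= (ind_true R Ai) lerDl.
by apply: sumr_ge0 => j _; exact: ind_ge0.
Qed.

Lemma ind_sub A A' : (forall x, A x -> A' x) -> E (ind R A) <= E (ind R A').
Proof.
move=> AA'; apply: (fin_exp_le FE); try exact: ind_bounded.
by move=> x; apply: ind_le; [exact: ind_ge0 | by move=> /AA' h; rewrite (ind_true R h)].
Qed.

End FiniteExpectationFacts.

(* Kolmogorov extension for bits: nested subintervals of [0, 1) whose lengths
   are the finitely additive weights of the finite bit patterns. *)
Section Bits.
Variables (R : realType) (W : Type) (E : (W -> R) -> R).
Hypothesis FE : fin_expectation E.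
Variable e : nat -> W -> bool.

Definition unif : probability (measurableTypeR R) R := uniform_prob (@ltr01 R).

Lemma unifE (A : set (measurableTypeR R)) : measurable A ->
  unif A = lebesgue_measure (A `&` `[0, 1]%classic).
Proof.
move=> mA; rewrite -[LHS]/(uniform_prob ltr01 A).
rewrite -[A in LHS]setIT -(integral_indic (uniform_prob ltr01) measurableT mA).
rewrite integral_uniform.
- by rewrite subr0 invr1 mul1e integral_indic.
- by apply/measurable_EFinP; exact: measurable_indic.
- by move=> x; rewrite lee_fin.
Qed.

Lemma unif_itv (a b : R) : 0 <= a -> a <= b -> b <= 1 ->
  unif `[a, b[%classic = (b - a)%:E.
Proof.
move=> a0 ab b1; rewrite unifE//.
rewrite (_ : `[a, b[%classic `&` `[0, 1]%classic = `[a, b[%classic).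
  rewrite lebesgue_measure_itv /= lte_fin.
  by case: ltP => // ba; rewrite (le_anti (introT andP (conj ab ba))) subrr.
by rewrite setIidl// => x /=; rewrite !in_itv /= => /andP[ax xb]; lra.
Qed.

Fixpoint match_bits (s : seq bool) (x : W) : bool :=
  if s is b :: s' then (e (size s') x == b) && match_bits s' x else true.

Definition bit_weight s : R := E (ind R (match_bits s)).

(** Left end of the interval of the pattern [s], the latest bit being the head. Within the parent
    interval [false] takes the left part and [true] the right part. *)
Fixpoint bit_left (s : seq bool) : R :=
  if s is b :: s' then bit_left s' + (if b then bit_weight (false :: s') else 0)
  else 0.

Fixpoint bit_list (k : nat) (u : R) : seq bool :=
  if k is k'.+1 then
    (bit_left (bit_list k' u) + bit_weight (false :: bit_list k' u) <= u)
      :: bit_list k' u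
  else [::].

Lemma bit_weight_ge0 s : 0 <= bit_weight s.
Proof. apply: (fin_exp_ge0 FE); [exact: ind_bounded | exact: ind_ge0]. Qed.

Lemma bit_weight_nil : bit_weight [::] = 1.
Proof.
rewrite /bit_weight -[RHS](fin_exp_cst FE 1); congr E; apply/funext => x.
exact: ind_true.
Qed.

Lemma bit_weight_split s :
  bit_weight s = bit_weight (false :: s) + bit_weight (true :: s).
Proof.
rewrite /bit_weight -(fin_exp_add FE); try exact: ind_bounded.
congr E; apply/funext => x; rewrite /ind /= !asboolb.
by case: (e _ x); rewrite /= ?addr0 ?add0r.
Qed.

Lemma bit_list_eq u s : 0 <= u < 1 ->
  (bit_list (size s) u == s) = (bit_left s <= u < bit_left s + bit_weight s).
Proof.
move=> u01; elim: s => [|b s IH]; first by rewrite /= bit_weight_nil add0r u01 eqxx.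
move: IH; rewrite /= eqseq_cons.
case: (eqVneq (bit_list (size s) u) s) => [->|ne] IH.
  rewrite andbT; have : bit_left s <= u < bit_left s + bit_weight s by rewrite -IH.
  rewrite bit_weight_split => /andP[lu ul].
  case: b; first by rewrite eqb_id -addrA ul andbT.
  by rewrite addr0 lu /= eqbF_neg -ltNge.
rewrite andbF; apply/esym/negbTE.
apply/negP => /andP[lu ul].
suff : bit_left s <= u < bit_left s + bit_weight s by rewrite -IH.
have := bit_weight_ge0 (false :: s); have := bit_weight_ge0 (true :: s).
rewrite [bit_weight s]bit_weight_split.
by case: b lu ul => lu ul; lra.
Qed.

Lemma bit_left_range s : 0 <= bit_left s /\ bit_left s + bit_weight s <= 1.
Proof.
elim: s => [|b s [l0 l1]]; first by rewrite /= bit_weight_nil add0r.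
rewrite bit_weight_split in l1.
have := bit_weight_ge0 (false :: s); have := bit_weight_ge0 (true :: s).
by case: b => /= h1 h2; split; lra.
Qed.

Lemma measurable_bit_list k s : measurable [set u : measurableTypeR R | bit_list k u = s].
Proof.
elim: k s => [|k IH] s /=.
  case: s => [|b s].
    by rewrite (_ : [set _ | _] = setT)//; apply/seteqP.
  by rewrite (_ : [set _ | _] = set0)//; apply/seteqP; split.
case: s => [|b s]; first by rewrite (_ : [set _ | _] = set0)//; apply/seteqP; split.
rewrite (_ : [set u | _] = [set u : measurableTypeR R | bit_list k u = s] `&`
   [set u : measurableTypeR R | (bit_left s + bit_weight (false :: s) <= u) = b]).
  apply: measurableI => //.
  set c := _ + _; case: b.
    rewrite (_ : [set _ | _] = `[c, +oo[%classic)//.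
    by apply/seteqP; split => u /=; rewrite in_itv /= andbT.
  rewrite (_ : [set _ | _] = `]-oo, c[%classic)//.
  apply/seteqP; split => u /=; rewrite in_itv /= ltNge.
    by move=> ->.
  by move=> /negbTE.
by apply/seteqP; split => u /= [] => [<- <-//|->]; move=> <-.
Qed.

Lemma unif_bit_list s :
  unif [set u : measurableTypeR R | bit_list (size s) u = s] = (bit_weight s)%:E.
Proof.
have [l0 l1] := bit_left_range s; have w0 := bit_weight_ge0 s.
have ll : bit_left s <= bit_left s + bit_weight s by lra.
rewrite (_ : (bit_weight s) = bit_left s + bit_weight s - bit_left s); last ring.
rewrite -(unif_itv l0 ll l1) !unifE//; last exact: measurable_bit_list.
set A := [set u | _]; set I : set (measurableTypeR R) := `[_, _[%classic.
have mA : measurable (A `&` `[0, 1]%classic).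
  by apply: measurableI => //; exact: measurable_bit_list.
have mI : measurable (I `&` `[0, 1]%classic).
  by apply: measurableI; exact: measurable_itv.
have e01 u : 0 <= u < 1 -> A u <-> I u.
  move=> u01; rewrite /A /I /= in_itv /= -bit_list_eq//.
  by split=> [->|/eqP//].
apply/eqP; rewrite eq_le; apply/andP; split.
  (* The characterisation of [bit_list] covers [[0, 1)] only; the end point 1 is added as a null
     set. *)
  apply: (@le_trans _ _ (lebesgue_measure ((I `&` `[0, 1]%classic) `|` [set 1]))).
    apply: le_measure; rewrite ?inE//; first exact: measurableU.
    move=> u [Au]; rewrite /= in_itv /= => /andP[u0 u1].
    have [->|ne] := eqVneq u 1; first by right.
    left; split; last by rewrite u0 u1.
    by apply/e01 => //; rewrite u0 lt_neqAle ne u1.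
  apply: (le_trans (measureU2 _ _ _)) => //.
  by rewrite [X in (_ + X <= _)%E](@lebesgue_measure_set1 R 1) adde0.
apply: le_measure; rewrite ?inE// => u [Iu u01]; split => //.
apply/e01 => //; move: Iu; rewrite /I /= in_itv /=; lra.
Qed.

Definition bit (i : nat) (u : R) : bool := head false (bit_list i.+1 u).

Definition bit_rev (b : nat -> bool) (k : nat) : seq bool := rev (mkseq b k).

Lemma bit_revS b k : bit_rev b k.+1 = b k :: bit_rev b k.
Proof. by rewrite /bit_rev /mkseq -addn1 iotaD map_cat rev_cat. Qed.

Lemma bit_listE k u : bit_list k u = bit_rev (bit^~ u) k.
Proof. by elim: k => // k IH; rewrite bit_revS -IH /bit. Qed.

Lemma match_bitsE s x : match_bits s x = (s == bit_rev (e^~ x) (size s)).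
Proof.
elim: s => [|b s IH] //=; rewrite IH bit_revS eqseq_cons eq_sym.
by [].
Qed.

Definition depends_on_bits (V : Type) (k : nat) (G : (nat -> bool) -> V) : Prop :=
  forall b b', (forall i, (i < k)%N -> b i = b' i) -> G b = G b'.

Lemma depends_on_bits_rev V k (G : (nat -> bool) -> V) b : depends_on_bits k G ->
  G b = G (fun i => nth false (rev (bit_rev b k)) i).
Proof. by move=> dG; apply: dG => i ik; rewrite revK nth_mkseq. Qed.

Lemma bits_decomp (k : nat) (G : (nat -> bool) -> R) (b : nat -> bool) :
  depends_on_bits k G -> G b = \sum_(s : k.-tuple bool)
    G (fun i => nth false (rev s) i) * ((bit_rev b k == s)%:R).
Proof.
move=> dG.
have sz : size (bit_rev b k) == k by rewrite /bit_rev size_rev size_mkseq.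
rewrite (bigD1 (Tuple sz))//= eqxx mulr1 big1 ?addr0.
  exact: depends_on_bits_rev.
move=> s ns; case: eqP => [h|]; last by rewrite mulr0.
by exfalso; move/eqP: ns; apply; apply: val_inj; rewrite /= h.
Qed.

(** A functional of finitely many bits is a finite sum over patterns, so finite additivity of [E] is
    enough to identify its expectation with an integral over [[0, 1]]. *)
Lemma unif_bits_finite k (G : (nat -> bool) -> R) : depends_on_bits k G ->
  [/\ measurable_fun setT (fun u : measurableTypeR R => G (bit^~ u)),
      integ unif (fun u => G (bit^~ u)) &
      Ex unif (fun u => G (bit^~ u)) = E (fun x => G (e^~ x))].
Proof.
move=> dG.
have eqU : (fun u => G (bit^~ u)) = fun u => \sum_(s : k.-tuple bool)
    G (fun i => nth false (rev s) i) * \1_[set u | bit_list (size s) u = s] u.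
  apply/funext => u; rewrite (bits_decomp _ dG); apply: eq_bigr => s _.
  rewrite -bit_listE indicE; congr (_ * _%:R).
  congr (nat_of_bool _); apply/idP/idP => [/eqP h|].
    by rewrite inE /= size_tuple.
  by rewrite inE /= size_tuple => ->.
have iU (s : k.-tuple bool) : integ unif (fun u => G (fun i => nth false (rev s) i) *
    \1_[set u | bit_list (size s) u = s] u).
  apply: integZ; apply: integ_indic; exact: measurable_bit_list.
have iG : integ unif (fun u => G (bit^~ u)) by rewrite eqU; exact: integ_sum.
split => //; first exact: integ_measurable iG.
rewrite eqU Ex_sum// (_ : (fun x => G (e^~ x)) = fun x => \sum_(s : k.-tuple bool)
    G (fun i => nth false (rev s) i) * ind R (match_bits s) x); last first.
  apply/funext => x; rewrite (bits_decomp _ dG); apply: eq_bigr => s _.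
  by rewrite /ind asboolb match_bitsE size_tuple eq_sym.
rewrite (fin_exp_sum FE); last by move=> s; apply: bounded_fctZ; exact: ind_bounded.
apply: eq_bigr => s _; rewrite ExZ; last by apply: integ_indic; exact: measurable_bit_list.
rewrite (fin_exp_scale FE); last exact: ind_bounded.
congr (_ * _); apply: EFin_inj; rewrite Ex_indic; last exact: measurable_bit_list.
exact: unif_bit_list.
Qed.

End Bits.

Section DominatedConvergence.
Context d (T : measurableType d) (R : realType) (P : probability T R).

Lemma Ex_dominated_cvg (f_ : nat -> T -> R) (f g : T -> R) (A : set T) :
  (forall n, measurable_fun setT (f_ n)) -> measurable_fun setT f -> integ P g ->
  measurable A -> P A = 0%E -> (forall x, ~ A x -> f_ n x @[n --> \oo] --> f x) ->
  (forall n x, ~ A x -> `|f_ n x| <= g x) ->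
  [/\ forall n, integ P (f_ n), integ P f & Ex P (f_ n) @[n --> \oo] --> Ex P f].
Proof.
move=> mf_ mf gi mA PA cf bf.
have mEf n : measurable_fun setT (EFin \o f_ n) by exact/measurable_EFinP.
have mEf' : measurable_fun setT (EFin \o f) by exact/measurable_EFinP.
have ae_b n : {ae P, forall x, setT x -> (`|(EFin \o f_ n) x| <= (EFin \o g) x)%E}.
  exists A; split => // x /= nfg; apply: contrapT => nA; apply: nfg => _.
  by rewrite lee_fin; exact: bf.
have ae_g : {ae P, forall x, forall n, setT x -> (`|(EFin \o f_ n) x| <= (EFin \o g) x)%E}.
  exists A; split => // x /= nfg; apply: contrapT => nA; apply: nfg => n _.
  by rewrite lee_fin; exact: bf.
have ae_c : {ae P, forall x, setT x -> (EFin \o f_ n) x @[n --> \oo] --> (EFin \o f) x}.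
  exists A; split => // x /= nfg; apply: contrapT => nA; apply: nfg => _.
  by apply: cvg_EFin; [exact: nearW | exact: cf].
have [fi _ cE] := dominated_convergence measurableT mEf mEf' ae_c gi ae_g.
have fin n : integ P (f_ n).
  have [/measurable_EFinP mg _] := integrableP _ _ _ gi.
  have mg' : measurable_fun setT (EFin \o g) by exact/measurable_EFinP.
  have mgn : measurable_fun setT (fun x => (`|(EFin \o f_ n) x|)%E).
    exact: measurableT_comp.
  apply/integrableP; split => //.
  apply: (@le_lt_trans _ _ (\int[P]_x `|(EFin \o g) x|)%E).
    apply: ae_ge0_le_integral => //; first exact: measurableT_comp.
    apply: filterS (ae_b n) => x h _; apply: (le_trans (h Logic.I)).
    exact: lee_abs.
  by have /integrableP[] := gi.
rewrite (_ : (\int[P]_x (EFin \o f) x)%E = (Ex P f)%:E) in cE; last exact: Ex_EFin.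
by split => //; move/fine_cvgP : cE => [_].
Qed.

End DominatedConvergence.

Section CylinderMeasurable.
Variable R : realType.

Lemma cyl_measurable (t : R) (F : (R -> R) -> R) : cyl t F ->
  measurable_fun setT (fun w : Omega R => F (fun s => B s w)).
Proof.
move=> [ts [K [M [_ K0 _ FK]]]].
apply: (@measurability _ _ (Omega R) R setT _ (@measurable_realfun.RGenOInfty.G R)).
  exact: measurable_realfun.RGenOInfty.measurableE.
move=> _ [_ [a ->] <-]; rewrite setTI; apply: open_path_measurable.
apply/open_pathP => w; rewrite /= in_itv /= andbT => aw.
have e0 : 0 < F (fun s => B s w) - a by rewrite subr_gt0.
have : exists m : nat, forall w', path_close m w w' ->
    K * \sum_(s <- ts) `|B s w' - B s w| < F (fun s => B s w) - a.
  have [e ee0 Ke] : exists2 e : R, 0 < e & K * e < F (fun s => B s w) - a.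
    exists ((F (fun s => B s w) - a) / (K + 1)); first by rewrite divr_gt0//; lra.
    rewrite mulrA ltr_pdivrMr; last by rewrite ltr_wpDl.
    by rewrite [ltRHS]mulrC ltr_pM2r// ltrDl.
  have [m hm] : exists m : nat, forall w', path_close m w w' ->
      \sum_(s <- ts) `|B s w' - B s w| <= e.
    elim: ts e ee0 {FK Ke} => [|s ts IH] e ee0.
      by exists 0%N => w' _; rewrite big_nil ltW.
    have e2 : 0 < e / 2 by rewrite divr_gt0.
    have [m1 h1] := IH _ e2; have [m2 h2] := B_continuous s w e2.
    have mono p q w' : (p <= q)%N -> path_close q w w' -> path_close p w w'.
      move=> pq cw r rp; apply: lt_le_trans.
        by apply: cw; apply: (le_trans rp); rewrite ler_nat.
      by rewrite lef_pV2 ?posrE// ler_nat ltnS.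
    exists (maxn m1 m2) => w' cw; rewrite big_cons.
    have := h1 w' (mono _ _ _ (leq_maxl _ _) cw).
    have := h2 w' (mono _ _ _ (leq_maxr _ _) cw).
    lra.
  exists m => w' /hm h1; apply: le_lt_trans Ke; exact: ler_wpM2l.
move=> [m hm]; exists m => w' /hm h1; rewrite /= in_itv /= andbT.
by have := FK (fun s => B s w') (fun s => B s w); rewrite ler_norml; lra.
Qed.

Lemma cyl_integ (Q : probability (Omega R) R) (t : R) (F : (R -> R) -> R) : cyl t F ->
  integ Q (fun w => F (fun s => B s w)).
Proof.
move=> cF; have [M _ FM] := cyl_bounded cF.
by apply: (@integ_bounded _ _ _ _ _ M); [exact: cyl_measurable cF | move=> x; exact: FM].
Qed.

End CylinderMeasurable.

Section GeometricRate.
Variable R : realType.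

(** The ratio makes [lrate] summable while its fourth power decays more slowly than [2^-k]: at most
    [8^k] increments, each exceeding [lrate k] with weight at most a multiple of
    [16^-k / lrate k ^+ 4], then have a summable total. *)
Definition lrate (k : nat) : R := (9 / 10) ^+ k.

Lemma lrate_gt0 k : 0 < lrate k.
Proof. by rewrite exprn_gt0//; lra. Qed.

Lemma lrateS k : lrate k.+1 = 9 / 10 * lrate k.
Proof. by rewrite /lrate exprS. Qed.

Lemma lrate_small (e : R) : 0 < e -> exists n0, forall n, (n0 <= n)%N -> lrate n <= e.
Proof.
move=> e0.
have /cvgrPdist_le/(_ _ e0)[n0 _ h] : (fun n => lrate n) @ \oo --> 0.
  by apply: cvg_expr; rewrite ger0_norm; lra.
by exists n0 => n /h; rewrite sub0r normrN (ger0_norm (ltW (lrate_gt0 n))).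
Qed.

Lemma rstep_lrate k : rstep R k <= lrate k.
Proof. by rewrite /rstep /lrate lerXn2r ?nnegrE//; lra. Qed.

Lemma geom45_lrate k : (4 / 5 : R) ^+ k <= lrate k.
Proof. by rewrite /lrate lerXn2r ?nnegrE//; lra. Qed.

Lemma nneseries_geometric (c : R) (f : nat -> \bar R) : 0 <= c ->
  (forall n, (0 <= f n)%E) -> (forall n, (f n <= (c * lrate n)%:E)%E) ->
  (\big[+%E/0%E]_(0 <= n <oo) f n < +oo)%E.
Proof.
move=> c0 f0 fc; apply: (@le_lt_trans _ _ (10 * c)%:E); last by rewrite ltry.
apply: lime_le; first by apply: is_cvg_nneseries => n _ _; exact: f0.
apply: nearW => n.
apply: (@le_trans _ _ (10 * c * (1 - lrate n))%:E).
  elim: n => [|n IH]; first by rewrite big_nil /lrate expr0 subrr mulr0.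
  rewrite big_nat_recr//=; apply: (le_trans (leeD IH (fc n))).
  by rewrite -EFinD lee_fin lrateS; lra.
by rewrite lee_fin; have := mulr_ge0 c0 (ltW (lrate_gt0 n)); lra.
Qed.

End GeometricRate.

Section PiecewiseLinear.
Variable R : realType.
Implicit Types (c : nat -> R) (x : R).

Definition clamp01 x : R := Num.max 0 (Num.min x 1).

Lemma clamp01_le0 x : x <= 0 -> clamp01 x = 0.
Proof. by move=> x0; rewrite /clamp01 max_l// ge_min x0. Qed.

Lemma clamp01_ge1 x : 1 <= x -> clamp01 x = 1.
Proof. by move=> x1; rewrite /clamp01 min_r// max_r. Qed.

Lemma clamp01_id x : 0 <= x <= 1 -> clamp01 x = x.
Proof. by move=> /andP[x0 x1]; rewrite /clamp01 min_l// max_r. Qed.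

Lemma clamp01_continuous : continuous clamp01.
Proof.
rewrite (_ : clamp01 = (fun=> 0) \max (id \min (fun=> 1))); last exact/funext.
move=> x; apply: (@continuous_max R R); first exact: cvg_cst.
by apply: (@continuous_min R R); [exact: cvg_id | exact: cvg_cst].
Qed.

(** The linear interpolation of [c j - c 0] at the integers, as a sum of ramps: continuity and
    vanishing for negative [x] are then immediate. *)
Definition piecewise N c x : R := \sum_(j < N) (c j.+1 - c j) * clamp01 (x - j%:R).

Lemma piecewise_full N c x : N%:R <= x -> piecewise N c x = c N - c 0%N.
Proof.
rewrite /piecewise; elim: N => [|N IH] Nx; first by rewrite big_ord0 subrr.
have N1 : N%:R + 1 = N.+1%:R :> R by rewrite natr1.
rewrite big_ord_recr /= IH; last lra.
by rewrite clamp01_ge1 ?mulr1; lra.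
Qed.

Lemma piecewiseE N c x j : (j < N)%N -> j%:R <= x <= j.+1%:R ->
  piecewise N c x = c j - c 0%N + (c j.+1 - c j) * (x - j%:R).
Proof.
move=> jN /andP[jx xj].
have j1 : j%:R + 1 = j.+1%:R :> R by rewrite natr1.
rewrite -(subnKC jN); elim: (N - j.+1)%N => [|d IH].
  rewrite addn0 /piecewise big_ord_recr /= -/(piecewise j c x) piecewise_full//.
  by rewrite clamp01_id//; lra.
rewrite addnS /piecewise big_ord_recr /= -/(piecewise _ c x) IH.
rewrite clamp01_le0 ?mulr0 ?addr0// natrD; have : 0 <= (d%:R : R) by []; lra.
Qed.

Lemma piecewise_le0 N c x : x <= 0 -> piecewise N c x = 0.
Proof.
move=> x0; rewrite /piecewise big1// => j _; rewrite clamp01_le0 ?mulr0//.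
by have : 0 <= (j%:R : R) by []; lra.
Qed.

Lemma piecewise_continuous N c (a : R) : continuous (fun x => piecewise N c (x * a)).
Proof.
rewrite /piecewise; elim: N => [|N IH].
  rewrite (_ : (fun _ => _) = fun=> 0); first exact: cont_cst.
  by apply/funext => x; rewrite big_ord0.
rewrite (_ : (fun _ => _) = fun x => piecewise N c (x * a) +
   (c N.+1 - c N) * clamp01 (x * a - N%:R)); last first.
  by apply/funext => x; rewrite big_ord_recr.
apply: cont_add => //; apply: cont_mul; first exact: cont_cst.
move=> x; apply: (@continuous_comp _ _ _ (fun x => x * a - N%:R) clamp01).
  apply: cont_add; last exact: cont_cst.
  by apply: cont_mul; [move=> z; exact: cvg_id | exact: cont_cst].
exact: clamp01_continuous.
Qed.

End PiecewiseLinear.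

(** * From random bits to a probability on continuous paths *)

Section PathMeasure.
Variables (R : realType) (E : ((R -> R) -> R) -> R) (C : R).
Hypothesis FE : fin_expectation E.
Hypothesis C0 : 0 <= C.
Hypothesis E_incr : forall s t lam, 0 <= s -> s <= t -> 0 < lam ->
  E (ind R (fun x => lam < `|x t - x s|)) <= C * (t - s) ^+ 2 / lam ^+ 4.
Hypothesis E_at0 : E (ind R (fun x => x 0 <> 0)) = 0.

Let h (k : nat) : R := rstep R k ^+ 2.
Let lam := @lrate R.

Let h_gt0 k : 0 < h k. Proof. by rewrite exprn_gt0// rstep_gt0. Qed.

(* Bit number [pickle (k, j, v)] tells whether the value at time [j * 4^-k],
   rounded down to a multiple of [2^-k] and shifted by [8^k] units so as to be a
   natural number when it is at least [- 4^k], is [v]. *)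
Definition round_bit (n : nat) (x : R -> R) : bool :=
  if @unpickle (nat * nat * nat)%type n is Some (k, j, v) then
    Num.truncn (2 ^+ k * x (j%:R * rstep R k ^+ 2) + 8 ^+ k) == v
  else false.

(** For a value in [[- 4^k, 4^k]], the range covered by [v <= 2 * 8^k], exactly one of the bits read
    is set, and the sum returns the rounded value. *)
Definition decode (k j : nat) (b : nat -> bool) : R :=
  \sum_(v < (2 * 8 ^ k).+1) (b (pickle (k, j, v : nat)))%:R * ((v%:R - 8 ^+ k) / 2 ^+ k).

Definition interp (k : nat) (b : nat -> bool) (t : R) : R :=
  piecewise (k * 4 ^ k) (fun j => decode k j b) (t * 4 ^+ k).

Lemma interp_C0 k b : C0_paths (interp k b).
Proof.
split; first exact: piecewise_continuous.
move=> t t0; rewrite /interp piecewise_le0//.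
by rewrite mulr_le0_ge0// exprn_ge0.
Qed.

Definition interp_path k b : Omega R := exist _ (interp k b) (mem_set (interp_C0 k b)).

Lemma interp_depends k : exists K, depends_on_bits K (interp_path k).
Proof.
pose K := \max_(j < (k * 4 ^ k).+1) \max_(v < (2 * 8 ^ k).+1)
  (pickle (k, j : nat, v : nat)).+1.
exists K => b b' bb'; apply: path_ext => t; rewrite /B /= /interp.
have dec j : (j <= k * 4 ^ k)%N -> decode k j b = decode k j b'.
  move=> jN; apply: eq_bigr => v _; congr (_%:R * _); congr nat_of_bool.
  apply: bb'; rewrite /K.
  have jN' : (j < (k * 4 ^ k).+1)%N by rewrite ltnS.
  apply: leq_trans (leq_bigmax (Ordinal jN')).
  exact: (leq_bigmax (F := fun v : 'I_(2 * 8 ^ k).+1 => (pickle (k, j, v : nat)).+1)).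
by apply: eq_bigr => j _; rewrite !dec// ltnW.
Qed.

(** The second condition keeps the grid values in the range of [decode]; the third keeps the
    interpolation close to the grid values. *)
Definition good (k : nat) (x : R -> R) : Prop :=
  [/\ x 0 = 0, forall j, (j <= k * 4 ^ k)%N -> `|x (j%:R * h k)| <= 4 ^+ k &
      forall j, (j < k * 4 ^ k)%N -> `|x (j.+1%:R * h k) - x (j%:R * h k)| <= lam k].

Lemma decode_eq k j x (v0 : nat) : (v0 <= 2 * 8 ^ k)%N ->
  Num.truncn (2 ^+ k * x (j%:R * h k) + 8 ^+ k) = v0 ->
  decode k j (fun n => round_bit n x) = (v0%:R - 8 ^+ k) / 2 ^+ k.
Proof.
move=> v0N e; have v0N' : (v0 < (2 * 8 ^ k).+1)%N by rewrite ltnS.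
rewrite /decode (bigD1 (Ordinal v0N'))//= big1.
  by rewrite /round_bit pickleK e eqxx mul1r addr0.
move=> v vne; rewrite /round_bit pickleK e; case: eqP => [ev|]; last by rewrite mul0r.
by exfalso; move/eqP: vne; apply; apply: val_inj; rewrite /= ev.
Qed.

Lemma decode_close k j x : good k x -> (j <= k * 4 ^ k)%N ->
  `|decode k j (fun n => round_bit n x) - x (j%:R * h k)| <= rstep R k.
Proof.
move=> [x0 xb _] jN; have := xb j jN; rewrite ler_norml => /andP[y1 y2].
set y := x _ in y1 y2 *.
have p2 : 0 < (2 : R) ^+ k by rewrite exprn_gt0.
have e8 : (2 : R) ^+ k * 4 ^+ k = 8 ^+ k by rewrite -exprMn; congr (_ ^+ _); ring.
have z0 : 0 <= 2 ^+ k * y + 8 ^+ k.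
  by have := ler_wpM2l (ltW p2) y1; rewrite mulrN e8; lra.
have z1 : 2 ^+ k * y + 8 ^+ k <= (2 * 8 ^ k)%N%:R.
  have := ler_wpM2l (ltW p2) y2; rewrite e8 natrM natrX; lra.
have := truncn_itv z0; set v0 := Num.truncn _ => /andP[v1 v2].
have v0N : (v0 <= 2 * 8 ^ k)%N by rewrite -(ler_nat R); exact: le_trans z1.
rewrite (decode_eq v0N)// -/y.
have -> : rstep R k = 1 / 2 ^+ k by rewrite /rstep exprVn mul1r.
have -> : y = 2 ^+ k * y / 2 ^+ k by field; rewrite gt_eqF.
rewrite -mulrBl normrM (ger0_norm (_ : 0 <= (2 ^+ k)^-1)); last by rewrite invr_ge0 ltW.
rewrite ler_pM2r ?invr_gt0//; move: v2; rewrite -natr1 ler_norml; lra.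
Qed.

Lemma decode_at0 k x : good k x -> decode k 0 (fun n => round_bit n x) = 0.
Proof.
move=> [x0 _ _]; rewrite (@decode_eq _ _ _ (8 ^ k)%N).
- by rewrite natrX subrr mul0r.
- by rewrite leq_pmull.
- by rewrite mul0r x0 mulr0 add0r -natrX natrK.
Qed.

Lemma tick_h k (t : R) : 0 <= t ->
  (tick k t)%:R * h k <= t /\ t < (tick k t)%:R * h k + h k.
Proof. by move=> t0; have := tickP k t0 => /andP[]. Qed.

Lemma tick_lt k (t : R) : 0 <= t -> t < k%:R -> (tick k t < k * 4 ^ k)%N.
Proof.
move=> t0 tk; rewrite -(ltr_nat R) natrM natrX.
apply: le_lt_trans (_ : t * 4 ^+ k < _); last by rewrite ltr_pM2r// exprn_gt0.
by rewrite /tick truncn_le// mulr_ge0// exprn_ge0.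
Qed.

Lemma interp_close k x (t : R) : good k x -> 0 <= t -> t < k%:R ->
  `|interp k (fun n => round_bit n x) t - x ((tick k t)%:R * h k)| <=
  lam k + 3 * rstep R k.
Proof.
move=> gx t0 tk; set j := tick k t.
have jN : (j < k * 4 ^ k)%N by exact: tick_lt.
have p4 : 0 < (4 : R) ^+ k by rewrite exprn_gt0.
have /andP[jt tj] : j%:R <= t * 4 ^+ k < j.+1%:R.
  by rewrite truncn_itv// mulr_ge0// ltW.
rewrite /interp (piecewiseE _ jN); last by rewrite jt ltW.
rewrite decode_at0// subr0.
have := decode_close gx (ltnW jN); have := decode_close gx jN.
have [_ _ /(_ j jN)] := gx.
set c0 := decode k j _; set c1 := decode k j.+1 _; set th := t * _ - _.
move=> inc d1 d0.
have th01 : 0 <= th <= 1 by rewrite /th; move: tj; rewrite -[j.+1%:R]natr1; lra.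
have c10 : `|(c1 - c0) * th| <= lam k + 2 * rstep R k.
  rewrite normrM -[leRHS]mulr1; apply: ler_pM => //.
    by move: inc d1 d0; rewrite !ler_norml; lra.
  by rewrite ler_norml; lra.
by move: c10 d0; rewrite !ler_norml; lra.
Qed.

Lemma tick_succ k (t : R) : 0 <= t ->
  (4 * tick k t <= tick k.+1 t)%N && (tick k.+1 t <= 4 * tick k t + 3)%N.
Proof.
move=> t0; have p4 : 0 < (4 : R) ^+ k by rewrite exprn_gt0.
have /andP[a1 a2] : (tick k t)%:R <= t * 4 ^+ k < (tick k t).+1%:R.
  by rewrite truncn_itv// mulr_ge0// ltW.
have /andP[b1 b2] : (tick k.+1 t)%:R <= t * 4 ^+ k.+1 < (tick k.+1 t).+1%:R.
  by rewrite truncn_itv// mulr_ge0// exprn_ge0.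
rewrite exprS in b1 b2.
have -> : (4 * tick k t <= tick k.+1 t)%N.
  rewrite -ltnS -(ltr_nat R) natrM; lra.
rewrite -ltnS -(ltr_nat R) -addnS natrD natrM.
by move: a2; rewrite -[(tick k t).+1%:R]natr1; lra.
Qed.

(** Each level contributes [lam + 3 rstep], and at most three fine increments separate the two grid
    points below [t]. With [rstep <= lam] and [lam k.+1 = 9/10 lam k] this sums to [10.3 lam k]. *)
Lemma interp_consecutive k x (t : R) : good k x -> good k.+1 x -> t < k%:R ->
  `|interp k.+1 (fun n => round_bit n x) t - interp k (fun n => round_bit n x) t| <=
  11 * lam k.
Proof.
move=> g0 g1 tk; have l0 : 0 < lam k by exact: lrate_gt0.
have [t0|t0] := leP t 0.
  rewrite /interp !piecewise_le0 ?subrr ?normr0 ?mulr_le0_ge0 ?exprn_ge0//.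
  by rewrite mulr_ge0// ltW.
have tk1 : t < k.+1%:R by rewrite -natr1; lra.
have c0 := interp_close g0 (ltW t0) tk.
have c1 := interp_close g1 (ltW t0) tk1.
have /andP[j1 j2] := tick_succ k (ltW t0).
have jN := tick_lt (ltW t0) tk1.
have hh : h k = 4 * h k.+1.
  have -> : h k.+1 = (2^-1 * rstep R k) ^+ 2 by congr (_ ^+ 2); exact: exprS.
  by rewrite /h; field.
have step d : (4 * tick k t + d <= k.+1 * 4 ^ k.+1)%N ->
    `|x ((4 * tick k t + d)%N%:R * h k.+1) - x ((4 * tick k t)%N%:R * h k.+1)|
    <= d%:R * lam k.+1.
  elim: d => [|d IH] dN; first by rewrite addn0 subrr normr0 mul0r.
  have [_ _ inc] := g1; rewrite addnS in dN *.
  have := inc _ dN; have := IH (ltnW dN).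
  by rewrite -[d.+1]addn1 natrD !ler_norml; lra.
have := step (tick k.+1 t - 4 * tick k t)%N.
rewrite subnKC// => /(_ (ltnW jN)).
have -> : (4 * tick k t)%N%:R * h k.+1 = (tick k t)%:R * h k by rewrite natrM hh; ring.
move=> st.
have d3 : (tick k.+1 t - 4 * tick k t)%N%:R <= (3 : R).
  by rewrite ler_nat leq_subLR.
have l1 : 0 < lam k.+1 by exact: lrate_gt0.
have := ler_wpM2r (ltW l1) d3.
have l10 : lam k.+1 = 9 / 10 * lam k by exact: lrateS.
have r0 : rstep R k <= lam k by exact: rstep_lrate.
have r1 : rstep R k.+1 <= lam k.+1 by exact: rstep_lrate.
move: c0 c1 st; rewrite !ler_norml; lra.
Qed.

(** A union bound. At most [2 * 8^k] grid values leave the range, each with weight at most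
    [C / 64^k]; at most [8^k] increments are too large, each with weight at most
    [C 16^-k / (9/10)^(4k)]. The ratios are [1/8] and [0.5 / 0.6561], both below [4/5]. *)
Lemma not_good_prob k : E (ind R (fun x => ~ good k x)) <= 3 * C * (4 / 5) ^+ k.
Proof.
set N := (k * 4 ^ k)%N.
pose A0 (x : R -> R) := x 0 <> 0.
pose A1 (j : nat) (x : R -> R) := 4 ^+ k < `|x (j%:R * h k) - x 0|.
pose A2 (j : nat) (x : R -> R) := lam k < `|x (j.+1%:R * h k) - x (j%:R * h k)|.
have sub x : ~ good k x -> A0 x \/ ((exists2 j, j \in iota 0 N.+1 & A1 j x) \/
    (exists2 j, j \in iota 0 N & A2 j x)).
  move=> ng; apply: contrapT => /not_orP[n0 /not_orP[n1 n2]]; apply: ng.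
  have x0 : x 0 = 0 by apply: contrapT.
  split => // [j jN|j jN]; rewrite leNgt; apply/negP => bad.
    by apply: n1; exists j; rewrite ?mem_iota ?add0n ?ltnS// /A1 x0 subr0.
  by apply: n2; exists j; rewrite ?mem_iota ?add0n.
apply: (le_trans (ind_sub FE sub)); apply: (le_trans (ind_or FE _ _)).
rewrite E_at0 add0r; apply: (le_trans (ind_or FE _ _)).
have kp : (k%:R : R) <= 2 ^+ k by rewrite -natrX ler_nat ltnW// ltn_expl.
have p2 : 0 < (2 : R) ^+ k by rewrite exprn_gt0.
have p4 : 0 < (4 : R) ^+ k by rewrite exprn_gt0.
have p8 : 0 < (8 : R) ^+ k by rewrite exprn_gt0.
have N8 : (N%:R : R) <= 8 ^+ k.
  rewrite /N natrM natrX (_ : (8 : R) ^+ k = 2 ^+ k * 4 ^+ k) ?ler_pM2r//.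
  by rewrite -exprMn; congr (_ ^+ _); ring.
have hk : h k = (4 ^+ k)^-1 by exact: rstep_sq.
have e1 : E (ind R (fun x => exists2 j, j \in iota 0 N.+1 & A1 j x)) <=
    2 * C * (4 / 5) ^+ k.
  apply: (le_trans (ind_exists FE _ _)).
  apply: (@le_trans _ _ (\sum_(j <- iota 0 N.+1) C * (64 ^+ k)^-1)).
    rewrite big_seq [leRHS]big_seq; apply: ler_sum => j.
    rewrite mem_iota add0n ltnS => /andP[_ jN].
    have jh0 : 0 <= j%:R * h k by rewrite mulr_ge0// ltW.
    apply: (le_trans (E_incr (lexx 0) jh0 p4)).
    rewrite subr0 -mulrA ler_wpM2l// ler_pdivrMr ?exprn_gt0//.
    rewrite (_ : (64 ^+ k)^-1 * _ = (2 ^+ k) ^+ 2); last first.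
      rewrite (_ : (64 : R) ^+ k = 4 ^+ k * 4 ^+ k * 4 ^+ k); last first.
        by rewrite -!exprMn; congr (_ ^+ _); ring.
      rewrite (_ : (2 ^+ k) ^+ 2 = (4 : R) ^+ k); last first.
        by rewrite -exprM mulnC exprM; congr (_ ^+ _); ring.
      by field; rewrite gt_eqF.
    rewrite ler_sqr ?nnegrE// ?(ltW p2)//; apply: le_trans kp.
    rewrite hk ler_pdivrMr//.
    by rewrite -natrX -natrM ler_nat.
  rewrite big_const_seq count_predT size_iota iter_addr_0 -[leLHS]mulr_natr.
  have : (N.+1%:R : R) <= 2 * 8 ^+ k.
    by rewrite -natr1; have : 1 <= (8 : R) ^+ k by [rewrite exprn_ege1//; lra]; lra.
  move=> /(ler_wpM2l (_ : 0 <= C * (64 ^+ k)^-1))/wrap[|h1].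
    by rewrite mulr_ge0// invr_ge0 exprn_ge0.
  apply: (le_trans h1).
  rewrite (_ : C / 64 ^+ k * (2 * 8 ^+ k) = 2 * C * (8^-1) ^+ k); last first.
    rewrite (_ : (64 : R) ^+ k = 8 ^+ k * 8 ^+ k); last first.
      by rewrite -exprMn; congr (_ ^+ _); ring.
    by rewrite exprVn; field; rewrite gt_eqF.
  rewrite ler_wpM2l ?mulr_ge0// lerXn2r ?nnegrE ?invr_ge0//; lra.
have e2 : E (ind R (fun x => exists2 j, j \in iota 0 N & A2 j x)) <= C * (4 / 5) ^+ k.
  apply: (le_trans (ind_exists FE _ _)).
  have l0 : 0 < lam k by exact: lrate_gt0.
  apply: (@le_trans _ _ (\sum_(j <- iota 0 N) C * ((4 ^+ k)^-1 ^+ 2 / lam k ^+ 4))).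
    apply: ler_sum => j _.
    have jh0 : 0 <= j%:R * h k by rewrite mulr_ge0// ltW.
    have jh1 : j%:R * h k <= j.+1%:R * h k by rewrite ler_pM2r// ler_nat.
    apply: (le_trans (E_incr jh0 jh1 l0)).
    have -> : j.+1%:R * h k - j%:R * h k = (4 ^+ k)^-1 by rewrite -[j.+1%:R]natr1 -hk; ring.
    by rewrite -mulrA.
  rewrite big_const_seq count_predT size_iota iter_addr_0 -[leLHS]mulr_natr -[leLHS]mulrA.
  apply: ler_wpM2l => //.
  apply: (@le_trans _ _ ((4 ^+ k)^-1 ^+ 2 / lam k ^+ 4 * 8 ^+ k)).
    by rewrite ler_wpM2l// divr_ge0 ?sqr_ge0// exprn_ge0// ltW.
  have -> : (4 ^+ k)^-1 ^+ 2 / lam k ^+ 4 * 8 ^+ k = (4^-1 ^+ 2 / (9 / 10) ^+ 4 * 8 : R) ^+ k.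
    have -> : (4 ^+ k)^-1 ^+ 2 = (4^-1 ^+ 2 : R) ^+ k by rewrite -exprVn -!exprM mulnC.
    have -> : lam k ^+ 4 = ((9 / 10) ^+ 4) ^+ k by rewrite /lam /lrate -!exprM mulnC.
    by rewrite -exprVn -!exprMn.
  by apply: lerXn2r; rewrite ?nnegrE; lra.
lra.
Qed.

Let D (u : R) (n : nat) : bool := bit E round_bit n u.
Let U01 : probability (measurableTypeR R) R := unif R.

Definition bad (k : nat) : set (measurableTypeR R) :=
  [set u | ~ forall t : R, t < k%:R ->
    `|interp k.+1 (D u) t - interp k (D u) t| <= 11 * lam k].

Lemma bits_event (K : nat) (A : (nat -> bool) -> Prop) : depends_on_bits K A ->
  measurable [set u : measurableTypeR R | A (D u)] /\
  U01 [set u | A (D u)] = (E (ind R (fun x => A (fun n => round_bit n x))))%:E.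
Proof.
move=> dA; pose G b := ind R A b.
have dG : depends_on_bits K G by move=> b b' /dA e; rewrite /G /ind e.
have [mG iG eG] := unif_bits_finite FE round_bit dG.
have mA : measurable [set u : measurableTypeR R | A (D u)].
  rewrite (_ : [set u | _] = setT `&` ((fun u => G (D u)) @^-1` [set 1])); last first.
    apply/seteqP; split => u /=.
      by move=> Au; split => //; rewrite /G ind_true.
    move=> [_]; rewrite /G /ind; case: asboolP => // _ /eqP.
    by rewrite eq_sym oner_eq0.
  by apply: mG => //; exact: measurable_set1.
split => //; rewrite -Ex_indic//; congr EFin; rewrite -[RHS]eG.
congr Ex; apply/funext => u; rewrite indicE /G /ind; by congr (_%:R); congr nat_of_bool.
Qed.

(** The event quantifies over all times, yet both interpolations depend on finitely many bits, so
    its measure can be computed under [E]. There it occurs only where [good k] or [good k.+1]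
    fails. *)
Lemma bad_prob k : measurable (bad k) /\ (U01 (bad k) <= (6 * C * lam k)%:E)%E.
Proof.
have [K0 dK0] := interp_depends k; have [K1 dK1] := interp_depends k.+1.
have dep : depends_on_bits (maxn K0 K1) (fun b => ~ forall t : R, t < k%:R ->
    `|interp k.+1 b t - interp k b t| <= 11 * lam k).
  move=> b b' bb'.
  have e0 : interp k b = interp k b'.
    have e : interp_path k b = interp_path k b'.
      by apply: dK0 => i iK; apply: bb'; rewrite leq_max iK.
    by have := congr1 (fun w => fun t => B t w) e.
  have e1 : interp k.+1 b = interp k.+1 b'.
    have e : interp_path k.+1 b = interp_path k.+1 b'.
      by apply: dK1 => i iK; apply: bb'; rewrite leq_max iK orbT.
    by have := congr1 (fun w => fun t => B t w) e.
  by rewrite e0 e1.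
have [mb eb] := bits_event dep; split => //.
rewrite /bad eb lee_fin.
apply: (@le_trans _ _ (E (ind R (fun x => ~ good k x \/ ~ good k.+1 x)))).
  apply: (ind_sub FE) => x nx; apply: contrapT => /not_orP[/contrapT g0 /contrapT g1].
  by apply: nx => t tk; exact: interp_consecutive.
apply: (le_trans (ind_or FE _ _)).
have := not_good_prob k; have := not_good_prob k.+1.
have q0 : 0 <= C * (4 / 5) ^+ k by rewrite mulr_ge0// exprn_ge0//; lra.
have : C * (4 / 5) ^+ k <= C * lam k by rewrite ler_wpM2l//; exact: geom45_lrate.
by rewrite exprS; lra.
Qed.

Definition bad_set : set (measurableTypeR R) := lim_sup_set bad.

Lemma bad_set_measurable : measurable bad_set.
Proof.
apply: bigcapT_measurable => n; apply: bigcup_measurable => k _.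
by have [] := bad_prob k.
Qed.

Lemma bad_set0 : U01 bad_set = 0%E.
Proof.
apply: lim_sup_set_cvg0; first by move=> k; have [] := bad_prob k.
apply: (@nneseries_geometric _ (6 * C)); first by rewrite mulr_ge0.
  by move=> n; exact: measure_ge0.
by move=> n; have [] := bad_prob n.
Qed.

Lemma not_bad_setP u : ~ bad_set u -> exists k0, forall k, (k0 <= k)%N ->
  forall t : R, t < k%:R -> `|interp k.+1 (D u) t - interp k (D u) t| <= 11 * lam k.
Proof.
move=> nb; have [k0 nk] : exists k0, ~ (\bigcup_(j in [set j | (k0 <= j)%N]) bad j) u.
  apply: contrapT => h0; apply: nb => n _; apply: contrapT => h1; apply: h0.
  by exists n.
exists k0 => k kk t tk; rewrite leNgt; apply/negP => lt; apply: nk.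
by exists k => // /(_ t tk); rewrite leNgt lt.
Qed.

Definition limit_fct (u : R) (t : R) : R := lim (interp k (D u) t @[k --> \oo]).

Section OneSample.
Variables (u : R) (k0 : nat).
Hypothesis cons : forall k, (k0 <= k)%N -> forall t : R, t < k%:R ->
  `|interp k.+1 (D u) t - interp k (D u) t| <= 11 * lam k.

(** Since [11 lam k = 110 (lam k - lam k.+1)], the bounds on consecutive differences telescope. *)
Lemma interp_cauchy k p t : (k0 <= k)%N -> t < k%:R ->
  `|interp (k + p) (D u) t - interp k (D u) t| <= 110 * (lam k - lam (k + p)).
Proof.
move=> kk tk; elim: p => [|p IH]; first by rewrite addn0 !subrr normr0 mulr0.
have kkp : (k0 <= k + p)%N by apply: leq_trans kk (leq_addr _ _).
have tkp : t < (k + p)%N%:R by apply: (lt_le_trans tk); rewrite ler_nat leq_addr.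
have := cons kkp tkp; have := IH; rewrite addnS.
have -> : lam (k + p).+1 = 9 / 10 * lam (k + p) by exact: lrateS.
rewrite !ler_norml; lra.
Qed.

Lemma interp_cvg t : interp k (D u) t @[k --> \oo] --> limit_fct u t.
Proof.
rewrite /limit_fct; apply: cauchy_cvg; apply: cauchy_exP => e e0.
have e110 : 0 < e / 220 by rewrite divr_gt0 ?ltr0n.
have [n0 n0P] := lrate_small e110.
pose n := maxn (maxn n0 k0) (Num.truncn `|t|).+1.
have kn : (k0 <= n)%N by rewrite !leq_max leqnn orbT.
have tn : t < n%:R.
  apply: (le_lt_trans (ler_norm t)); apply: (lt_le_trans (truncnS_gt _)).
  by rewrite ler_nat leq_max leqnn orbT.
exists (interp n (D u) t); exists n => // m nm; rewrite /ball /= distrC.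
have := interp_cauchy (m - n) kn tn; rewrite subnKC// => /le_lt_trans; apply.
have ln : lam n <= e / 220 by apply: n0P; rewrite !leq_max leqnn.
have : 0 < lam m by exact: lrate_gt0.
lra.
Qed.

Lemma limit_fct_close k t : (k0 <= k)%N -> t < k%:R ->
  `|limit_fct u t - interp k (D u) t| <= 110 * lam k.
Proof.
move=> kk tk.
have c : `|interp m (D u) t - interp k (D u) t| @[m --> \oo] -->
   `|limit_fct u t - interp k (D u) t|.
  by apply: cvg_norm; apply: cvgB; [exact: interp_cvg | exact: cvg_cst].
rewrite -(cvg_lim _ c)//; apply: limr_le; first by apply/cvg_ex; eexists; exact: c.
exists k => // m km; have := interp_cauchy (m - k) kk tk; rewrite subnKC// => hm.
by apply: (le_trans hm); have : 0 < lam m by [exact: lrate_gt0]; lra.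
Qed.

Lemma limit_fct_C0 : C0_paths (limit_fct u).
Proof.
split=> [t|t t0]; last first.
  rewrite /limit_fct (_ : (fun k => _) = fun=> 0) ?lim_cst//.
  apply/funext => k; rewrite /interp piecewise_le0//.
  by rewrite mulr_le0_ge0// exprn_ge0.
apply/cvgrPdist_le => e e0.
have e330 : 0 < e / 330 by rewrite divr_gt0 ?ltr0n.
have [n0 n0P] := lrate_small e330.
pose n := maxn (maxn n0 k0) (Num.truncn (`|t| + 1)).+1.
have kn : (k0 <= n)%N by rewrite !leq_max leqnn orbT.
have tn : `|t| + 1 < n%:R.
  by apply: (lt_le_trans (truncnS_gt _)); rewrite ler_nat leq_max leqnn orbT.
have ln : lam n <= e / 330 by apply: n0P; rewrite !leq_max leqnn.
have [ci _] := interp_C0 n (D u).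
have e3 : 0 < e / 3 by rewrite divr_gt0.
have := ci t => /cvgrPdist_le/(_ _ e3) near_i.
near=> s.
have s1 : `|t - s| <= 1 by near: s; apply: cvgr_dist_le.
have is3 : `|interp n (D u) t - interp n (D u) s| <= e / 3 by near: s.
have tn' : t < n%:R by have := ler_norm t; lra.
have sn : s < n%:R.
  by have := ler_norm t; move: s1; rewrite ler_norml; lra.
have := limit_fct_close kn tn'; have := limit_fct_close kn sn.
by move: is3; rewrite !ler_norml; lra.
Unshelve. all: by end_near. Qed.

End OneSample.

Lemma limit_fct_path u : ~ bad_set u -> C0_paths (limit_fct u).
Proof. by move=> /not_bad_setP[k0 h0]; exact: limit_fct_C0 h0. Qed.

Definition sample_path (u : measurableTypeR R) : Omega R :=
  match pselect (bad_set u) with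
  | left _ => point
  | right nb => exist _ (limit_fct u) (mem_set (limit_fct_path nb))
  end.

Lemma B_sample_path u t : ~ bad_set u -> B t (sample_path u) = limit_fct u t.
Proof. by move=> nb; rewrite /sample_path; case: pselect. Qed.

Lemma sample_path_measurable : measurable_fun setT sample_path.
Proof.
apply: measurable_path_fct => V /open_pathP oV.
(* Off the exceptional set, the sample path lies in [V] iff for some [m] all late interpolations
   have their [m]-ball inside [V]. Each of these events depends on finitely many bits and is
   therefore measurable. *)
pose Vm (m : nat) : set (Omega R) := [set w | forall w', path_close m w w' -> V w'].
pose A m k : set (measurableTypeR R) := [set u | Vm m (interp_path k (D u))].
have mA m k : measurable (A m k).
  have [K dK] := interp_depends k.
  have dep : depends_on_bits K (fun b => Vm m (interp_path k b)).
    by move=> b b' /dK ->.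
  by have [] := bits_event dep.
rewrite (_ : sample_path @^-1` V =
  (~` bad_set `&` \bigcup_m \bigcup_n \bigcap_(k in [set k | (n <= k)%N]) A m k) `|`
  (bad_set `&` [set _ | V point])).
  apply: measurableU.
    apply: measurableI; first by apply: measurableC; exact: bad_set_measurable.
    apply: bigcupT_measurable => m; apply: bigcupT_measurable => n.
    by apply: bigcap_measurable => [|k _ //]; exists n => /=.
  apply: measurableI; first exact: bad_set_measurable.
  have [Vp|nVp] := pselect (V point).
    by rewrite (_ : [set _ | _] = setT)//; apply/seteqP; split.
  by rewrite (_ : [set _ | _] = set0)//; apply/seteqP; split.
apply/seteqP; split => u /=.
  have [b|nb] := pselect (bad_set u).
    by rewrite {1}/sample_path; case: pselect => // _ Vp; right.
  move=> Vu; left; split => //; have [k0 h0] := not_bad_setP nb.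
  have [m0 m0P] := oV _ Vu.
  (* Since [m + 1 = 2 (m0 + 1)], half of the radius is left for the distance between the sample path
     and its interpolation. *)
  pose m := (m0.+1 + m0)%N; exists m => //.
  have e0 : 0 < (m.+1%:R : R)^-1 / 220 by rewrite divr_gt0 ?invr_gt0 ?ltr0n.
  have [n0 n0P] := lrate_small e0.
  exists (maxn (maxn n0 k0) m0.+1) => // k /=; rewrite !geq_max => /andP[/andP[k1 k2] k3].
  move=> w' cw; apply: m0P => s sm.
  have sk : s < k%:R.
    apply: (le_lt_trans (ler_norm s)); apply: (le_lt_trans sm).
    by rewrite ltr_nat.
  have sm' : `|s| <= m%:R by apply: (le_trans sm); rewrite ler_nat leq_addl.
  have c1 : `|B s w' - interp k (D u) s| < m.+1%:R^-1 := cw s sm'.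
  have := limit_fct_close h0 k2 sk; rewrite -(B_sample_path _ nb) => c2.
  have c3 : lam k <= m.+1%:R^-1 / 220 := n0P k k1.
  have mm : (m.+1%:R : R)^-1 * 2 = m0.+1%:R^-1.
    rewrite (_ : m.+1%:R = 2 * m0.+1%:R :> R); first by rewrite invfM mulrAC mulVf ?mul1r// pnatr_eq0.
    by rewrite /m -natrM mulSn mul1n addSn addnS.
  have i0 : 0 < (m.+1%:R : R)^-1 by rewrite invr_gt0.
  move: c1 c2; rewrite -mm !ltr_norml !ler_norml; clear -c3 i0 => /andP[a1 a2] /andP[a3 a4].
  move: a1 a2 a3 a4 c3 i0; move: (B s w') (interp k (D u) s) (B s (sample_path u)).
  move: (lam k) (m.+1%:R^-1) => l p b1 b2 b3; lra.
case=> [[nb [m _ [n _ hA]]]|[b Vp]]; last first.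
  by rewrite /sample_path; case: pselect.
have [k0 h0] := not_bad_setP nb.
have e0 : 0 < (m.+1%:R : R)^-1 / 220 by rewrite divr_gt0 ?invr_gt0 ?ltr0n.
have [n0 n0P] := lrate_small e0.
pose k := maxn (maxn n n0) (maxn k0 m.+1).
apply: (hA k); first by rewrite /= !leq_max leqnn.
move=> s sm; rewrite B_sample_path//.
have sk : s < k%:R.
  apply: (le_lt_trans (ler_norm s)); apply: (le_lt_trans sm).
  by rewrite ltr_nat !leq_max leqnn !orbT.
have kk : (k0 <= k)%N by rewrite !leq_max leqnn !orbT.
have := limit_fct_close h0 kk sk; rewrite /B /= => /le_lt_trans; apply.
have : lam k <= (m.+1%:R : R)^-1 / 220 by apply: n0P; rewrite !leq_max leqnn !orbT.
have : 0 < (m.+1%:R : R)^-1 by rewrite invr_gt0.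
move: (lam k) (m.+1%:R^-1) => l p; lra.
Qed.

Lemma h_sq_lrate k : h k ^+ 2 <= (4 / 5) ^+ k * lam k ^+ 4.
Proof.
have -> : lam k ^+ 4 = ((9 / 10) ^+ 4) ^+ k by rewrite /lam /lrate -exprM mulnC exprM.
have -> : h k = 4^-1 ^+ k by rewrite exprVn; exact: rstep_sq.
have -> : (4^-1 : R) ^+ k ^+ 2 = (4^-1 ^+ 2) ^+ k by rewrite -!exprM mulnC.
rewrite -exprMn; apply: lerXn2r; rewrite ?nnegrE; lra.
Qed.

(** As [E] is only finitely additive, pointwise convergence would say nothing; the proof produces a
    rate. Off a bad event [F] moves by at most [K] times [5 lam k] per time point:
    [lam k + 3 rstep k] from interpolating and [lam k] from moving to the grid. The bad event has
    weight of order [lam k]. *)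
Lemma interp_functional_cvg (t : R) (F : (R -> R) -> R) : cyl t F ->
  E (fun x => F (interp k (fun n => round_bit n x))) @[k --> \oo] --> E F.
Proof.
move=> cF; have [ts [K [M [ts0 K0 FM FK]]]] := cF.
have M0 : 0 <= M by apply: le_trans (FM (fun=> 0)).
have bF : bounded_fct F by exists M.
pose n := (Num.truncn `|t|).+1.
pose c := (size ts)%:R : R.
have c0 : 0 <= c by [].
pose W := K * (c * 5) + 2 * M * (3 * C + c * C).
have W0 : 0 <= W by rewrite /W !(addr_ge0, mulr_ge0).
have main k : (n <= k)%N ->
    `|E (fun x => F (interp k (fun n => round_bit n x))) - E F| <= W * lam k.
  move=> nk; have bFk : bounded_fct (fun x => F (interp k (fun n => round_bit n x))).
    by exists M.
  rewrite -(fin_expB FE)//; apply: (le_trans (fin_exp_abs FE _)).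
    by exists (M + M) => x; apply: (le_trans (ler_normB _ _)); exact: lerD.
  pose A s (x : R -> R) := lam k < `|x s - x ((tick k s)%:R * h k)|.
  pose bad_ev x := ~ good k x \/ exists2 s, s \in ts & A s x.
  have l0 : 0 < lam k by exact: lrate_gt0.
  have pw x : `|F (interp k (fun n => round_bit n x)) - F x| <=
      K * (c * (5 * lam k)) + 2 * M * ind R bad_ev x.
    have [b|nb] := pselect (bad_ev x).
      rewrite (ind_true R b) mulr1; apply: (le_trans (ler_normB _ _)).
      rewrite -[leLHS]add0r lerD ?mulr_ge0// ?(ltW l0)//.
      by rewrite mulr_natl mulr2n lerD.
    rewrite -[leLHS]addr0 lerD ?mulr_ge0 ?ind_ge0//.
    apply: (le_trans (FK _ _)); rewrite ler_wpM2l//.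
    apply: (@le_trans _ _ (\sum_(s <- ts) 5 * lam k)); last first.
      by rewrite big_const_seq count_predT iter_addr_0 -[leLHS]mulr_natl.
    rewrite big_seq [leRHS]big_seq; apply: ler_sum => s sts.
    move/not_orP: nb => [/contrapT gx nA]; have /andP[s0 st] := ts0 s sts.
    have sk : s < k%:R.
      apply: (le_lt_trans st); apply: (le_lt_trans (ler_norm t)).
      by apply: (lt_le_trans (truncnS_gt _)); rewrite ler_nat.
    have ic := interp_close gx s0 sk.
    have : `|x s - x ((tick k s)%:R * h k)| <= lam k.
      by rewrite leNgt; apply/negP => ?; apply: nA; exists s.
    have : rstep R k <= lam k by exact: rstep_lrate.
    by move: ic; rewrite !ler_norml; lra.
  have bi : bounded_fct (ind R bad_ev) by exact: ind_bounded.
  apply: (@le_trans _ _ (E (fun x => K * (c * (5 * lam k)) + 2 * M * ind R bad_ev x))).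
    apply: (fin_exp_le FE) => //.
      by exists (M + M) => x; rewrite normr_id; apply: (le_trans (ler_normB _ _)); exact: lerD.
    by apply: bounded_fctD; [exact: bounded_fct_cst | exact: bounded_fctZ].
  rewrite (fin_exp_add FE); [|exact: bounded_fct_cst|exact: bounded_fctZ].
  rewrite (fin_exp_cst FE) (fin_exp_scale FE)//.
  have e1 : E (ind R bad_ev) <= (3 * C + c * C) * lam k.
    apply: (le_trans (ind_or FE _ _)).
    have a1 := not_good_prob k.
    have a2 : E (ind R (fun x => exists2 s, s \in ts & A s x)) <=
        \sum_(s <- ts) C * (4 / 5) ^+ k.
      apply: (le_trans (ind_exists FE _ _)); rewrite big_seq [leRHS]big_seq.
      apply: ler_sum => s sts; have /andP[s0 _] := ts0 s sts.
      have [t1 t2] := tick_h k s0.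
      have th0 : 0 <= (tick k s)%:R * h k by rewrite mulr_ge0// ltW.
      apply: (le_trans (E_incr th0 t1 l0)).
      rewrite -mulrA ler_wpM2l// ler_pdivrMr ?exprn_gt0//.
      apply: (@le_trans _ _ (h k ^+ 2)).
        by rewrite ler_sqr ?nnegrE ?(ltW (h_gt0 k))//; lra.
      exact: h_sq_lrate.
    rewrite big_const_seq count_predT iter_addr_0 -[leRHS]mulr_natl -/c in a2.
    have g := ler_wpM2l C0 (geom45_lrate R k).
    have := ler_wpM2l c0 g; rewrite -/lam in g *; lra.
  have := ler_wpM2l (_ : 0 <= 2 * M) e1; rewrite mulr_ge0// => /(_ isT).
  rewrite /W; lra.
apply/cvgrPdist_le => e e0.
have eW : 0 < e / (W + 1) by rewrite divr_gt0//; lra.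
have [n0 n0P] := lrate_small eW.
exists (maxn n0 n) => // k /=; rewrite geq_max => /andP[k0 k1].
rewrite distrC; apply: (le_trans (main k k1)).
apply: (@le_trans _ _ ((W + 1) * lam k)).
  by rewrite ler_wpM2r ?ltW ?lrate_gt0//; lra.
have := n0P k k0; rewrite ler_pdivlMr; last by rewrite ltr_wpDl.
by rewrite mulrC.
Qed.

(** [Q] is the law of [sample_path] under the uniform measure. At each level the interpolated
    functional has the same expectation under the uniform measure and under [E]; the two sides of
    the claim are the limits, by dominated convergence and by [interp_functional_cvg]. *)
Theorem exists_path_measure : exists Q : probability (Omega R) R,
  forall (t : R) (F : (R -> R) -> R), cyl t F -> Ex Q (fun w => F (fun s => B s w)) = E F.
Proof.
pose X : {mfun measurableTypeR R >-> Omega R} := mfun_Sub (mem_set sample_path_measurable).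
pose Q : probability (Omega R) R := distribution U01 X.
exists Q => t F cF.
have mF := cyl_measurable cF.
have [ts [K [M [ts0 K0 FM FK]]]] := cF.
have mFX : measurable_fun setT (fun u => F (fun s => B s (sample_path u))).
  exact: (measurableT_comp mF sample_path_measurable).
have iF : integ U01 (fun u => F (fun s => B s (sample_path u))).
  by apply: (@integ_bounded _ _ _ _ _ M).
have -> : Ex Q (fun w => F (fun s => B s w)) = Ex U01 (fun u => F (fun s => B s (sample_path u))).
  rewrite /Ex /Rintegral; congr fine.
  rewrite (@integral_distribution _ _ _ _ _ U01 X (fun w => (F (fun s => B s w))%:E))//.
  exact/measurable_EFinP.
have fin k : [/\ measurable_fun setT (fun u : measurableTypeR R => F (interp k (D u))) &
    Ex U01 (fun u => F (interp k (D u))) = E (fun x => F (interp k (fun n => round_bit n x)))].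
  have [K1 dK] := interp_depends k.
  have dep : depends_on_bits K1 (fun b => F (interp k b)).
    by move=> b b' /dK e; have := congr1 (fun w => F (fun t => B t w)) e.
  by have [m _ e] := unif_bits_finite FE round_bit dep.
have [_ _ c1] : [/\ forall k, integ U01 (fun u => F (interp k (D u))),
    integ U01 (fun u => F (fun s => B s (sample_path u))) &
    Ex U01 (fun u => F (interp k (D u))) @[k --> \oo] -->
    Ex U01 (fun u => F (fun s => B s (sample_path u)))].
  have := (@Ex_dominated_cvg _ (measurableTypeR R) R U01 (fun k u => F (interp k (D u)))
    (fun u => F (fun s => B s (sample_path u))) (fun=> M) bad_set); apply => //.
  - by move=> k; have [] := fin k.
  - exact: integ_cst.
  - exact: bad_set_measurable.
  - exact: bad_set0.
  - move=> u nb; have [k0 h0] := not_bad_setP nb.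
    have e : (fun t => B t (sample_path u)) = limit_fct u.
      by apply/funext => s; exact: B_sample_path.
    rewrite e; apply/cvgrPdist_le => eps e0.
    have c : K * \sum_(s <- ts) `|interp k (D u) s - limit_fct u s| @[k --> \oo] --> (0 : R).
      rewrite -[X in _ --> X](mulr0 K); apply: cvgM; first exact: cvg_cst.
      elim: ts {ts0 FK} => [|s r IH].
        rewrite (_ : (fun _ => _) = fun=> 0); first exact: cvg_cst.
        by apply/funext => k; rewrite big_nil.
      rewrite (_ : (fun _ => _) = fun k => `|interp k (D u) s - limit_fct u s| +
         \sum_(s <- r) `|interp k (D u) s - limit_fct u s|); last first.
        by apply/funext => k; rewrite big_cons.
      rewrite -[X in _ --> X](addr0 0); apply: cvgD => //.
      have -> : 0 = `|limit_fct u s - limit_fct u s| :> R by rewrite subrr normr0.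
      by apply: cvg_norm; apply: cvgB; [exact: interp_cvg h0 _ | exact: cvg_cst].
    move/cvgrPdist_le : c => /(_ _ e0); apply: filterS => k.
    rewrite sub0r normrN ger0_norm; last by rewrite mulr_ge0// sumr_ge0.
    by move=> h1; rewrite distrC; apply: le_trans h1; exact: FK.
have c2 := interp_functional_cvg cF.
have c3 : Ex U01 (fun u => F (interp k (D u))) @[k --> \oo] --> E F.
  by rewrite (_ : (fun k => _) = fun k => E (fun x => F (interp k (fun n => round_bit n x))))//;
    apply/funext => k; have [] := fin k.
exact: (cvg_unique _ c1 c3).
Qed.

End PathMeasure.

(** * Conditional G-expectations as limits of walk expectations *)

Section CylinderFunctionals.
Variable R : realType.

Lemma Lip_cyl t (X : Omega R -> R) : Lip t X ->
  exists2 F, cyl t F & X = fun w => F (fun s => B s w).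
Proof.
move=> [m [s [phi [_ st phiL ->]]]]; have [K [M [K0 M0 [phiM phiK]]]] := bounded_lipschitzP phiL.
exists (fun x => phi [tuple x (s i) | i < m]) => //.
exists [seq s i | i <- enum 'I_m], K, M; split => // [_ /mapP[i _ ->]|x y] //.
apply: (le_trans (phiK _ _)); rewrite ler_wpM2l// big_map big_enum /=.
by apply: ler_sum => i _; rewrite !tnth_mktuple.
Qed.

Lemma cyl_Lip (t : R) (F : (R -> R) -> R) : 0 <= t -> cyl t F ->
  Lip t (fun w : Omega R => F (fun s => B s w)).
Proof.
(* The extra time 0 makes the list nonempty, as [Lip] demands; reading each time at its first index
   in the list copes with repetitions. *)
move=> t0 [ts [K [M [tst K0 FM FK]]]]; pose ts' := 0 :: ts.
pose pos (v : (size ts').-tuple R) (r : R) := nth 0 v (index r ts').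
exists (size ts'), (fun i => tnth (in_tuple ts') i), (fun v => F (pos v)); split => //.
- move=> i; have := mem_tnth i (in_tuple ts'); rewrite inE => /predU1P[->|/tst //].
  by rewrite lexx.
- split; first by exists M.
  exists (K * (size ts)%:R) => v v'; apply: (le_trans (FK _ _)).
  rewrite -mulrA ler_wpM2l//.
  apply: (@le_trans _ _ (\sum_(r <- ts) \sum_(i < size ts') `|tnth v i - tnth v' i|)).
    rewrite big_seq [leRHS]big_seq; apply: ler_sum => r rts.
    have ir : (index r ts' < size ts')%N by rewrite index_mem inE rts orbT.
    rewrite (bigD1 (Ordinal ir))//= !(tnth_nth 0) /= lerDl.
    by apply: sumr_ge0.
  by rewrite big_const_seq count_predT iter_addr_0 mulr_natl.
- apply/funext => w; apply/eqP; rewrite -subr_eq0 -normr_le0.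
  apply: (le_trans (FK _ _)); rewrite big_seq big1 ?mulr0// => r rts.
  have ir : (index r ts' < size ts')%N by rewrite index_mem inE rts orbT.
  rewrite /pos (nth_map (Ordinal ir)) ?size_enum_ord// (tnth_nth 0) /=.
  by rewrite nth_enum_ord// nth_index ?subrr ?normr0// inE rts orbT.
Qed.

Lemma cyl_pincr (K M : R) (s : nat -> R) i (f : i.-tuple R -> R) : 0 <= K ->
  lip_bound K M f -> s 0%N = 0 -> (forall k, (k < i)%N -> s k <= s k.+1) ->
  cyl (s i) (fun x => f (pincr s i x)).
Proof.
move=> K0 [fM fK] s0 ss.
have mono j k : (j + k <= i)%N -> s j <= s (j + k)%N.
  elim: k => [|k IH] jk; first by rewrite addn0.
  by rewrite addnS in jk *; apply: le_trans (ss _ jk); apply: IH; exact: ltnW.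
have rng k : (k <= i)%N -> 0 <= s k <= s i.
  move=> ki; rewrite -s0 -{1}[k]add0n mono//=.
  by rewrite -(subnKC ki) mono// subnKC.
exists ([seq s k.+1 | k <- index_iota 0 i] ++ [seq s k | k <- index_iota 0 i]), K, M; split => //.
- move=> r; rewrite mem_cat => /orP[] /mapP[k]; rewrite mem_index_iota => /andP[_ ki] ->.
    exact: rng.
  by apply: rng; exact: ltnW.
- move=> x y; apply: (le_trans (fK _ _)); rewrite ler_wpM2l// big_cat /= !big_map.
  rewrite !big_mkord -big_split /=.
  apply: ler_sum => k _; rewrite !tnth_mktuple opprD addrACA -opprD.
  exact: ler_normB.
Qed.

End CylinderFunctionals.

Section WalkConditionalExpectation.
Variables (R : realType) (sl su : R).
Hypotheses (sl0 : 0 <= sl) (slu : sl <= su).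

(** Repackages the backward recursion as two cylinder functionals and a convergence along walks, so
    that the grid can be forgotten. *)
Lemma Lip_cond_exp_walk (t : R) (X Y : Omega R -> R) : Lip_cond_exp sl su t X Y ->
  exists T F G, [/\ 0 <= t <= T, cyl T F, cyl t G,
     X = (fun w => F (fun s => B s w)) & Y = (fun w => G (fun s => B s w))] /\
   forall eps, 0 < eps -> exists n0, forall n, (n0 <= n)%N ->
     forall N, (tick n T <= N)%N -> forall l, size l = tick n t ->
     `|iter (N - tick n t) (wstepn sl su n) (fun l' => F (wpath n l')) l
       - G (wpath n l)| <= eps.
Proof.
move=> [m [j [s [phi [[m0 jm s0 ss phiL] [-> bs -> ->]]]]]].
have [K [M [K0 M0 lb]]] := bounded_lipschitzP phiL.
have lbi := lip_bound_chain sl0 slu K0 ss bs lb.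
have mono a b : (a + b <= m)%N -> s a <= s (a + b)%N.
  elim: b => [|k IH] jk; first by rewrite addn0.
  by rewrite addnS in jk *; apply: le_trans (ss _ jk); apply: IH; exact: ltnW.
exists (s m), (fun x => phi m (pincr s m x)), (fun x => phi j (pincr s j x)); split.
  split => //.
  - rewrite -{1}s0 -{1}[j]add0n mono//=; rewrite -(subnKC jm) mono// subnKC//.
  - exact: (cyl_pincr K0 lb).
  - by apply: (cyl_pincr K0) => //; [exact: lbi|move=> k kj; apply: ss; exact: leq_trans kj jm].
move=> eps e0; have [n0 n0P] := walk_cond_exp sl0 slu K0 s0 ss bs lb e0.
by exists n0 => n nn N TN l szl; exact: n0P.
Qed.

(** Under any strategy the walk expectation is below the upper one, and on cylinder functions the
    upper one converges to the G-expectation. *)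
Theorem limit_exp_PG (U : set_system nat) (al : nat -> seq R -> bool) :
  UltraFilter U -> \oo `<=` U -> exists2 Q : probability (Omega R) R, PG sl su Q &
  forall (t : R) F, cyl t F ->
    Ex Q (fun w => F (fun s => B s w)) = limit_exp sl su U al F.
Proof.
move=> UU Uoo; have su0 := le_trans sl0 slu.
have FE := limit_exp_fin sl su al UU Uoo.
have C0 : 0 <= 12 * su ^+ 4 by rewrite mulr_ge0// exprn_ge0.
have [Q QE] := exists_path_measure FE C0
  (limit_exp_increment sl0 slu al UU Uoo) (limit_exp_at0 sl su al UU).
exists Q => // X e /Lip_cond_exp_walk[T [F [G [[/andP[_ T0] cF cG -> eG] conv]]]].
rewrite Ex_EFin; last exact: cyl_integ cF.
rewrite lee_fin (QE _ _ cF); apply/ler_addgt0Pr => eps eps0.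
have [n0 n0P] := conv _ eps0.
have [M _ FM] := cyl_bounded cF.
rewrite /limit_exp -[leRHS](ulim_cst UU).
apply: (@ulim_le _ _ UU _ _ _ (maxn n0 (Num.truncn T).+1)) => //.
- by apply: walk_exp_bounded; exists M.
- by exists `|e + eps|.
move=> n; rewrite geq_max => /andP[n0n nT].
apply: (le_trans (walk_exp_le_sup _ _ _ _ _)).
have Tn : T <= n%:R by apply: (le_trans (ltW (truncnS_gt T))); rewrite ler_nat.
have := n0P n n0n (horizon n) (tick_horizon Tn) [::].
rewrite tick0 subn0 => /(_ erefl).
(* [G] is known to be constant on paths of [Omega] only; the empty walk gives the zero path, which
   is the distinguished point of [Omega]. *)
have -> : G (wpath n [::]) = e.
  rewrite (congr1 (@^~ (point : Omega R)) eG); congr G; apply/funext => s.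
  by rewrite /wpath /psum big1// => i _; rewrite nth_nil.
by rewrite -/(walk_supexp sl su n F) ler_norml; lra.
Qed.

End WalkConditionalExpectation.

(** * Testing conditional G-expectations against cylinder functions *)

Section SecondDerivativeTest.
Variables (R : realType) (f : R -> R) (y : R).
Hypothesis df : forall x, derivable f x 1.

Lemma derive1_local_min : (\forall x \near y, f y <= f x) -> derive1 f y = 0.
Proof.
move=> /nbhs_ballP[e /= e0 he].
have h : is_derive y 1 f 0.
  apply: (@derive1_at_min _ f (y - e) (y + e)).
  - by lra.
  - by [].
  - by rewrite in_itv /=; apply/andP; split; lra.
  - move=> t; rewrite in_itv /= => /andP[t1 t2]; apply: he.
    by rewrite /ball /= ltr_norml; apply/andP; split; lra.
by rewrite derive1E derive_val.
Qed.

Lemma derive2_local_min : derivable (derive1 f) y 1 ->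
  (\forall x \near y, f y <= f x) -> 0 <= derive1 (derive1 f) y.
Proof.
move=> ddf mn; have d0 := derive1_local_min mn.
rewrite leNgt; apply/negP => neg.
move: ddf => /cvg_ex[l /= cl].
have el : derive1 (derive1 f) y = l.
  by rewrite derive1E /derive; apply: cvg_lim cl; exact: Rhausdorff.
rewrite el in neg.
have /cvgrPdist_lt/(_ (- l)) := cl; rewrite oppr_gt0 => /(_ neg).
move=> /nbhs_ballP[d /= d0' hd].
move: mn => /nbhs_ballP[e /= e0 he].
pose b := Num.min (d / 2) (e / 2).
have b0 : 0 < b by rewrite /b lt_min !divr_gt0.
have bd : b <= d / 2 by rewrite /b ge_min lexx.
have be : b <= e / 2 by rewrite /b ge_min lexx orbT.
have yb : y < y + b by rewrite ltrDl.
have isd (x : R) : is_derive x 1 f (derive1 f x).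
  by apply: DeriveDef => //; rewrite derive1E.
have cf : {within `[y, y + b], continuous f}.
  apply: continuous_subspaceT => x; apply: differentiable_continuous.
  exact/derivable1_diffP.
have [c cyb eqf] := MVT yb (fun x _ => isd x) cf.
move: cyb; rewrite in_itv /= => /andP[c1 c2].
have := hd (c - y); rewrite /ball /= sub0r normrN => /(_ _ _)/wrap[||].
  by rewrite ltr_norml; apply/andP; split; lra.
  by rewrite subr_eq0 gt_eqF.
rewrite [_ *: 1]mulr1 subrK d0 subr0 => hc.
have cneg : derive1 f c < 0.
  have cy0 : 0 < (c - y)^-1 by rewrite invr_gt0 subr_gt0.
  have : (c - y)^-1 * derive1 f c < 0.
    by move: hc; rewrite /GRing.scale /= ltr_norml; lra.
  by rewrite pmulr_rlt0.
have : f y <= f (y + b).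
  by apply: he; rewrite /ball /= ltr_norml; apply/andP; split; lra.
have : derive1 f c * (y + b - y) < 0 by rewrite nmulr_rlt0//; lra.
by rewrite -eqf; lra.
Qed.

End SecondDerivativeTest.

Section ScaledTestFunctions.
Variable R : realType.

Lemma derive1_scale (k : R) (f : R -> R) x : derivable f x 1 ->
  derivable (fun x => k * f x) x 1 /\ derive1 (fun x => k * f x) x = k * derive1 f x.
Proof.
move=> df; have d : derivable (k \*: f) x 1 by exact: derivableZ.
by split; [exact: d | rewrite !derive1E; exact: deriveZ].
Qed.

Lemma near_fst_gt0 (t y : R) : 0 < t -> \forall z \near (t, y), 0 < z.1.
Proof.
move=> t0; exists ([set s | 0 < s], setT); last by case=> a b [].
split; last exact: filterT.
by apply: open_nbhs_nbhs; split; [exact: open_gt | exact: t0].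
Qed.

Lemma dt_scale (psi : R -> R -> R) k t y : 0 < t -> test_function psi ->
  dt (fun t y => k * psi t y) t y = k * dt psi t y.
Proof. by move=> t0 /(_ t y t0)[[d _ _] _]; have [] := derive1_scale k d. Qed.

Lemma dy_scale (psi : R -> R -> R) k t : 0 < t -> test_function psi ->
  derive1 (fun y => k * psi t y) = fun y => k * derive1 (psi t) y.
Proof.
move=> t0 T; apply/funext => y; have [[_ d _] _] := T t y t0.
by have [] := derive1_scale k d.
Qed.

Lemma dyy_scale (psi : R -> R -> R) k t y : 0 < t -> test_function psi ->
  dyy (fun t y => k * psi t y) t y = k * dyy psi t y.
Proof.
move=> t0 T; have [[_ _ d] _] := T t y t0.
rewrite /dyy /derive1n /= (dy_scale k t0 T).
by have [] := derive1_scale k d.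
Qed.

Lemma near_eq_cont (T : topologicalType) (f g : T -> R) x :
  (\forall z \near x, f z = g z) -> f x = g x ->
  {for x, continuous f} -> {for x, continuous g}.
Proof.
move=> fg e cf; rewrite /prop_for /continuous_at -e; apply: cvg_trans cf.
exact: near_eq_cvg.
Qed.

Lemma test_function_scale (psi : R -> R -> R) k :
  test_function psi -> test_function (fun t y => k * psi t y).
Proof.
move=> T t y t0; have [[d1 d2 d3] [c1 c2 c3 c4]] := T t y t0.
have cs (f : R * R -> R) : {for (t, y), continuous f} ->
    {for (t, y), continuous (fun z => k * f z)}.
  by move=> cf; apply: cvgM => //; exact: cvg_cst.
split; split.
- by have [] := derive1_scale k d1.
- by have [] := derive1_scale k d2.
- rewrite (dy_scale k t0 T).
  by have [] := derive1_scale k d3.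
- exact: (cs (fun z => psi z.1 z.2)).
- apply: near_eq_cont (cs _ c2); last by rewrite dt_scale.
  by apply: filterS (near_fst_gt0 y t0) => z z0; rewrite dt_scale.
- apply: near_eq_cont (cs _ c3); last by rewrite /dy /= (dy_scale k t0 T).
  by apply: filterS (near_fst_gt0 y t0) => z z0; rewrite /dy (dy_scale k z0 T).
- apply: near_eq_cont (cs _ c4); last by rewrite dyy_scale.
  by apply: filterS (near_fst_gt0 y t0) => z z0; rewrite dyy_scale.
Qed.

End ScaledTestFunctions.

Section ExplicitSolutions.
Variables (R : realType) (sl su : R).
Hypotheses (sl0 : 0 <= sl) (slu : sl <= su).

Lemma Gfun_ge0 a : 0 <= a -> 0 <= Gfun sl su a.
Proof.
by move=> a0; apply: le_trans (Gfun_ge_lower sl0 slu a); rewrite mulr_ge0// divr_ge0// sqr_ge0.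
Qed.

Lemma local_min_derivatives (psi : R -> R -> R) (t y : R) : 0 < t -> test_function psi ->
  (\forall z \near (t, y), psi t y <= psi z.1 z.2) ->
  dt psi t y = 0 /\ 0 <= dyy psi t y.
Proof.
move=> t0 T [[A C] /= [nA nC] AC].
have At : A t by exact: nbhs_singleton.
have Cy : C y by exact: nbhs_singleton.
have ny : \forall x \near y, psi t y <= psi t x.
  by apply: filterS nC => x Cx; exact: (AC (t, x)).
have nt : \forall s \near t, psi t y <= psi s y.
  by apply: filterS nA => s As; exact: (AC (s, y)).
split; last first.
  apply: derive2_local_min => //; last by have [[_ _ d3] _] := T t y t0.
  by move=> x; have [[_ d2 _] _] := T t x t0.
move: nt => /nbhs_ballP[e /= e0 he]; pose d := Num.min e t.
have d0 : 0 < d by rewrite lt_min e0.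
have h : is_derive t 1 (psi ^~ y) 0.
  have dt' : d <= t by rewrite /d ge_min lexx orbT.
  have de : d <= e by rewrite /d ge_min lexx.
  apply: (@derive1_at_min _ (psi ^~ y) (t - d) (t + d)).
  - by lra.
  - by move=> s; rewrite in_itv /= => /andP[s1 s2]; have s0 : 0 < s by [lra];
      have [[d1 _ _] _] := T s y s0.
  - by rewrite in_itv /=; apply/andP; split; lra.
  - move=> s; rewrite in_itv /= => /andP[s1 s2]; apply: he.
    by rewrite /ball /= ltr_norml; apply/andP; split; lra.
by rewrite /dt derive1E derive_val.
Qed.

(** Serves the histories at which the test functional vanishes: multiplying a solution by a constant
    [c] is justified by dividing test functions by [c], which requires [c > 0]. *)
Lemma G_heat_solution0 : G_heat_solution sl su (fun=> 0) (fun _ _ => 0).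
Proof.
split => //.
- by apply: continuous_subspaceT => x; exact: cvg_cst.
- by exists 0 => t y _; rewrite normr0.
- move=> psi t y t0 T h.
  have [-> d2] : dt psi t y = 0 /\ 0 <= dyy psi t y.
    by apply: local_min_derivatives => //; apply: filterS h => z; rewrite !sub0r lerN2.
  exact: Gfun_ge0.
- move=> psi t y t0 T h.
  have T' := test_function_scale (-1) T.
  have := @local_min_derivatives _ t y t0 T'.
  rewrite (dt_scale _ _ t0 T) (dyy_scale _ _ t0 T) !mulN1r => /(_ _)/wrap[|[/eqP]].
    by apply: filterS h => z; rewrite !sub0r !mulN1r.
  rewrite oppr_eq0 => /eqP-> d2; rewrite Gfun_max//; move: d2; rewrite oppr_ge0 => d2.
  by rewrite ge_max !mulr_ge0_le0// divr_ge0// sqr_ge0.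
Qed.

Lemma G_heat_solution_affine (f : R -> R) u (c a : R) : 0 < c -> G_heat_solution sl su f u ->
  G_heat_solution sl su (fun y => c * (f y - a)) (fun t y => c * (u t y - a)).
Proof.
move=> c0 [cu [M uM] u0 usub usup].
have kc : 0 <= c^-1 by rewrite invr_ge0 ltW.
split.
- move=> z; apply: cvgM; first exact: cvg_cst.
  by apply: cvgB; [exact: cu | exact: cvg_cst].
- exists (c * (M + `|a|)) => t y t0; rewrite normrM (gtr0_norm c0) ler_pM2l//.
  by apply: (le_trans (ler_normB _ _)); rewrite lerD2r uM.
- by move=> y; rewrite u0.
- move=> psi t y t0 T h.
  have := usub _ t y t0 (test_function_scale c^-1 T).
  rewrite (dt_scale _ _ t0 T) (dyy_scale _ _ t0 T) GfunZ// ler_pM2l ?invr_gt0//.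
  apply; apply: filterS h => z hz.
  rewrite -(ler_pM2l c0) !mulrBr !mulVKf ?gt_eqF//; lra.
- move=> psi t y t0 T h.
  have := usup _ t y t0 (test_function_scale c^-1 T).
  rewrite (dt_scale _ _ t0 T) (dyy_scale _ _ t0 T) GfunZ// ler_pM2l ?invr_gt0//.
  apply; apply: filterS h => z hz.
  rewrite -(ler_pM2l c0) !mulrBr !mulVKf ?gt_eqF//; lra.
Qed.

End ExplicitSolutions.

Section LipschitzTuples.
Variable R : realType.

Definition l1_dist (i : nat) (x y : i.-tuple R) : R :=
  \sum_(k < i) `|tnth x k - tnth y k|.

Lemma l1_dist_ge0 i (x y : i.-tuple R) : 0 <= l1_dist x y.
Proof. exact: sumr_ge0. Qed.

Lemma bounded_lipschitzM i (f g : i.-tuple R -> R) :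
  bounded_lipschitz f -> bounded_lipschitz g -> bounded_lipschitz (fun x => f x * g x).
Proof.
move=> /bounded_lipschitzP[K [M [K0 M0 [fM fK]]]] /bounded_lipschitzP[K' [M' [K'0 M'0 [gM gK]]]].
split; first by exists (M * M') => x; rewrite normrM ler_pM.
exists (K * M' + M * K') => x y.
have -> : f x * g x - f y * g y = (f x - f y) * g x + f y * (g x - g y) by ring.
apply: (le_trans (ler_normD _ _)); rewrite !normrM mulrDl lerD//.
  by rewrite mulrAC ler_pM.
by rewrite -mulrA ler_pM.
Qed.

Lemma bounded_lipschitzB i (f g : i.-tuple R -> R) :
  bounded_lipschitz f -> bounded_lipschitz g -> bounded_lipschitz (fun x => f x - g x).
Proof.
move=> /bounded_lipschitzP[K [M [K0 M0 [fM fK]]]] /bounded_lipschitzP[K' [M' [K'0 M'0 [gM gK]]]].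
split; first by exists (M + M') => x; apply: (le_trans (ler_normB _ _)); rewrite lerD.
exists (K + K') => x y.
have -> : f x - g x - (f y - g y) = (f x - f y) - (g x - g y) by ring.
by apply: (le_trans (ler_normB _ _)); rewrite mulrDl lerD.
Qed.

Lemma bounded_lipschitz_comp i k (f : k.-tuple R -> R) (h : i.-tuple R -> k.-tuple R) (L : R) :
  (forall a x y, `|tnth (h x) a - tnth (h y) a| <= L * l1_dist x y) ->
  bounded_lipschitz f -> bounded_lipschitz (fun x => f (h x)).
Proof.
move=> hL /bounded_lipschitzP[K [M [K0 M0 [fM fK]]]]; split; first by exists M.
exists (K * (k%:R * L)) => x y; apply: (le_trans (fK _ _)); rewrite -!mulrA ler_wpM2l//.
apply: (@le_trans _ _ (\sum_(a < k) L * l1_dist x y)); first exact: ler_sum.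
by rewrite sumr_const card_ord mulr_natl.
Qed.

Definition mk_tuple (p : nat) (l : seq R) : p.-tuple R := [tuple nth 0 l a | a < p].

Lemma mk_tupleE p (x : p.-tuple R) : mk_tuple p x = x.
Proof. by apply: eq_from_tnth => a; rewrite tnth_mktuple (tnth_nth 0). Qed.

Lemma mk_tuple_rcons l y : mk_tuple (size l).+1 (rcons l y) = rcons_tuple (mk_tuple (size l) l) y.
Proof.
rewrite (_ : mk_tuple (size l) l = in_tuple l); last exact: (mk_tupleE (in_tuple l)).
by rewrite -[RHS]mk_tupleE.
Qed.

Lemma l1_dist_nth i (x y : i.-tuple R) :
  l1_dist x y = \sum_(0 <= a < i) `|nth 0 x a - nth 0 y a|.
Proof. by rewrite big_mkord; apply: eq_bigr => a _; rewrite !(tnth_nth 0). Qed.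

Lemma psum_dist i (x y : i.-tuple R) k : (k <= i)%N -> `|psum x k - psum y k| <= l1_dist x y.
Proof.
move=> ki; rewrite /psum -sumrB; apply: (le_trans (ler_norm_sum _ _ _)).
rewrite l1_dist_nth (big_cat_nat (n := k))//= big_mkord lerDl.
by apply: sumr_ge0.
Qed.

Lemma nth_dist i (x y : i.-tuple R) a : `|nth 0 x a - nth 0 y a| <= l1_dist x y.
Proof.
have [ai|ia] := ltnP a i; last by rewrite !nth_default ?size_tuple// subrr normr0 l1_dist_ge0.
rewrite /l1_dist (bigD1 (Ordinal ai))//= !(tnth_nth 0) /= lerDl.
by apply: sumr_ge0.
Qed.

End LipschitzTuples.

Section TestedConditionalExpectation.
Variables (R : realType) (sl su : R).
Hypotheses (sl0 : 0 <= sl) (slu : sl <= su).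
Variables (m j : nat) (s : nat -> R) (phi : forall i : nat, i.-tuple R -> R).
Hypotheses (jm : (j <= m)%N) (s0 : s 0%N = 0).
Hypothesis ss : forall i, (i < m)%N -> s i <= s i.+1.
Hypothesis phiL : bounded_lipschitz (phi (i := m)).
Hypothesis back : forall i, (i < m)%N -> backward_step sl su s phi i.
Variables (Xi : (R -> R) -> R) (ts : seq R) (K M : R).
Hypotheses (ts0 : forall r, r \in ts -> 0 <= r <= s j) (K0 : 0 <= K).
Hypothesis XiM : forall x, `|Xi x| <= M.
Hypothesis XiK : forall x y, `|Xi x - Xi y| <= K * \sum_(r <- ts) `|x r - y r|.
Hypothesis Xi0 : forall x, 0 <= Xi x.

(* The grid of [phi] is refined before time [s j] by the times on which [Xi]
   depends; at and after step [J] the value function is [Xi] times that of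
   [phi] minus its conditional expectation at [s j]; before [J] it vanishes. *)
Let grid : seq R := sort <=%O (0 :: ts ++ [seq s a | a <- iota 0 j.+1]).
Let J : nat := (size ts + j.+1)%N.
Let s' (i : nat) : R := if (i < J)%N then nth 0 grid i else s (j + (i - J)).
(** Position at the grid time [u], rebuilt from increments. The cap [J] makes it a function of the
    first [J] increments even if [u] is not in the grid. *)
Let pos (x : seq R) (u : R) : R := psum x (minn J (index u grid)).
(** Increments over the original grid: the first [j] are recomputed from positions, the later ones
    are common to both grids. *)
Let zs (x : seq R) : seq R := pincr s j (pos x) ++ drop J x.
Let Phi (i : nat) (x : i.-tuple R) : R :=
  if (i < J)%N then 0 else
  Xi (pos x) * (phi (mk_tuple (i - J + j) (zs x)) - phi (pincr s j (pos x))).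
Let m' : nat := (J + (m - j))%N.

Let s_mono a b : (a + b <= m)%N -> s a <= s (a + b)%N.
Proof.
elim: b => [|b IH] ab; first by rewrite addn0.
by rewrite addnS in ab *; apply: le_trans (ss ab); apply: IH; exact: ltnW.
Qed.

Let s_le a : (a <= j)%N -> 0 <= s a <= s j.
Proof.
move=> aj; rewrite -{1}s0 -{1}[a]add0n s_mono ?(leq_trans aj)//=.
by rewrite -(subnKC aj) s_mono// subnKC.
Qed.

Let size_grid : size grid = J.+1.
Proof. by rewrite size_sort /= size_cat /= size_map size_iota. Qed.

Let mem_grid u : (u \in grid) = [|| u == 0, u \in ts | u \in [seq s a | a <- iota 0 j.+1]].
Proof. by rewrite mem_sort inE mem_cat. Qed.

Let grid_s a : (a <= j)%N -> s a \in grid.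
Proof.
move=> aj; rewrite mem_grid; apply/orP; right; apply/orP; right.
by apply: map_f; rewrite mem_iota add0n ltnS.
Qed.

Let grid_range u : u \in grid -> 0 <= u <= s j.
Proof.
rewrite mem_grid => /or3P[/eqP->|/ts0 //|/mapP[a]].
  by rewrite lexx; have /andP[] := s_le (leqnn j).
by rewrite mem_iota add0n ltnS => /andP[_ aj] ->; exact: s_le.
Qed.

Let grid_sorted : sorted <=%O grid. Proof. exact: sort_le_sorted. Qed.

Let nth_grid_le a b : (a <= b)%N -> (b <= J)%N -> nth 0 grid a <= nth 0 grid b.
Proof.
move=> ab bJ; apply: (sorted_leq_nth le_trans le_refl) => //; rewrite inE size_grid ltnS//.
exact: leq_trans bJ.
Qed.

Let index_grid u : u \in grid -> (index u grid <= J)%N.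
Proof. by rewrite -ltnS -size_grid index_mem. Qed.

Let grid0 : nth 0 grid 0 = 0.
Proof.
have g0 : 0 \in grid by rewrite mem_grid eqxx.
apply/eqP; rewrite eq_le; apply/andP; split.
  by rewrite -[leRHS](nth_index 0 g0); apply: nth_grid_le => //; exact: index_grid.
by have /andP[] : 0 <= nth 0 grid 0 <= s j by apply/grid_range/mem_nth; rewrite size_grid.
Qed.

Let gridJ : nth 0 grid J = s j.
Proof.
have gj := grid_s (leqnn j).
apply/eqP; rewrite eq_le; apply/andP; split.
  by have /andP[] : 0 <= nth 0 grid J <= s j by apply/grid_range/mem_nth; rewrite size_grid.
by rewrite -[leLHS](nth_index 0 gj); apply: nth_grid_le => //; exact: index_grid.
Qed.

Let s'_grid i : (i <= J)%N -> s' i = nth 0 grid i.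
Proof.
rewrite /s' leq_eqVlt => /predU1P[->|->//].
by rewrite ltnn subnn addn0 gridJ.
Qed.

Let s'_tail b : s' (J + b) = s (j + b)%N.
Proof. by rewrite /s' ltnNge leq_addr /= addKn. Qed.

Let pos_increments w u : u \in grid -> pos (increments s' m' w) u = B u w.
Proof.
move=> ug; have iJ := index_grid ug.
rewrite /pos (minn_idPr iJ).
have iu : u = s' (index u grid) by rewrite s'_grid// nth_index.
have im : (index u grid <= m')%N by apply: leq_trans iJ (leq_addr _ _).
rewrite {2}iu; move: im; move: (index u grid) => k; elim: k => [|k IH] km.
  rewrite /psum big_ord0 s'_grid// grid0.
  by have [_ /(_ 0 (lexx 0)) ->] : @C0_paths R (fun s : R => B s w) := set_valP w.
rewrite /psum big_ord_recr /= -/(psum _ k) IH ?(ltnW km)//.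
by rewrite (nth_map (Ordinal km)) ?size_enum_ord// nth_enum_ord// addrC subrK.
Qed.

Let Xi_eq x y : {in grid, x =1 y} -> Xi x = Xi y.
Proof.
move=> xy; apply/eqP; rewrite -subr_eq0 -normr_le0; apply: (le_trans (XiK _ _)).
rewrite big_seq big1 ?mulr0// => r rts; rewrite xy ?subrr ?normr0//.
by rewrite mem_grid rts orbT.
Qed.

Let pincr_eq x y : {in grid, x =1 y} -> pincr s j x = pincr s j y.
Proof.
move=> xy; apply: eq_from_tnth => a; rewrite !tnth_mktuple.
by rewrite !xy ?grid_s// ltnW.
Qed.

Let phi_cast p q l : p = q -> phi (mk_tuple p l) = phi (mk_tuple q l).
Proof. by move->. Qed.

Let size_zs x : size (zs x) = (size x - J + j)%N.
Proof. by rewrite size_cat size_tuple size_drop addnC. Qed.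

Let PhiJ (x : J.-tuple R) : Phi x = 0.
Proof.
rewrite /Phi ltnn (@phi_cast _ j); last by rewrite subnn.
by rewrite /zs drop_oversize ?size_tuple// cats0 mk_tupleE subrr mulr0.
Qed.

Let Phi_increments w : Phi (increments s' m' w) =
  Xi (fun r => B r w) * (phi (increments s m w) - phi (increments s j w)).
Proof.
rewrite /Phi /m' ltnNge leq_addr /=.
have gr : {in grid, pos (increments s' m' w) =1 fun r => B r w}.
  by move=> u; exact: pos_increments.
rewrite (Xi_eq gr) (pincr_eq gr); congr (_ * (_ - _)).
rewrite (@phi_cast _ m); last by rewrite addKn subnK.
congr phi; apply: eq_from_tnth => a; rewrite !tnth_mktuple /zs (pincr_eq gr) nth_cat size_tuple.
have [aj|ja] := ltnP a j.
  by rewrite (nth_map (Ordinal aj)) ?size_enum_ord// nth_enum_ord.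
have am' : (J + (a - j) < m')%N by rewrite ltn_add2l ltn_sub2r// (leq_ltn_trans ja).
rewrite nth_drop (nth_map (Ordinal am')) ?size_enum_ord// nth_enum_ord// -addnS.
by rewrite !s'_tail addnS subnKC.
Qed.

Let pos_rcons x y : (J <= size x)%N -> pos (rcons x y) = pos x.
Proof.
move=> Jx; apply/funext => u; rewrite /pos -cats1 psum_cat//.
by rewrite (leq_trans (geq_minl _ _)).
Qed.

Let Phi_rcons i (x : i.-tuple R) y : (J <= i)%N -> Phi (rcons_tuple x y) =
  Xi (pos x) * (phi (rcons_tuple (mk_tuple (i - J + j) (zs x)) y) - phi (pincr s j (pos x))).
Proof.
move=> Ji; have Jx : (J <= size x)%N by rewrite size_tuple.
rewrite /Phi ltnNge leqW//= pos_rcons//; congr (_ * (_ - _)).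
rewrite (_ : zs (rcons x y) = rcons (zs x) y); last first.
  by rewrite /zs pos_rcons// drop_rcons// rcons_cat.
have sz : size (zs x) = (i - J + j)%N by rewrite size_zs size_tuple.
rewrite (@phi_cast _ (i - J + j).+1); last by rewrite subSn.
by congr phi; rewrite -sz mk_tuple_rcons.
Qed.

Let Phi_back i : (i < m')%N -> backward_step sl su s' Phi i.
Proof.
move=> im x.
have zero : (forall y, Phi (rcons_tuple x y) = 0) -> Phi x = 0 ->
    exists2 u, G_heat_solution sl su (fun y => Phi (rcons_tuple x y)) u &
    Phi x = u (s' i.+1 - s' i) 0.
  move=> Pz Px; exists (fun _ _ => 0); last by [].
  by rewrite (_ : (fun y => _) = fun=> 0); [exact: G_heat_solution0 | apply/funext].
have [iJ|Ji] := ltnP i J.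
  apply: zero; last by rewrite /Phi iJ.
  move=> y; move: iJ; rewrite leq_eqVlt => /predU1P[iJ|iJ]; last by rewrite /Phi iJ.
  by move: (rcons_tuple x y); rewrite iJ; exact: PhiJ.
have := Xi0 (pos x); rewrite le_eqVlt => /predU1P[X0|Xpos].
  apply: zero; first by move=> y; rewrite Phi_rcons// -X0 mul0r.
  by rewrite /Phi ltnNge Ji /= -X0 mul0r.
have qm : (i - J + j < m)%N.
  by rewrite -(ltn_sub2rE _ (leq_addl _ j)) addnK ltn_subLR.
have [u hu eu] := back qm (mk_tuple (i - J + j) (zs x)).
exists (fun t y => Xi (pos x) * (u t y - phi (pincr s j (pos x)))).
  have := G_heat_solution_affine (phi (pincr s j (pos x))) Xpos hu.
  by congr (G_heat_solution _ _ _ _); apply/funext => y; rewrite Phi_rcons.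
rewrite /Phi ltnNge Ji /= eu; congr (_ * (u _ _ - _)).
have -> : s' i.+1 = s (i - J + j).+1 by rewrite addnC -addnS -s'_tail addnS subnKC.
by have -> : s' i = s (i - J + j)%N by rewrite addnC -s'_tail subnKC.
Qed.

Let Phi_lipschitz : bounded_lipschitz (Phi (i := m')).
Proof.
have Jm : (J <= m')%N by exact: leq_addr.
have pos_dist u (x y : m'.-tuple R) : `|pos x u - pos y u| <= l1_dist x y.
  by apply: psum_dist; apply: leq_trans Jm; exact: geq_minl.
have pincr_dist a (x y : m'.-tuple R) :
    `|tnth (pincr s j (pos x)) a - tnth (pincr s j (pos y)) a| <= 2 * l1_dist x y.
  rewrite !tnth_mktuple.
  rewrite (_ : _ - _ = (pos x (s a.+1) - pos y (s a.+1)) - (pos x (s a) - pos y (s a)));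
    last ring.
  by apply: (le_trans (ler_normB _ _)); rewrite mulr_natl mulr2n lerD.
rewrite /Phi ltnNge Jm /=.
apply: bounded_lipschitzM.
  split; first by exists M.
  exists (K * (size ts)%:R) => x y; apply: (le_trans (XiK _ _)); rewrite -mulrA ler_wpM2l//.
  apply: (@le_trans _ _ (\sum_(r <- ts) l1_dist x y)); first by apply: ler_sum => r _.
  by rewrite big_const_seq count_predT iter_addr_0 mulr_natl.
have mE : (m' - J + j)%N = m by rewrite addKn subnK.
apply: bounded_lipschitzB.
  apply: (@bounded_lipschitz_comp _ _ _ (phi (i := (m' - J + j)%N)) _ 2).
    move=> a x y; rewrite !tnth_mktuple /zs !nth_cat !size_tuple.
    case: ltnP => aj; last first.
      rewrite !nth_drop; apply: (le_trans (nth_dist _ _ _)).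
      by rewrite mulr_natl mulr2n lerDl l1_dist_ge0.
    by have := pincr_dist (Ordinal aj) x y; rewrite !(tnth_nth 0).
  by rewrite mE.
apply: (@bounded_lipschitz_comp _ _ _ (phi (i := j)) _ 2) => //.
have [K' [M' [K'0 M'0 lb]]] := bounded_lipschitzP phiL.
have [b1 b2] := lip_bound_chain sl0 slu K'0 ss back lb jm.
by split; [exists M' | exists K'].
Qed.

Lemma Lip_exp_tested : (0 < m)%N -> Lip_exp sl su
  (fun w => Xi (fun r => B r w) * (phi (increments s m w) - phi (increments s j w))) 0.
Proof.
move=> m0; exists m', 0%N, s', Phi; split; split => //.
- by rewrite /m' /J addnS.
- by rewrite s'_grid.
- move=> i im; have [iJ|Ji] := ltnP i J.
    by rewrite !s'_grid// ?(ltnW iJ)// nth_grid_le.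
  rewrite -(subnKC Ji) -addnS !s'_tail addnS; apply: ss.
  by rewrite -ltn_subRL ltn_subLR.
- by apply/funext => w; rewrite Phi_increments.
- by rewrite s'_grid.
- by apply/funext => w; rewrite /Phi /J addnS.
Qed.

End TestedConditionalExpectation.

Lemma Ex_tested_cond_exp (R : realType) (sl su : R) : 0 <= sl -> sl <= su ->
  forall (P : probability (Omega R) R) t xi eta Xi, PG sl su P ->
  Lip_cond_exp sl su t xi eta -> cyl t Xi -> (forall x, 0 <= Xi x) ->
  Ex P (fun w => Xi (fun r => B r w) * (xi w - eta w)) <= 0.
Proof.
move=> sl0 slu P t xi eta Xi PP ce cX X0.
have [T [F [G [[/andP[t0 tT] cF cG xiE etaE] _]]]] := Lip_cond_exp_walk sl0 slu ce.
have iE : integ P (fun w => Xi (fun r => B r w) * (xi w - eta w)).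
  rewrite xiE etaE; apply: (@cyl_integ _ P T (fun x => Xi x * (F x - G x))).
  by apply: cylM; [exact: cyl_le cX | apply: cylB => //; exact: cyl_le cG].
rewrite -lee_fin -Ex_EFin//; apply: PP.
move: ce => [m [j [s [phi [[m0 jm s0 ss phiL] [-> bs tE ->]]]]]].
have [ts [K [M [ts0 K0 XM XK]]]] := cX.
apply: (Lip_exp_tested sl0 slu jm s0 ss phiL bs (ts := ts) (K := K) (M := M)) => //.
by rewrite -tE.
Qed.

(** * Measures that nearly attain conditional G-expectations *)

Section WalkExtra.
Variables (R : realType) (s1 s2 r : R).
Implicit Types F G : seq R -> R.

Lemma iter_lstep_le_size al k F G l :
  (forall l', size l' = k -> F (l ++ l') <= G (l ++ l')) ->
  iter k (lstep s1 s2 r al) F l <= iter k (lstep s1 s2 r al) G l.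
Proof.
elim: k l => [|k IH] l FG; first by have := FG [::] erefl; rewrite cats0.
have ih x : iter k (lstep s1 s2 r al) F (rcons l x) <= iter k (lstep s1 s2 r al) G (rcons l x).
  by apply: IH => l' sl'; rewrite cat_rcons; apply: FG; rewrite /= sl'.
exact: wavg_le.
Qed.

Lemma iter_lstep_sum al k K (F : nat -> seq R -> R) l :
  iter k (lstep s1 s2 r al) (fun l => \sum_(i < K) F i l) l =
  \sum_(i < K) iter k (lstep s1 s2 r al) (F i) l.
Proof.
elim: K => [|K IH].
  rewrite big_ord0 -[RHS](iter_lstep_cst s1 s2 r al k 0 l); congr (iter _ _ _ _).
  by apply/funext => l'; rewrite big_ord0.
rewrite big_ord_recr /= -IH -iter_lstepD; congr (iter _ _ _ _).
by apply/funext => l'; rewrite big_ord_recr.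
Qed.

Lemma iter_wstep_dist k F G l :
  `|iter k (wstep s1 s2 r) F l - iter k (wstep s1 s2 r) G l| <=
  iter k (wstep s1 s2 r) (fun l => `|F l - G l|) l.
Proof.
have half F' G' : iter k (wstep s1 s2 r) F' l <=
    iter k (wstep s1 s2 r) (fun l => `|F' l - G' l|) l + iter k (wstep s1 s2 r) G' l.
  apply: le_trans (iter_wstepD s1 s2 r k _ _ l); apply: iter_wstep_le => l' _.
  by have := ler_norm (F' (l ++ l') - G' (l ++ l')); lra.
rewrite ler_norml; have := half F G; have := half G F.
rewrite (_ : (fun l => `|G l - F l|) = fun l => `|F l - G l|); first lra.
by apply/funext => l'; rewrite distrC.
Qed.

Lemma iter_wstep_stable a b F l :
  (forall l1 l2, size l1 = (size l + a)%N -> F (l1 ++ l2) = F l1) ->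
  iter (a + b) (wstep s1 s2 r) F l = iter a (wstep s1 s2 r) F l.
Proof.
move=> st; rewrite iterD; apply: eq_iter_wstep => l1 sl1.
rewrite -[RHS](iter_wstep_cst s1 s2 r b _ (l ++ l1)); apply: eq_iter_wstep => l2 _.
by apply: st; rewrite size_cat sl1.
Qed.

End WalkExtra.

Lemma cyl_eq (R : realType) (t : R) F x y : cyl t F ->
  (forall s, 0 <= s <= t -> x s = y s) -> F x = F y.
Proof.
move=> [ts [K [M [ts0 K0 _ FK]]]] xy; apply/eqP; rewrite -subr_eq0 -normr_le0.
apply: (le_trans (FK _ _)); rewrite big_seq big1 ?mulr0// => s /ts0 st.
by rewrite xy// subrr normr0.
Qed.

Lemma cyl_wpath_cat (R : realType) (t : R) F n l l' : cyl t F -> (tick n t <= size l)%N ->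
  F (wpath n (l ++ l')) = F (wpath n l).
Proof.
move=> cF tl; apply: (cyl_eq cF) => s /andP[_ st]; rewrite /wpath psum_cat//.
by apply: leq_trans tl; exact: tick_le.
Qed.

(** * One strategy for all dates *)

Section WalkDrift.
Variables (R : realType) (sl su : R) (n K : nat) (Z : nat -> (R -> R) -> R).
Hypotheses (Kn : (K <= n)%N) (cZ : forall k, (k < K)%N -> cyl k.+1%:R (Z k)).

Let tk (k : nat) : nat := (k * 4 ^ n)%N.
Let rem (k : nat) : nat := (horizon n - tk k)%N.

Definition pred_val (k : nat) (l : seq R) : R :=
  iter (rem k) (wstepn sl su n) (fun l' => Z k (wpath n l')) l.

Definition drift (k : nat) (l : seq R) : R :=
  \sum_(i < k) (Z i (wpath n l) - pred_val i (take (tk i) l)).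

Let tk_le a b : (a <= b)%N -> (tk a <= tk b)%N.
Proof. by move=> ab; rewrite leq_mul2r ab orbT. Qed.

Let tkS k : tk k.+1 = (tk k + 4 ^ n)%N. Proof. by rewrite /tk mulSn addnC. Qed.

Let remE k : (k < K)%N -> rem k = (4 ^ n + rem k.+1)%N.
Proof.
move=> kK; rewrite /rem tkS subnDA subnKC// -(leq_add2l (tk k)) subnKC -?tkS.
  by apply: tk_le; exact: leq_trans Kn.
by apply: tk_le; apply: leq_trans Kn; exact: ltnW.
Qed.

Lemma drift_cat k l l' : (k <= K)%N -> (tk k <= size l)%N -> drift k (l ++ l') = drift k l.
Proof.
move=> kK kl; apply: eq_bigr => i _; have ik := ltn_ord i.
rewrite (cyl_wpath_cat _ (cZ (leq_trans ik kK))) ?(tick_nat R)//; last first.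
  exact: leq_trans (tk_le ik) kl.
by rewrite takel_cat//; apply: leq_trans kl; apply: tk_le; exact: ltnW.
Qed.

(** Given the history at date [i], the term of index [i] has upper expectation 0 and the earlier
    terms are constants, so the sum is a martingale for the sublinear conditional expectation. *)
Lemma iter_drift k l : (k <= K)%N -> size l = tk k ->
  iter (rem k) (wstepn sl su n) (drift K) l = drift k l.
Proof.
move=> kK; rewrite -(subKn kK); move: (K - k)%N (leq_subr k K) => d.
elim: d l => [|d IH] l dK sz.
  rewrite subn0 in sz *; rewrite -[RHS](iter_wstep_cst sl su (rstep R n) (rem K) _ l).
  by apply: eq_iter_wstep => l' _; apply: drift_cat; rewrite ?sz.
set k' := (K - d.+1)%N in sz *.
have k'K : (k' < K)%N by rewrite /k' ltn_subrL /=; apply: leq_trans dK.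
have e : (K - d = k'.+1)%N by rewrite /k' subnSK.
rewrite e in IH; rewrite remE// iterD.
pose c := drift k' l - pred_val k' l.
transitivity (iter (4 ^ n) (wstepn sl su n) (fun l' => Z k' (wpath n l') + c) l).
  apply: eq_iter_wstep => l' sl'; rewrite IH ?(ltnW dK)//; last by rewrite size_cat sz sl' tkS.
  rewrite /drift big_ord_recr /= -/(drift k' _) drift_cat ?(ltnW k'K) ?sz//.
  by rewrite take_size_cat ?sz// /c; ring.
rewrite /wstepn iter_wstep_addc.
rewrite -(@iter_wstep_stable _ _ _ _ _ (rem k'.+1)) -?remE//; first by rewrite /c /pred_val; ring.
move=> l1 l2 sl1; apply: cyl_wpath_cat; first exact: cZ.
by rewrite (tick_nat R) sl1 sz -tkS.
Qed.

(* The increments of [drift] have upper expectation 0 given the past, so the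
   strategy that is optimal for [drift] makes its linear expectation vanish. *)
Lemma walk_drift_strategy : exists al : seq R -> bool,
  forall (F G : nat -> (R -> R) -> R) (e : R),
  (forall k, (k < K)%N -> cyl k%:R (G k)) ->
  (forall k, (k < K)%N -> forall l, size l = tick n (k%:R : R) ->
    `|iter (horizon n - tick n (k%:R : R)) (wstepn sl su n) (fun l' => F k (wpath n l')) l
      - G k (wpath n l)| <= e) ->
  - \sum_(k < K) (e + walk_supexp sl su n (fun x => `|F k x - Z k x|)) <=
  iter (horizon n) (lstep sl su (rstep R n) al)
    (fun l => \sum_(k < K) (Z k (wpath n l) - G k (wpath n l))) [::].
Proof.
have [al alP] := optimal_strategy sl su (rstep R n) (horizon n) (drift K).
exists al => F G e cG FG.
pose h k l := iter (rem k) (wstepn sl su n) (fun l' => `|F k (wpath n l') - Z k (wpath n l')|) l.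
have d0 : iter (horizon n) (lstep sl su (rstep R n) al) (drift K) [::] = 0.
  rewrite alP//; have := iter_drift (leq0n K) (erefl : size (Nil R) = tk 0).
  by rewrite /rem /tk mul0n subn0 /drift big_ord0.
(* The upper prediction of [Z k] differs from that of [F k] by at most [h k], the upper prediction
   of [|F k - Z k|], and the latter differs from [G k] by at most [e]. *)
pose W l := drift K l + -1 * \sum_(k < K) (e + h k (take (tk k) l)).
apply: (@le_trans _ _ (iter (horizon n) (lstep sl su (rstep R n) al) W [::])); last first.
  apply: iter_lstep_le_size => l szl; rewrite /W /drift mulN1r -sumrN -big_split /=.
  apply: ler_sum => k _; have kK := ltn_ord k.
  have tl : (tk k <= size l)%N.
    by rewrite szl; apply: tk_le; apply: leq_trans Kn; exact: ltnW.
  set l0 := take (tk k) l; have sl0 : size l0 = tk k by rewrite size_takel.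
  have -> : G k (wpath n l) = G k (wpath n l0).
    rewrite -[in LHS](cat_take_drop (tk k) l); apply: cyl_wpath_cat; first exact: cG.
    by rewrite (tick_nat R) sl0.
  have := FG k kK l0; rewrite (tick_nat R) => /(_ sl0).
  have := iter_wstep_dist sl su (rstep R n) (rem k) (fun l' => F k (wpath n l'))
    (fun l' => Z k (wpath n l')) l0.
  rewrite -/(wstepn sl su n) -/(h k l0) -/(pred_val k l0) -/(rem k).
  rewrite /= !ler_norml; lra.
rewrite /W iter_lstepD d0 add0r iter_lstepZ mulN1r lerN2.
rewrite (iter_lstep_sum sl su (rstep R n) al (horizon n) K (fun k l => e + h k (take (tk k) l))).
apply: ler_sum => k _; rewrite iter_lstepD iter_lstep_cst lerD2l.
apply: (le_trans (iter_lstep_le_wstep _ _ _ _ _ _ _)).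
rewrite /walk_supexp -/(wstepn sl su n).
have kn : (tk k <= horizon n)%N by apply: tk_le; apply: leq_trans Kn; exact: ltnW.
rewrite -(subnKC kn) !iterD; apply: iter_wstep_le => l szl /=.
rewrite -/(rem k) -[leRHS](iter_wstep_cst sl su (rstep R n) (rem k) _ l).
by apply: iter_wstep_le => l' _; rewrite take_size_cat.
Qed.

End WalkDrift.

Section DriftMeasure.
Variables (R : realType) (sl su : R).
Hypotheses (sl0 : 0 <= sl) (slu : sl <= su).

Lemma exists_ultra_oo : exists2 U : set_system nat, UltraFilter U & \oo `<=` U.
Proof.
by have [U [UU Uoo]] := ultraFilterLemma (@eventually_filter); exists U.
Qed.

(* The strategies that attain [walk_supexp n F] also define a measure in [PG]. *)
Lemma ulim_walk_supexp_le (U : set_system nat) (t : R) F (d : R) :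
  UltraFilter U -> \oo `<=` U -> cyl t F ->
  (forall P : probability (Omega R) R, PG sl su P ->
     Ex P (fun w => F (fun s => B s w)) <= d) ->
  ulim U (fun n => walk_supexp sl su n F) <= d /\
  bounded_seq (fun n => walk_supexp sl su n F).
Proof.
move=> UU Uoo cF Pd.
have ex n : exists al, iter (horizon n) (lstep sl su (rstep R n) al)
    (fun l => F (wpath n l)) [::] = walk_supexp sl su n F.
  have [al alP] := optimal_strategy sl su (rstep R n) (horizon n) (fun l => F (wpath n l)).
  by exists al; rewrite alP.
have [al alP] := choice ex.
have [Q PQ QE] := limit_exp_PG sl0 slu al UU Uoo.
have e : (fun n => walk_supexp sl su n F) = fun n => walk_exp sl su al n F.
  by apply/funext => n; rewrite -alP.
rewrite e; split; first by rewrite -[leLHS](QE _ _ cF); exact: Pd.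
by apply: walk_exp_bounded; have [M _ FM] := cyl_bounded cF; exists M.
Qed.

(** Two approximations of the same variable are needed: [F k] has the known conditional expectation
    [G k] but may look beyond date [k + 1], whereas [Z k] is decided at date [k + 1], as the
    martingale argument requires. The bound [d] measures their distance under every measure of
    [PG]. *)
Lemma exists_drift_measure (K : nat) (T : nat -> R) (F G Z : nat -> (R -> R) -> R) (d e : R) :
  0 < e ->
  (forall k, (k < K)%N -> [/\ cyl (T k) (F k), cyl k%:R (G k) & cyl k.+1%:R (Z k)]) ->
  (forall k, (k < K)%N -> forall eps, 0 < eps -> exists n0, forall n, (n0 <= n)%N ->
     forall N, (tick n (T k) <= N)%N -> forall l, size l = tick n (k%:R : R) ->
     `|iter (N - tick n (k%:R : R)) (wstepn sl su n) (fun l' => F k (wpath n l')) l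
       - G k (wpath n l)| <= eps) ->
  (forall k, (k < K)%N -> forall P : probability (Omega R) R, PG sl su P ->
     Ex P (fun w => `|F k (fun s => B s w) - Z k (fun s => B s w)|) <= d) ->
  exists2 Q : probability (Omega R) R, PG sl su Q &
    - (K%:R * (e + d)) <=
    Ex Q (fun w => \sum_(k < K) (Z k (fun s => B s w) - G k (fun s => B s w))).
Proof.
move=> e0 cyls conv Pd; have [U UU Uoo] := exists_ultra_oo.
have cZ k : (k < K)%N -> cyl k.+1%:R (Z k) by move=> /cyls[].
have ex n : exists al : seq R -> bool, (K <= n)%N -> forall (F G : nat -> (R -> R) -> R) (e : R),
  (forall k, (k < K)%N -> cyl k%:R (G k)) ->
  (forall k, (k < K)%N -> forall l, size l = tick n (k%:R : R) ->
    `|iter (horizon n - tick n (k%:R : R)) (wstepn sl su n) (fun l' => F k (wpath n l')) l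
      - G k (wpath n l)| <= e) ->
  - \sum_(k < K) (e + walk_supexp sl su n (fun x => `|F k x - Z k x|)) <=
  iter (horizon n) (lstep sl su (rstep R n) al)
    (fun l => \sum_(k < K) (Z k (wpath n l) - G k (wpath n l))) [::].
  have [Kn|] := boolP (K <= n)%N; last by exists (fun=> true).
  by have [al alP] := walk_drift_strategy sl su Kn cZ; exists al => _; exact: alP.
have [al alP] := choice ex.
have [Q PQ QE] := limit_exp_PG sl0 slu al UU Uoo; exists Q => //.
have [t [ct cS]] : exists t : R, cyl t (fun x => \sum_(k < K) (Z k x - G k x)) /\
    forall k, (k < K)%N -> T k <= t.
  exists (K%:R + \sum_(k < K) `|T k|); split; last first.
    move=> k kK; rewrite (bigD1 (Ordinal kK))//=; apply: (le_trans (ler_norm _)).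
    by rewrite addrCA lerDl addr_ge0// sumr_ge0.
  have s0 : 0 <= \sum_(k < K) `|T k| by exact: sumr_ge0.
  apply: cyl_sum => k; have [_ cG cZk] := cyls k (ltn_ord k).
  have kK : k.+1%:R <= K%:R :> R by rewrite ler_nat.
  apply: cylB; first by apply: cyl_le cZk; lra.
  by apply: cyl_le cG; move: kK; rewrite -natr1; lra.
rewrite (QE _ _ ct).
have bS : bounded_fct (fun x => \sum_(k < K) (Z k x - G k x)).
  by have [M _ SM] := cyl_bounded ct; exists M.
have cFZ k : (k < K)%N -> cyl (Num.max (T k) k.+1%:R) (fun x => `|F k x - Z k x|).
  move=> kK; have [cF _ cZk] := cyls k kK; apply: cyl_abs; apply: cylB.
    by apply: cyl_le cF; rewrite le_max lexx.
  by apply: cyl_le cZk; rewrite le_max lexx orbT.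
have sup k (kK : (k < K)%N) := ulim_walk_supexp_le UU Uoo (cFZ k kK) (Pd k kK).
have [n0 n0P] : exists n0, forall n, (n0 <= n)%N -> forall k, (k < K)%N ->
    forall l, size l = tick n (k%:R : R) ->
    `|iter (horizon n - tick n (k%:R : R)) (wstepn sl su n) (fun l' => F k (wpath n l')) l
      - G k (wpath n l)| <= e.
  have ex1 k : exists n1, (k < K)%N -> forall n, (n1 <= n)%N ->
     forall N, (tick n (T k) <= N)%N -> forall l, size l = tick n (k%:R : R) ->
     `|iter (N - tick n (k%:R : R)) (wstepn sl su n) (fun l' => F k (wpath n l')) l
       - G k (wpath n l)| <= e.
    have [kK|] := boolP (k < K)%N; last by exists 0%N.
    by have [n1 n1P] := conv k kK e e0; exists n1.
  have [n1 n1P] := choice ex1.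
  exists (maxn (Num.truncn t).+1 (\max_(k < K) n1 k)) => n; rewrite geq_max => /andP[tn mn] k kK.
  apply: n1P => //.
    apply: leq_trans mn; exact: (leq_bigmax (F := fun k : 'I_K => n1 k) (Ordinal kK)).
  apply: tick_horizon; apply: (le_trans (cS k kK)).
  by apply: (le_trans (ltW (truncnS_gt t))); rewrite ler_nat.
pose a k n := walk_supexp sl su n (fun x => `|F k x - Z k x|).
have lim_sum J : (J <= K)%N ->
    bounded_seq (fun n => \sum_(k < J) (e + a k n)) /\
    ulim U (fun n => \sum_(k < J) (e + a k n)) <= J%:R * (e + d).
  elim: J => [|J IH] JK.
    rewrite mul0r (_ : (fun n => _) = fun=> 0); last by apply/funext => n; rewrite big_ord0.
    by split; [exists 0 => n; rewrite normr0 | rewrite (ulim_cst UU)].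
  have [b1 u1] := IH (ltnW JK); have [u2 b2] := sup J JK.
  have be : bounded_seq (fun _ : nat => e) by exists `|e|.
  have b3 : bounded_seq (fun n => e + a J n).
    by have [M aM] := b2; exists (`|e| + M) => n; apply: (le_trans (ler_normD _ _)); rewrite lerD2l; exact: aM.
  rewrite (_ : (fun n => _) = fun n => \sum_(k < J) (e + a k n) + (e + a J n)); last first.
    by apply/funext => n; rewrite big_ord_recr.
  split.
    have [M aM] := b1; have [M' aM'] := b3; exists (M + M') => n.
    by apply: (le_trans (ler_normD _ _)); rewrite lerD.
  rewrite (ulimD UU)// (ulimD UU)// (ulim_cst UU) -natr1; move: u1 u2; rewrite -/(a J).
  set x := ulim _ _; set y := ulim _ _; lra.
have [bK uK] := lim_sum K (leqnn K).
apply: (@le_trans _ _ (- ulim U (fun n => \sum_(k < K) (e + a k n)))); first by rewrite lerN2.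
rewrite -mulN1r -(ulimZ UU)//; apply: (@ulim_le _ _ UU Uoo _ _ (maxn n0 K)).
- by have [M bM] := bK; exists M => n; rewrite mulN1r normrN.
- exact: walk_exp_bounded.
move=> n; rewrite geq_max => /andP[n0n Kn]; rewrite mulN1r.
apply: alP => //; first by move=> k /cyls[].
exact: n0P.
Qed.

End DriftMeasure.

(** * The spaces of G-integrable random variables *)

Lemma integ_ae d (T : measurableType d) (R : realType) (P : probability T R) (f g : T -> R) A :
  measurable A -> P A = 0%E -> measurable_fun setT g -> (forall x, ~ A x -> f x = g x) ->
  integ P f -> integ P g.
Proof.
move=> mA PA mg fg fi; have mf := integ_measurable fi.
apply/integrableP; split; first exact/measurable_EFinP.
have /integrableP[_] := fi; congr (_ < _)%E; apply: ae_eq_integral => //.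
- by apply: measurableT_comp => //; exact/measurable_EFinP.
- by apply: measurableT_comp => //; exact/measurable_EFinP.
- exists A; split => // x /= nfg; apply: contrapT => nA; apply: nfg => _.
  by rewrite /= fg.
Qed.

Section GSpaces.
Variables (R : realType) (sl su : R).
Implicit Types (f g X Y : Omega R -> R) (P : probability (Omega R) R).

Definition at_path (F : (R -> R) -> R) : Omega R -> R := fun w => F (fun s => B s w).

(** A bound on the norm of [L_G^1], stated measure by measure so that it can be used with
    real-valued expectations. *)
Definition G_small (e : R) f : Prop := forall P, PG sl su P ->
  integ P f /\ Ex P (fun w => `|f w|) <= e.

Definition G_null (A : set (Omega R)) : Prop :=
  measurable A /\ forall P, PG sl su P -> P A = 0%E.

Lemma quasi_surelyP (Q : Omega R -> Prop) : quasi_surely sl su Q ->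
  PG sl su !=set0 /\ exists2 A, G_null A & forall w, ~ A w -> Q w.
Proof.
move=> [A [mA cA AQ]]; split.
  (* Over an empty family the capacity would be the supremum of the empty set, which is [-oo] and
     not 0. *)
  apply: contrapT => /set0P/negP/negPn/eqP e; move: cA; rewrite /capacity e image_set0 ereal_sup0.
  by [].
exists A => //; split => // P PP; apply/eqP; rewrite eq_le measure_ge0 andbT -cA.
by apply: ereal_sup_ubound; exists P.
Qed.

Lemma G_null_quasi_surely (Q : Omega R -> Prop) A : PG sl su !=set0 -> G_null A ->
  (forall w, ~ A w -> Q w) -> quasi_surely sl su Q.
Proof.
move=> [P PP] [mA A0] AQ; exists A; split => //; apply/eqP; rewrite eq_le; apply/andP; split.
  by apply: ub_ereal_sup => _ [P' PP' <-]; rewrite A0.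
by rewrite -(A0 P PP); apply: ereal_sup_ubound; exists P.
Qed.

Lemma G_nullU A A' : G_null A -> G_null A' -> G_null (A `|` A').
Proof.
move=> [mA A0] [mA' A'0]; split; first exact: measurableU.
by move=> P PP; apply: null_set_setU => //; [exact: A0|exact: A'0].
Qed.

Lemma G_null_bigcup (A : nat -> set (Omega R)) : (forall n, G_null (A n)) ->
  G_null (\bigcup_n A n).
Proof.
move=> A0; split; first by apply: bigcupT_measurable => n; have [] := A0 n.
move=> P PP; apply/eqP; rewrite eq_le measure_ge0 andbT.
have mA n : measurable (A n) by have [] := A0 n.
apply: (le_trans (measure_sigma_subadditive P mA (bigcupT_measurable _ mA) (@subset_refl _ _))).
by rewrite eseries0// => n _ _; have [_ h] := A0 n; exact: h.
Qed.

Lemma G_smallD e e' f g : G_small e f -> G_small e' g ->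
  G_small (e + e') (fun w => f w + g w).
Proof.
move=> fe ge P PP; have [fi fE] := fe P PP; have [gi gE] := ge P PP.
have fgi := integD fi gi; split => //.
apply: (@le_trans _ _ (Ex P (fun w => `|f w| + `|g w|))); last first.
  by rewrite ExD; [exact: lerD | exact: integ_abs | exact: integ_abs].
apply: Ex_le; [exact: integ_abs | by apply: integD; exact: integ_abs | ].
by move=> w; exact: ler_normD.
Qed.

Lemma G_small_dom e f g : measurable_fun setT g -> (forall w, `|g w| <= `|f w|) ->
  G_small e f -> G_small e g.
Proof.
move=> mg gf fe P PP; have [fi fE] := fe P PP.
have gi : integ P g by exact: integ_le fi.
by split => //; apply: le_trans fE; apply: Ex_le => //; exact: integ_abs.
Qed.

Lemma G_smallZ e c f : G_small e f -> G_small (`|c| * e) (fun w => c * f w).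
Proof.
move=> fe P PP; have [fi fE] := fe P PP; split; first exact: integZ.
rewrite (_ : (fun w => _) = fun w => `|c| * `|f w|); last by apply/funext => w; rewrite normrM.
by rewrite ExZ ?ler_wpM2l//; exact: integ_abs.
Qed.

Lemma G_smallN e f : G_small e f -> G_small e (fun w => - f w).
Proof.
move=> /(G_smallZ (-1)); rewrite normrN1 mul1r.
by rewrite (_ : (fun w => _) = fun w => - f w)//; apply/funext => w; rewrite mulN1r.
Qed.

Lemma G_smallB e e' f g : G_small e f -> G_small e' g ->
  G_small (e + e') (fun w => f w - g w).
Proof. by move=> fe /G_smallN; exact: G_smallD. Qed.

Lemma G_small_ae e f g A : G_null A -> measurable_fun setT g ->
  (forall w, ~ A w -> f w = g w) -> G_small e f -> G_small e g.
Proof.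
move=> [mA A0] mg fg fe P PP; have [fi fE] := fe P PP.
have mf := integ_measurable fi.
have gi : integ P g by apply: (integ_ae _ _ mg fg fi) => //; exact: A0.
split => //; apply: le_trans fE; rewrite le_eqVlt; apply/orP; left; apply/eqP.
apply: (@Ex_ae_eq _ _ _ _ _ _ A) => //; [exact: A0 | exact: integ_abs | exact: integ_abs|].
by move=> w nA; rewrite fg.
Qed.

Lemma G_small_le e e' f : e <= e' -> G_small e f -> G_small e' f.
Proof. by move=> ee' fe P /fe[fi fE]; split => //; exact: le_trans ee'. Qed.

(** If [a > d] then [a / d <= (a / d)^p]. Integrated, it gives [E a <= 2 d] as soon as
    [E a^p <= d^p], which replaces Hoelder's inequality in the passage from the norm of order [p] to
    that of order 1. *)
Lemma le_add_powR (d p a : R) : 0 < d -> 1 <= p -> 0 <= a ->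
  a <= d + d * (d^-1 `^ p) * a `^ p.
Proof.
move=> d0 p1 a0; rewrite -mulrA -powRM ?invr_ge0 ?(ltW d0)//.
have [ad|da] := leP a d.
  by apply: (le_trans ad); rewrite lerDl mulr_ge0 ?powR_ge0// ltW.
have h : 1 <= d^-1 * a by rewrite mulrC ler_pdivlMr// mul1r ltW.
have := le1r_powR h p1; rewrite -(ler_pM2l d0) mulrA mulfV ?gt_eqF// mul1r.
by move=> /le_trans; apply; rewrite lerDr ltW.
Qed.

Lemma normG_small (p : R) (f : nat -> Omega R -> R) : 1 <= p ->
  (forall k, measurable_fun setT (f k)) ->
  normG sl su p (f k) @[k --> \oo] --> 0%E ->
  forall e, 0 < e -> exists k0, forall k, (k0 <= k)%N -> G_small e (f k).
Proof.
move=> p1 mf /fine_cvgP[fin cv] e e0.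
have p0 : 0 < p by apply: lt_le_trans p1.
pose d := e / 2; have d0 : 0 < d by rewrite divr_gt0.
move/cvgrPdist_le : cv => /(_ d d0) cv.
have [k0 _ k0P] := filterI fin cv.
exists k0 => k /k0P[/= fk]; rewrite sub0r normrN => fkd P PP.
have Ed : (Ehat sl su (fun w => (`|f k w| `^ p)%:E) <= (d `^ p)%:E)%E.
  set E := Ehat _ _ _.
  have E0 : (0 <= E)%E.
    apply: (@le_trans _ _ (\int[P]_w (`|f k w| `^ p)%:E)%E).
      by apply: integral_ge0 => w _; rewrite lee_fin powR_ge0.
    by apply: ereal_sup_ubound; exists P.
  have -> : E = ((E `^ p^-1) `^ p)%E by rewrite -poweRrM mulVf ?gt_eqF// poweRe1.
  rewrite -poweR_EFin; apply: gt0_ler_poweR; rewrite ?(ltW p0)//.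
  - by rewrite in_itv /= poweR_ge0 leey.
  - by rewrite in_itv /= lee_fin (ltW d0) leey.
  - rewrite -[leLHS]/(normG sl su p (f k)) -(fineK fk) lee_fin.
    exact: le_trans (ler_norm _) fkd.
have mp : measurable_fun setT (fun w => `|f k w| `^ p).
  apply: (measurableT_comp (measurable_powR p)); exact: measurableT_comp.
have EP : (\int[P]_w (`|f k w| `^ p)%:E <= (d `^ p)%:E)%E.
  by apply: le_trans Ed; apply: ereal_sup_ubound; exists P.
have pi : integ P (fun w => `|f k w| `^ p).
  apply/integrableP; split; first exact/measurable_EFinP.
  apply: le_lt_trans (ltry (d `^ p)); apply: le_trans EP.
  rewrite le_eqVlt; apply/orP; left; apply/eqP; apply: eq_integral => w _ /=.
  by rewrite ger0_norm// powR_ge0.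
pose g w := d + d * (d^-1 `^ p) * `|f k w| `^ p.
have gi : integ P g by apply: integD; [exact: integ_cst | exact: integZ].
have g0 w : 0 <= g w by rewrite /g addr_ge0 ?mulr_ge0 ?powR_ge0// ltW.
have fg w : `|f k w| <= g w by exact: le_add_powR.
have fi : integ P (f k).
  by apply: (integ_le _ _ gi) => // w; rewrite (ger0_norm (g0 w)).
split => //; apply: (le_trans (Ex_le (integ_abs fi) gi fg)).
rewrite /g ExD; [|exact: integ_cst|exact: integZ].
rewrite Ex_cst ExZ//.
have h : Ex P (fun w => `|f k w| `^ p) <= d `^ p by rewrite -lee_fin -Ex_EFin.
have c0 : 0 <= d * (d^-1 `^ p) by rewrite mulr_ge0 ?powR_ge0// ltW.
have := ler_wpM2l c0 h; rewrite -[X in _ <= X -> _]mulrA -powRM ?invr_ge0 ?(ltW d0)//.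
by rewrite mulVf ?gt_eqF// powR1 mulr1 /d; lra.
Qed.

Definition G_approx (t : R) X : Prop := measurable_fun setT X /\
  forall e, 0 < e -> exists2 F, cyl t F & G_small e (fun w => at_path F w - X w).

Lemma at_path_measurable (t : R) F : cyl t F -> measurable_fun setT (at_path F).
Proof. exact: cyl_measurable. Qed.

Lemma LG_approx p t X : 1 <= p -> LG sl su p t X -> G_approx t X.
Proof.
move=> p1 [mX [xi [xiL cv]]]; split => // e e0.
have ex k := Lip_cyl (xiL k).
have mxi k : measurable_fun setT (xi k).
  by have [F cF ->] := ex k; exact: at_path_measurable cF.
have mf k : measurable_fun setT (fun w => xi k w - X w) by exact: measurable_funB.
have [k0 k0P] := normG_small p1 mf cv e0.
by have [F cF xiE] := ex k0; exists F => //; have := k0P k0 (leqnn _); rewrite xiE.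
Qed.

Lemma normG1_le e f : PG sl su !=set0 -> G_small e f ->
  (0 <= normG sl su 1 f <= e%:E)%E.
Proof.
move=> ne fe; rewrite /normG poweR_ge0 /= invr1.
have -> : Ehat sl su (fun w => (`|f w| `^ 1)%:E) = Ehat sl su (fun w => `|f w|%:E).
  by congr Ehat; apply/funext => w; rewrite powRr1.
have h : (Ehat sl su (fun w => `|f w|%:E) <= e%:E)%E.
  apply: ub_ereal_sup => _ [P PP <-]; have [fi fE] := fe P PP.
  by rewrite Ex_EFin ?lee_fin//; exact: integ_abs.
have h0 : (0 <= Ehat sl su (fun w => `|f w|%:E))%E.
  have [P PP] := ne; apply: (@le_trans _ _ (\int[P]_w `|f w|%:E)%E).
    by apply: integral_ge0 => w _; rewrite lee_fin.
  by apply: ereal_sup_ubound; exists P.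
by rewrite poweRe1.
Qed.

Lemma G_approx_LG1 t X : PG sl su !=set0 -> 0 <= t -> G_approx t X -> LG sl su 1 t X.
Proof.
move=> ne t0 [mX Xa]; split => //.
have ex k : exists F, cyl t F /\ G_small (k.+1%:R^-1) (fun w => at_path F w - X w).
  have k0 : 0 < (k.+1%:R : R)^-1 by rewrite invr_gt0.
  by have [F cF Fs] := Xa _ k0; exists F.
have [F FP] := choice ex; exists (fun k => at_path (F k)); split.
  by move=> k; have [cF _] := FP k; exact: cyl_Lip.
apply: (@squeeze_cvge _ _ _ _ (fun=> 0%E) _ (fun k => (k.+1%:R^-1)%:E)).
- by apply: nearW => k; have [_ Fs] := FP k; exact: normG1_le.
- exact: cvg_cst.
- by apply: cvg_EFin; [exact: nearW | exact: cvg_harmonic].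
Qed.

Lemma G_approx_integ t X P : PG sl su P -> G_approx t X -> integ P X.
Proof.
move=> PP [mX /(_ 1 ltr01)[F cF /(_ P PP)[fi _]]].
have Fi := cyl_integ P cF; have := integB Fi fi.
rewrite (_ : (fun w => _) = X)//; apply/funext => w; rewrite /at_path; ring.
Qed.

Lemma G_approx_at_path t F : cyl t F -> G_approx t (at_path F).
Proof.
move=> cF; split; first exact: at_path_measurable cF.
move=> e e0; exists F => // P PP.
have -> : (fun w => at_path F w - at_path F w) = fun=> 0.
  by apply/funext => w; rewrite subrr.
split; first exact: integ_cst.
rewrite (_ : (fun w => _) = fun=> 0) ?Ex_cst ?ltW//.
by apply/funext => w; rewrite subrr normr0.
Qed.

Lemma G_approx_lip t X L h : lipschitz_with L h -> G_approx t X ->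
  G_approx t (fun w => h (X w)).
Proof.
move=> hL [mX Xa].
have mh : measurable_fun setT h.
  by apply: continuous_measurable_fun; exact: lipschitz_with_continuous hL.
have mhX : measurable_fun setT (fun w => h (X w)) by exact: (measurableT_comp mh).
split => // e e0.
have e1 : 0 < e / (`|L| + 1) by rewrite divr_gt0// ltr_wpDl.
have [F cF Fs] := Xa _ e1.
have chF := cyl_comp hL cF.
exists (fun x => h (F x)) => //.
apply: (@G_small_le (`|L| * (e / (`|L| + 1)))).
  by rewrite mulrCA ler_piMr ?(ltW e0)// ler_pdivrMr ?ltr_wpDl// mul1r lerDl.
apply: (@G_small_dom _ (fun w => L * (at_path F w - X w))).
- by apply: measurable_funB => //; exact: at_path_measurable chF.
- move=> w; rewrite normrM; apply: (le_trans (hL _ _)).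
  by rewrite ler_wpM2r// ler_norm.
- exact: G_smallZ.
Qed.

Lemma G_approxD t X Y : G_approx t X -> G_approx t Y -> G_approx t (fun w => X w + Y w).
Proof.
move=> [mX Xa] [mY Ya]; split; first exact: measurable_funD.
move=> e e0; have e2 : 0 < e / 2 by rewrite divr_gt0.
have [F cF Fs] := Xa _ e2; have [F' cF' Fs'] := Ya _ e2.
exists (fun x => F x + F' x); first exact: cylD.
have := G_smallD Fs Fs'; rewrite (_ : e / 2 + e / 2 = e); last by field.
congr G_small; apply/funext => w; rewrite /at_path; ring.
Qed.

Lemma G_approx_scale t c X : G_approx t X -> G_approx t (fun w => c * X w).
Proof.
apply: (@G_approx_lip t X `|c| (fun a => c * a)) => x y.
by rewrite -mulrBr normrM.
Qed.

Lemma G_approxB t X Y : G_approx t X -> G_approx t Y -> G_approx t (fun w => X w - Y w).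
Proof.
move=> Xa /(G_approx_scale (-1)) /(G_approxD Xa).
by congr (G_approx t _); apply/funext => w; rewrite mulN1r.
Qed.

Lemma G_approx_abs t X : G_approx t X -> G_approx t (fun w => `|X w|).
Proof.
apply: (@G_approx_lip t X 1 (fun a => `|a|)) => x y; rewrite mul1r.
exact: ler_dist_dist.
Qed.

Lemma G_approx_max t X Y : G_approx t X -> G_approx t Y ->
  G_approx t (fun w => Num.max (X w) (Y w)).
Proof.
move=> Xa Ya; rewrite (_ : (fun w => _) = fun w => 2^-1 * (X w + Y w + `|X w - Y w|)).
  by apply: G_approx_scale; apply: G_approxD; [exact: G_approxD |
    apply: G_approx_abs; exact: G_approxB].
by apply/funext => w; rewrite maxr_absE mulrC.
Qed.

Lemma G_approx_min t X Y : G_approx t X -> G_approx t Y ->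
  G_approx t (fun w => Num.min (X w) (Y w)).
Proof.
move=> Xa Ya; rewrite (_ : (fun w => _) = fun w => 2^-1 * (X w + Y w - `|X w - Y w|)).
  by apply: G_approx_scale; apply: G_approxB; [exact: G_approxD |
    apply: G_approx_abs; exact: G_approxB].
by apply/funext => w; rewrite minr_absE mulrC.
Qed.

Lemma G_approx_le t t' X : t <= t' -> G_approx t X -> G_approx t' X.
Proof.
move=> tt' [mX Xa]; split => // e /Xa[F cF Fs]; exists F => //.
exact: cyl_le cF.
Qed.

Lemma G_approx_ae t X Y A : G_null A -> measurable_fun setT Y ->
  (forall w, ~ A w -> X w = Y w) -> G_approx t X -> G_approx t Y.
Proof.
move=> nA mY XY [mX Xa]; split => // e /Xa[F cF Fs]; exists F => //.
apply: (G_small_ae nA _ _ Fs).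
  by apply: measurable_funB => //; exact: at_path_measurable cF.
by move=> w /XY ->.
Qed.

Definition G_cexp (t : R) X Y : Prop :=
  [/\ measurable_fun setT X, measurable_fun setT Y & forall e, 0 < e ->
  exists xi eta, [/\ Lip_cond_exp sl su t xi eta, G_small e (fun w => xi w - X w) &
    G_small e (fun w => eta w - Y w)]].

Hypotheses (sl0 : 0 <= sl) (slu : sl <= su).

Lemma cond_exp_G_cexp t X Y : cond_exp sl su t X Y -> G_cexp t X Y.
Proof.
move=> [mX mY [xi [eta [ce cX cY]]]]; split => // e e0.
have me k : measurable_fun setT (xi k) /\ measurable_fun setT (eta k).
  have [T [F [G [[_ cF cG -> ->] _]]]] := Lip_cond_exp_walk sl0 slu (ce k).
  by split; [exact: at_path_measurable cF | exact: at_path_measurable cG].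
have m1 k : measurable_fun setT (fun w => xi k w - X w).
  by apply: measurable_funB => //; have [] := me k.
have m2 k : measurable_fun setT (fun w => eta k w - Y w).
  by apply: measurable_funB => //; have [] := me k.
have [k1 k1P] := normG_small (lexx 1) m1 cX e0.
have [k2 k2P] := normG_small (lexx 1) m2 cY e0.
exists (xi (maxn k1 k2)), (eta (maxn k1 k2)); split => //.
  by apply: k1P; exact: leq_maxl.
by apply: k2P; exact: leq_maxr.
Qed.

Lemma G_cexp_approx t X Y : G_cexp t X Y -> G_approx t Y.
Proof.
move=> [_ mY ap]; split => // e /ap[xi [eta [ce _ es]]].
have [T [F [G [[_ cF cG _ etaE] _]]]] := Lip_cond_exp_walk sl0 slu ce.
by exists G => //; move: es; rewrite etaE.
Qed.

Lemma G_cexp_ae t X X' Y A : G_null A -> measurable_fun setT X' ->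
  (forall w, ~ A w -> X w = X' w) -> G_cexp t X Y -> G_cexp t X' Y.
Proof.
move=> nA mX' XX' [mX mY ap]; split => // e /ap[xi [eta [ce xs es]]].
exists xi, eta; split => //; apply: (G_small_ae nA _ _ xs).
  have [T [F [G [[_ cF _ -> _] _]]]] := Lip_cond_exp_walk sl0 slu ce.
  by apply: measurable_funB => //; exact: at_path_measurable cF.
by move=> w /XX' ->.
Qed.

Lemma at_path_stop t F w : cyl t F -> at_path F (stop t w) = at_path F w.
Proof.
move=> cF; apply: (cyl_eq cF) => s /andP[_ st]; rewrite B_stop.
by congr (B _ w); apply/min_idPl.
Qed.

(** The version is the upper limit of fast cylinder approximations, each of which depends on the
    stopped path only; so does the limit, at every path. Errors of order [lrate k ^+ 2] give, by
    Markov, weight at most [lrate k] to an error above [lrate k], and Borel-Cantelli yields one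
    exceptional set for all measures of [PG]. *)
Lemma G_approx_adapted t X : PG sl su !=set0 -> G_approx t X ->
  exists D, [/\ measurable_fun setT D, forall w, D (stop t w) = D w &
    exists2 A, G_null A & forall w, ~ A w -> D w = X w].
Proof.
move=> ne [mX Xa].
have ex k : exists F, cyl t F /\ G_small ((9 / 10) ^+ k * (9 / 10) ^+ k) (fun w => at_path F w - X w).
  have k0 : 0 < (9 / 10 : R) ^+ k * (9 / 10) ^+ k by rewrite mulr_gt0 ?(lrate_gt0 R).
  by have [F cF Fs] := Xa _ k0; exists F.
have [F FP] := choice ex.
have mF k : measurable_fun setT (at_path (F k)) by have [cF _] := FP k; exact: at_path_measurable cF.
pose D w := fine (limn_esup (fun k => (at_path (F k) w)%:E)).
pose bad k := [set w : Omega R | lrate R k < `|at_path (F k) w - X w|].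
have mdiff k : measurable_fun setT (fun w => `|at_path (F k) w - X w|).
  by apply: measurableT_comp => //; exact: measurable_funB.
have mbad k : measurable (bad k).
  rewrite (_ : bad k = setT `&` (fun w => `|at_path (F k) w - X w|) @^-1` `]lrate R k, +oo[%classic).
    by apply: mdiff => //; exact: measurable_itv.
  by apply/seteqP; split => w /=; rewrite in_itv /= andbT // => -[].
exists D; split.
- apply: (measurableT_comp (fine_measurable measurableT)).
  by apply: measurable_fun_limn_esup => k; exact/measurable_EFinP.
- move=> w; rewrite /D; congr (fine (limn_esup _)); apply/funext => k.
  by have [cF _] := FP k; rewrite (at_path_stop _ cF).
exists (lim_sup_set bad).
  split.
    by apply: bigcapT_measurable => n; apply: bigcup_measurable => k _.
  move=> P PP; apply: lim_sup_set_cvg0 => //.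
  apply: (@nneseries_geometric _ 1) => // k.
  have := Ex_indic P (mbad k) => eb; rewrite mul1r.
  apply: (@le_trans _ _ (Ex P \1_(bad k))%:E); first by rewrite eb.
  rewrite lee_fin.
  have [_ /(_ P PP)[di dE]] := FP k.
  have l0 := lrate_gt0 R k.
  rewrite -(ler_pM2l l0); apply: le_trans dE; rewrite -ExZ; last exact: integ_indic.
  apply: Ex_le; [by apply: integZ; exact: integ_indic | exact: integ_abs | ].
  move=> w; rewrite indicE; have [h|_] := boolP (w \in bad k); last by rewrite mulr0.
  by rewrite mulr1; rewrite inE in h; exact: ltW.
move=> w nb; have [k0 nk] : exists k0, ~ (\bigcup_(j in [set j | (k0 <= j)%N]) bad j) w.
  apply: contrapT => h0; apply: nb => n _; apply: contrapT => h1; apply: h0.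
  by exists n.
have cv : (at_path (F k) w)%:E @[k --> \oo] --> (X w)%:E.
  apply: cvg_EFin; first exact: nearW.
  apply/cvgrPdist_le => e e0; have [n0 n0P] := lrate_small e0.
  exists (maxn n0 k0) => // k /=; rewrite geq_max => /andP[nk0 kk0].
  apply: le_trans (n0P k nk0); rewrite distrC leNgt; apply/negP => h; apply: nk.
  by exists k.
by rewrite /D; have [_ ->] := cvg_limn_einf_sup cv.
Qed.

(** All paths stopped at time 0 are the zero path, so the version depending on the stopped path is
    constant. *)
Lemma G_approx0_cst X : PG sl su !=set0 -> G_approx 0 X ->
  exists c, exists2 A, G_null A & forall w, ~ A w -> X w = c.
Proof.
move=> ne /(G_approx_adapted ne)[D [_ Ds [A nA AD]]].
exists (D point), A => // w nAw; rewrite -AD// -Ds -[RHS]Ds; congr D.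
apply: path_ext => s; rewrite !B_stop.
have m0 : Num.min s 0 <= 0 by rewrite ge_min lexx orbT.
have [_ /(_ _ m0) e1] : @C0_paths R (fun s : R => B s w) := set_valP w.
by rewrite e1.
Qed.

End GSpaces.

(** * Stopping *)

Lemma clamp01_lipschitz (R : realType) : lipschitz_with 1 (@clamp01 R).
Proof.
move=> x y; rewrite mul1r.
have cl (z : R) : [\/ z <= 0 /\ clamp01 z = 0, 1 <= z /\ clamp01 z = 1 |
    0 <= z <= 1 /\ clamp01 z = z].
  have [z0|z0] := leP z 0; first by apply: Or31; rewrite clamp01_le0.
  have [z1|z1] := leP 1 z; first by apply: Or32; rewrite clamp01_ge1.
  have z01 : 0 <= z <= 1 by rewrite !ltW.
  by apply: Or33; rewrite clamp01_id.
have [yx|/ltW xy] := leP y x.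
  rewrite [leRHS]ger0_norm ?subr_ge0// ler_norml.
  by case: (cl x) => -[hx ->]; case: (cl y) => -[hy ->]; apply/andP; split; lra.
rewrite [leRHS]distrC [leRHS]ger0_norm ?subr_ge0// ler_norml.
by case: (cl x) => -[hx ->]; case: (cl y) => -[hy ->]; apply/andP; split; lra.
Qed.

Lemma clamp01_range (R : realType) (z : R) : 0 <= clamp01 z <= 1.
Proof. by rewrite /clamp01 le_max lexx /= ge_max ler01 ge_min lexx orbT. Qed.

Lemma adapted_measurable (R : realType) (t : R) (X : Omega R -> R) :
  adapted t X -> measurable_fun setT X.
Proof.
move=> aX _ C mC; rewrite setTI; have [D mD <-] := aX C mC.
by apply: measurable_stop.
Qed.

Lemma adapted_indic_measurable (R : realType) (t : R) (A : set (Omega R)) :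
  adapted t (\1_A : Omega R -> R) -> measurable A.
Proof.
move=> /adapted_measurable m.
have := m measurableT [set 1 : R] (measurable_set1 _); rewrite setTI.
congr measurable; apply/seteqP; split => w /=; rewrite indicE.
  by have [|_ /eqP] := boolP (w \in A); [rewrite inE | rewrite eq_sym oner_eq0].
by move=> Aw; rewrite mem_set.
Qed.

Section TestingConditionalExpectations.
Variables (R : realType) (sl su : R).
Hypotheses (sl0 : 0 <= sl) (slu : sl <= su).
Implicit Types (X Y Z : Omega R -> R).
Variables (P : probability (Omega R) R) (PP : PG sl su P).

Lemma G_cexp_integ t X Y : G_cexp sl su t X Y -> integ P X /\ integ P Y.
Proof.
move=> XY; split; last exact: G_approx_integ PP (G_cexp_approx sl0 slu XY).
have [mX mY /(_ 1 ltr01)[xi [eta [ce /(_ P PP)[xs _] _]]]] := XY.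
have [T [F [G [[_ cF _ xiE _] _]]]] := Lip_cond_exp_walk sl0 slu ce.
have xii : integ P xi by rewrite xiE; exact: cyl_integ cF.
have := integB xii xs; congr integ; apply/funext => w; ring.
Qed.

(** Approximation from the cylinder case. Clamping keeps the approximation of [Z] nonnegative; the
    bound [M] of [xi - eta] is known before [Z] is approximated, so the error [M * |H - Z|] can be
    made small. *)
Lemma Ex_G_cexp_le0 t X Y Z : G_cexp sl su t X Y -> G_approx sl su t Z ->
  (forall w, 0 <= Z w <= 1) -> Ex P (fun w => Z w * (X w - Y w)) <= 0.
Proof.
move=> XY [mZ Za] Z01; have [Xi Yi] := G_cexp_integ XY.
apply/ler_addgt0Pr => e e0; rewrite add0r.
have e4 : 0 < e / 4 by rewrite divr_gt0.
have [mX mY /(_ _ e4)[xi [eta [ce xs es]]]] := XY.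
have [T [F [G [[/andP[_ tT] cF cG xiE etaE] _]]]] := Lip_cond_exp_walk sl0 slu ce.
have cFG : cyl T (fun x => F x - G x) by apply: cylB => //; exact: cyl_le cG.
have [M M0 FGM] := cyl_bounded cFG.
have e2 : 0 < e / 2 / (M + 1) by rewrite !divr_gt0// ltr_wpDl.
have [H cH Hs] := Za _ e2.
have cH' := cyl_comp (@clamp01_lipschitz R) cH.
have le0 := Ex_tested_cond_exp sl0 slu PP ce cH'
  (fun x => proj1 (andP (clamp01_range (H x)))).
have [xsi xsE] := xs P PP; have [esi esE] := es P PP; have [Hsi HsE] := Hs P PP.
have Zi : integ P (fun w => Z w * (X w - Y w)).
  apply: (@integM_bounded _ _ _ _ _ _ 1) => //; last exact: integB.
  by move=> w; rewrite ger0_norm; have /andP[] := Z01 w.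
have fi : integ P (fun w => clamp01 (at_path H w) * (xi w - eta w)).
  rewrite xiE etaE; apply: (@cyl_integ _ P T (fun x => clamp01 (H x) * (F x - G x))).
  by apply: cylM => //; exact: cyl_le cH'.
pose bound w := clamp01 (at_path H w) * (xi w - eta w) + (M * `|at_path H w - Z w| +
  (`|xi w - X w| + `|eta w - Y w|)).
have i1 := integ_abs Hsi; have i2 := integ_abs xsi; have i3 := integ_abs esi.
have i23 := integD i2 i3; have i1M := integZ M i1; have i123 := integD i1M i23.
have bi : integ P bound by exact: integD.
apply: (@le_trans _ _ (Ex P bound)).
  apply: Ex_le => // w; rewrite /bound.
  have h1 : `|clamp01 (at_path H w) - Z w| <= `|at_path H w - Z w|.
    by have := @clamp01_lipschitz R (at_path H w) (Z w); rewrite mul1r [clamp01 (Z w)]clamp01_id.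
  have h2 : `|xi w - eta w| <= M by rewrite xiE etaE; exact: FGM.
  have h3 : (Z w - clamp01 (at_path H w)) * (xi w - eta w) <= M * `|at_path H w - Z w|.
    apply: (le_trans (ler_norm _)); rewrite normrM mulrC [`|Z w - _|]distrC.
    exact: ler_pM.
  have h4 : Z w * ((X w - xi w) - (Y w - eta w)) <= `|xi w - X w| + `|eta w - Y w|.
    apply: (le_trans (ler_norm _)); rewrite normrM.
    have /andP[z0 z1] := Z01 w; rewrite (ger0_norm z0).
    apply: (@le_trans _ _ (`|X w - xi w - (Y w - eta w)|)); first by rewrite ler_piMl.
    by apply: (le_trans (ler_normB _ _)); rewrite distrC [X in _ + X]distrC.
  have -> : Z w * (X w - Y w) = clamp01 (at_path H w) * (xi w - eta w) +
     ((Z w - clamp01 (at_path H w)) * (xi w - eta w) +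
      Z w * ((X w - xi w) - (Y w - eta w))) by ring.
  by rewrite lerD2l lerD.
rewrite /bound (ExD fi i123) (ExD i1M i23) (ExD i2 i3) (ExZ M i1).
have h : M * Ex P (fun w => `|at_path H w - Z w|) <= e / 2.
  apply: (@le_trans _ _ ((M + 1) * (e / 2 / (M + 1)))).
    by apply: ler_pM => //; [apply: Ex_ge0 | rewrite lerDl].
  by rewrite mulrC divfK ?gt_eqF// ltr_wpDl.
have := lerD xsE esE; move: le0; rewrite -/(at_path H).
set a := Ex P _; set b := Ex P _; lra.
Qed.

(** The clamped elements decreasing to the indicator and their complements to 1 are both admissible
    test functions, so dominated convergence yields both inequalities. Upper bounds for the value
    use the complement, the construction of a good stopping time uses [A] itself. *)
Lemma Ex_indic_cexp_le0 t X Y A : G_cexp sl su t X Y -> LG1star sl su t (\1_A) ->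
  [/\ measurable A, Ex P (fun w => \1_A w * (X w - Y w)) <= 0 &
   Ex P (fun w => (1 - \1_A w) * (X w - Y w)) <= 0].
Proof.
move=> XY [aA _ [Xk [XkL /quasi_surelyP[_ [N [mN N0] NP]]]]].
have mA := adapted_indic_measurable aA.
have [Xi Yi] := G_cexp_integ XY; have XYi := integB Xi Yi.
have Za k : G_approx sl su t (fun w => clamp01 (Xk k w)).
  exact: (G_approx_lip (@clamp01_lipschitz R) (LG_approx (lexx 1) (XkL k))).
have Z'a k : G_approx sl su t (fun w => 1 - clamp01 (Xk k w)).
  apply: (@G_approx_lip _ _ _ t _ 1 (fun a => 1 - a) _ (Za k)) => x y.
  by rewrite mul1r (_ : 1 - x - (1 - y) = y - x); [rewrite distrC | ring].
have mind : measurable_fun setT (\1_A : Omega R -> R) by exact: measurable_indic.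
have c01 a : clamp01 a <= 1 :> R by have /andP[] := clamp01_range a.
have c00 (a : R) : 0 <= clamp01 a by have /andP[] := clamp01_range a.
have cv w : ~ N w -> clamp01 (Xk k w) @[k --> \oo] --> (\1_A w : R).
  move=> /NP[_ c]; have -> : (\1_A w : R) = clamp01 (\1_A w).
    by rewrite clamp01_id// indicE; case: (w \in A); rewrite ?ler01 ?lexx.
  exact: (cvg_comp _ _ c (@clamp01_continuous R _)).
split => //.
  have [_ _ c] : [/\ forall k, integ P (fun w => clamp01 (Xk k w) * (X w - Y w)),
      integ P (fun w => \1_A w * (X w - Y w)) &
      Ex P (fun w => clamp01 (Xk k w) * (X w - Y w)) @[k --> \oo] -->
      Ex P (fun w => \1_A w * (X w - Y w))].
    apply: (@Ex_dominated_cvg _ _ _ P (fun k w => clamp01 (Xk k w) * (X w - Y w))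
       (fun w => \1_A w * (X w - Y w)) (fun w => `|X w - Y w|) N) => //.
    - by move=> k; apply: measurable_funM; [have [] := Za k | exact: integ_measurable XYi].
    - by apply: measurable_funM => //; exact: integ_measurable XYi.
    - exact: integ_abs.
    - exact: N0.
    - by move=> w /cv c; apply: cvgM => //; exact: cvg_cst.
    - by move=> k w _; rewrite normrM ger0_norm// ler_piMl.
  rewrite -(cvg_lim _ c)//; apply: limr_le; first by apply/cvg_ex; eexists; exact: c.
  by apply: nearW => k; apply: (Ex_G_cexp_le0 XY (Za k)) => w; exact: clamp01_range.
have [_ _ c] : [/\ forall k, integ P (fun w => (1 - clamp01 (Xk k w)) * (X w - Y w)),
    integ P (fun w => (1 - \1_A w) * (X w - Y w)) &
    Ex P (fun w => (1 - clamp01 (Xk k w)) * (X w - Y w)) @[k --> \oo] -->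
    Ex P (fun w => (1 - \1_A w) * (X w - Y w))].
  apply: (@Ex_dominated_cvg _ _ _ P (fun k w => (1 - clamp01 (Xk k w)) * (X w - Y w))
     (fun w => (1 - \1_A w) * (X w - Y w)) (fun w => `|X w - Y w|) N) => //.
  - by move=> k; apply: measurable_funM; [have [] := Z'a k | exact: integ_measurable XYi].
  - by apply: measurable_funM; [exact: measurable_funB | exact: integ_measurable XYi].
  - exact: integ_abs.
  - exact: N0.
  - move=> w /cv c; apply: cvgM; last exact: cvg_cst.
    by apply: cvgB => //; exact: cvg_cst.
  - move=> k w _; rewrite normrM ger0_norm ?subr_ge0// ler_piMl// lerBlDr lerDl.
    exact: c00.
rewrite -(cvg_lim _ c)//; apply: limr_le; first by apply/cvg_ex; eexists; exact: c.
apply: nearW => k; apply: (Ex_G_cexp_le0 XY (Z'a k)) => w.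
by rewrite subr_ge0 c01 lerBlDr lerDl c00.
Qed.

End TestingConditionalExpectations.

Lemma telescope_min (R : realType) (f : nat -> R) (m N : nat) :
  f (minn m N) = f 0%N + \sum_(k < N) (1 - (m <= k)%N%:R) * (f k.+1 - f k).
Proof.
elim: N => [|N IH]; first by rewrite minn0 big_ord0 addr0.
rewrite big_ord_recr /= addrA -IH; have [mN|Nm] := leqP m N.
  by rewrite subrr mul0r addr0 (minn_idPl (leqW mN)).
by rewrite (minn_idPr Nm) subr0 mul1r addrC subrK.
Qed.

Section StoppedProcess.
Variables (R : realType) (P : probability (Omega R) R) (tau : Omega R -> nat) (N : nat).
Hypothesis mtau : forall k, (k < N)%N -> measurable [set w | (tau w <= k)%N].

Let stopped_eq (f : nat -> Omega R -> R) : (fun w => f (minn (tau w) N) w) =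
  fun w => f 0%N w + \sum_(k < N) (1 - \1_[set w | (tau w <= k)%N] w) * (f k.+1 w - f k w).
Proof.
apply/funext => w; rewrite (telescope_min (f ^~ w)); congr (_ + _).
apply: eq_bigr => k _; congr ((1 - _%:R) * _); congr nat_of_bool.
by apply/idP/idP; rewrite inE.
Qed.

Let term_integ (f : nat -> Omega R -> R) k : (k < N)%N ->
  (forall n, (n <= N)%N -> integ P (f n)) ->
  integ P (fun w => (1 - \1_[set w | (tau w <= k)%N] w) * (f k.+1 w - f k w)).
Proof.
move=> kN fi; apply: (@integM_bounded _ _ _ _ _ _ 1).
- by apply: measurable_funB => //; apply: measurable_indic; exact: mtau.
- move=> w; rewrite indicE; case: (w \in _); rewrite ?subrr ?subr0 ?normr0 ?normr1//.
- by apply: integB; apply: fi => //; exact: ltnW.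
Qed.

Lemma stopped_integ (f : nat -> Omega R -> R) : (forall n, (n <= N)%N -> integ P (f n)) ->
  integ P (fun w => f (minn (tau w) N) w).
Proof.
move=> fi; rewrite stopped_eq; apply: integD; first exact: fi.
apply: integ_sum => k; exact: term_integ.
Qed.

Lemma Ex_stopped (f : nat -> Omega R -> R) : (forall n, (n <= N)%N -> integ P (f n)) ->
  Ex P (fun w => f (minn (tau w) N) w) = Ex P (f 0%N) +
  \sum_(k < N) Ex P (fun w => (1 - \1_[set w | (tau w <= k)%N] w) * (f k.+1 w - f k w)).
Proof.
move=> fi; rewrite stopped_eq ExD; last first.
- by apply: integ_sum => k; exact: term_integ.
- exact: fi.
by rewrite Ex_sum// => k; exact: term_integ.
Qed.

End StoppedProcess.

Section StoppingTimes.
Variables (R : realType) (sl su : R).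
Hypothesis ne : PG sl su !=set0.

Lemma stop_stop (s t : R) (w : Omega R) : s <= t -> stop s (stop t w) = stop s w.
Proof.
move=> st; apply: path_ext => u; rewrite !B_stop; congr (B _ w); apply/min_idPl.
by rewrite ge_min st orbT.
Qed.

Lemma G_approx_cst (t c : R) : G_approx sl su t (fun=> c).
Proof. exact: (G_approx_at_path sl su (cyl_cst t c)). Qed.

(** The functions [max 0 (1 - j * max M 0)] decrease to the indicator everywhere. Invariance of [M]
    under [stop t] at every path gives measurability with respect to the stopped path itself, not
    merely up to null sets. *)
Lemma LG1star_le0 t M : 0 <= t -> G_approx sl su t M ->
  (forall w, M (stop t w) = M w) -> LG1star sl su t (\1_[set w | M w <= 0]).
Proof.
move=> t0 Ma Ms; set A := [set w | M w <= 0].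
have mM : measurable_fun setT M by have [] := Ma.
have mA : measurable A.
  rewrite (_ : A = setT `&` M @^-1` `]-oo, 0]%classic); first by apply: mM.
  by apply/seteqP; split => w /=; rewrite in_itv //= => -[].
split.
- move=> C mC; exists ((\1_A : Omega R -> R) @^-1` C).
    rewrite -[X in measurable X]setTI.
    by apply: (@measurable_indic _ _ _ setT A mA).
  have IE w : \1_A (stop t w) = \1_A w :> R.
    rewrite !indicE; congr (_%:R); congr nat_of_bool.
    by apply/idP/idP; rewrite !inE /A /= Ms.
  by rewrite setTI; apply/seteqP; split => w /=; rewrite IE.
- apply: (@le_lt_trans _ _ 1%E); last by rewrite ltry.
  apply: ub_ereal_sup => _ [P PP <-].
  have ia : integ P (\1_A) by exact: integ_indic.
  rewrite Ex_EFin; last exact: integ_abs.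
  rewrite lee_fin -(Ex_cst P 1); apply: Ex_le; [exact: integ_abs | exact: integ_cst |].
  by move=> w; rewrite indicE; case: (w \in A); rewrite ?normr1 ?normr0.
pose Xk (j : nat) w := Num.max 0 (1 - j%:R * Num.max (M w) 0).
exists Xk; split.
  move=> j; apply: G_approx_LG1 => //; apply: G_approx_max; first exact: G_approx_cst.
  apply: G_approxB; first exact: G_approx_cst.
  by apply: G_approx_scale; apply: G_approx_max => //; exact: G_approx_cst.
apply: (@G_null_quasi_surely _ _ _ _ set0) => //.
move=> w _; split.
  move=> i j ij; rewrite /Xk; apply: le_max2 => //; rewrite lerD2l lerN2 ler_wpM2r ?ler_nat//.
  by rewrite le_max lexx orbT.
have [Mw|Mw] := leP (M w) 0.
  rewrite (_ : (fun j => _) = fun=> \1_A w); first exact: cvg_cst.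
  apply/funext => j; rewrite /Xk (max_r Mw) mulr0 subr0 max_r// indicE mem_set//.
apply: cvg_near_cst; exists (Num.truncn (M w)^-1).+1 => // j /= jM.
rewrite /Xk indicE memNset; last by rewrite /A /= leNgt Mw.
rewrite (max_l (ltW Mw)) max_l// subr_le0 -ler_pdivrMr// mul1r.
by apply: (le_trans (ltW (truncnS_gt _))); rewrite ler_nat.
Qed.

Variables (N : nat) (D : nat -> Omega R -> R).
Hypothesis Da : forall n, (n < N)%N -> G_approx sl su n%:R (D n).
Hypothesis Ds : forall n, (n < N)%N -> forall w, D n (stop n%:R w) = D n w.

(** When no index qualifies, [find] returns the length [N]: stopping is forced at the horizon. *)
Definition first_nonpos (w : Omega R) : nat := find (fun n => D n w <= 0) (iota 0 N).

Lemma first_nonpos_le w : (first_nonpos w <= N)%N.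
Proof. by have := find_size (fun n => D n w <= 0) (iota 0 N); rewrite size_iota. Qed.

Lemma first_nonposP w : (first_nonpos w < N)%N -> D (first_nonpos w) w <= 0.
Proof.
move=> lt; have h : has (fun n => D n w <= 0) (iota 0 N) by rewrite has_find size_iota.
by have := nth_find 0%N h; rewrite nth_iota.
Qed.

Lemma lt_first_nonpos w n : (n < first_nonpos w)%N -> 0 < D n w.
Proof.
move=> lt; have := before_find 0%N lt; rewrite nth_iota//; last first.
  exact: leq_trans lt (first_nonpos_le w).
by rewrite add0n ltNge => ->.
Qed.

(** Expresses [first_nonpos <= k] as a single inequality [M <= 0], the shape that [LG1star_le0]
    handles. *)
Fixpoint running_min (k : nat) (w : Omega R) : R :=
  if k is k'.+1 then Num.min (running_min k' w) (D k w) else D 0%N w.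

Lemma running_min_le0 k w : (k < N)%N ->
  (running_min k w <= 0) = (first_nonpos w <= k)%N.
Proof.
move=> kN; apply/idP/idP => [h|h].
  have [n nk Dn] : exists2 n, (n <= k)%N & D n w <= 0.
    elim: k h {kN} => [|k IH] /= h; first by exists 0%N.
    move: h; rewrite ge_min => /orP[/IH[n nk Dn]|Dk]; last by exists k.+1.
    by exists n => //; exact: leqW.
  rewrite leqNgt; apply/negP => lt.
  by have := lt_first_nonpos (leq_ltn_trans nk lt); rewrite ltNge Dn.
have hD := first_nonposP (leq_ltn_trans h kN).
move: (first_nonpos w) h hD => m; elim: k {kN} => [|k IH] /=.
  by rewrite leqn0 => /eqP ->.
rewrite leq_eqVlt => /predU1P[->|mk] Dm; first by rewrite ge_min Dm orbT.
by rewrite ge_min IH.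
Qed.

Lemma running_min_approx k (t : R) : (k < N)%N -> k%:R <= t ->
  G_approx sl su t (running_min k) /\ forall w, running_min k (stop t w) = running_min k w.
Proof.
have one n : (n < N)%N -> n%:R <= t -> G_approx sl su t (D n) /\ forall w, D n (stop t w) = D n w.
  move=> nN nt; split; first exact: G_approx_le (Da nN).
  by move=> w; rewrite -Ds// stop_stop// Ds.
elim: k => [|k IH] kN kt /=; first exact: one.
have kt' : k%:R <= t by apply: le_trans kt; rewrite ler_nat.
have [a1 s1] := IH (ltnW kN) kt'; have [a2 s2] := one _ kN kt.
by split; [exact: G_approx_min | move=> w; rewrite s1 s2].
Qed.

Lemma first_nonpos_T0 : T0 sl su first_nonpos.
Proof.
split; last first.
  apply: cvg_near_cst; exists N => // M /= NM.
  rewrite (_ : [set w | _] = set0); last first.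
    apply/seteqP; split => // w /= lt.
    by have := leq_trans lt (first_nonpos_le w); rewrite ltnNge NM.
  rewrite /capacity; have [P PP] := ne; apply/eqP; rewrite eq_le; apply/andP; split.
    by apply: ub_ereal_sup => _ [P' PP' <-]; rewrite measure0.
  by rewrite -(measure0 P); apply: ereal_sup_ubound; exists P.
split => // t t0; set k := Num.truncn t.
have kE w : ((first_nonpos w)%:R <= t) = (first_nonpos w <= k)%N.
  have /andP[k1 k2] := truncn_itv t0; apply/idP/idP => h.
    by rewrite -ltnS -(ltr_nat R); exact: le_lt_trans k2.
  by apply: le_trans k1; rewrite ler_nat.
have [kN|Nk] := ltnP k N.
  have kt : k%:R <= t by have /andP[] := truncn_itv t0.
  have [a s] := running_min_approx kN kt.
  rewrite (_ : [set w | _] = [set w | running_min k w <= 0]); first exact: LG1star_le0.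
  by apply/seteqP; split => w /=; rewrite kE running_min_le0.
rewrite (_ : [set w | _] = [set w | (0 : R) <= 0]).
  by apply: (@LG1star_le0 _ (fun=> 0)) => //; exact: G_approx_cst.
apply/seteqP; split => w //= _; rewrite kE.
exact: leq_trans (first_nonpos_le w) Nk.
Qed.

End StoppingTimes.

(** * Optimal stopping with a finite horizon *)

Section Snell.
Variables (R : realType) (sl su : R).
Hypotheses (sl0 : 0 <= sl) (slu : sl <= su).
Implicit Types (P : probability (Omega R) R).
Variables (X v Y : nat -> Omega R -> R) (N : nat).
Hypothesis va : forall n, (n <= N)%N -> G_approx sl su n%:R (v n).
Hypothesis Xa : forall n, (n <= N)%N -> G_approx sl su n%:R (X n).
Hypothesis vY : forall n, (n < N)%N -> G_cexp sl su n%:R (v n.+1) (Y n).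
Hypothesis vmax : forall n, (n < N)%N -> forall w, v n w = Num.max (X n w) (Y n w).
Hypothesis vN : v N = X N.

Let v_integ P : PG sl su P -> forall n, (n <= N)%N -> integ P (v n).
Proof. by move=> PP n nN; exact: G_approx_integ PP (va nN). Qed.

Let X_integ P : PG sl su P -> forall n, (n <= N)%N -> integ P (X n).
Proof. by move=> PP n nN; exact: G_approx_integ PP (Xa nN). Qed.

Let events (tau : Omega R -> nat) : G_stopping_time sl su (fun w => (tau w)%:R) ->
  forall k, LG1star sl su k%:R (\1_[set w | (tau w <= k)%N]).
Proof.
move=> [_ st] k; have := st k%:R (ler0n _ _).
by congr (LG1star _ _ _ (\1_ _)); apply/seteqP; split => w /=; rewrite ler_nat.
Qed.

Lemma Ex_stopped_le P tau : PG sl su P -> G_stopping_time sl su (fun w => (tau w)%:R) ->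
  Ex P (fun w => X (minn (tau w) N) w) <= Ex P (v 0%N).
Proof.
move=> PP st; have ev := events st; have vi := v_integ PP.
have mt k : (k < N)%N -> measurable [set w | (tau w <= k)%N].
  by move=> _; exact: adapted_indic_measurable (let: And3 a _ _ := ev k in a).
apply: (@le_trans _ _ (Ex P (fun w => v (minn (tau w) N) w))).
  apply: Ex_le; [exact: (stopped_integ mt (X_integ PP)) | exact: (stopped_integ mt vi) |].
  move=> w; have [->|tN] := eqVneq (minn (tau w) N) N; first by rewrite vN.
  by rewrite vmax ?le_max ?lexx// ltn_neqAle tN geq_minr.
rewrite (Ex_stopped mt vi) gerDl; apply: sumr_le0 => k _; have kN := ltn_ord k.
have [mA _ le0] := Ex_indic_cexp_le0 sl0 slu PP (vY kN) (ev k).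
apply: le_trans le0; have [v1i Yi] := G_cexp_integ sl0 slu PP (vY kN).
have mI : measurable_fun setT (fun w => 1 - \1_[set w | (tau w <= k)%N] w : R).
  by apply: measurable_funB => //; exact: measurable_indic.
have I1 w : `|1 - \1_[set w | (tau w <= k)%N] w : R| <= 1.
  by rewrite indicE; case: (w \in _); rewrite ?subrr ?subr0 ?normr0 ?normr1.
have I0 w : 0 <= 1 - \1_[set w | (tau w <= k)%N] w :> R.
  by rewrite indicE; case: (w \in _); rewrite ?subrr ?subr0.
apply: Ex_le.
- by apply: (integM_bounded mI I1); apply: integB => //; apply: vi; exact: ltnW.
- by apply: (integM_bounded mI I1); exact: integB.
- by move=> w; rewrite ler_wpM2l// lerD2l lerN2 vmax// le_max lexx orbT.
Qed.

Lemma exists_near_martingale (e : R) : 0 < e -> exists2 Q, PG sl su Q &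
  - e <= \sum_(k < N) Ex Q (fun w => v k.+1 w - Y k w).
Proof.
(* Each date costs [d + 2 d] in the choice of the measure and [2 d] in the passage from [Z], [G] to
   [v], [Y]: at most [5 N d] in all. *)
move=> e0; pose d := e / (5 * N.+1%:R).
have d0 : 0 < d by rewrite divr_gt0// mulr_gt0.
pose data := (R * ((R -> R) -> R) * ((R -> R) -> R) * ((R -> R) -> R))%type.
have ex k : exists q : data, (k < N)%N ->
    let: (T, F, G, Z) := q in
    [/\ cyl T F, cyl k%:R G, cyl k.+1%:R Z,
     forall eps, 0 < eps -> exists n0, forall n, (n0 <= n)%N ->
     forall M, (tick n T <= M)%N -> forall l, size l = tick n (k%:R : R) ->
     `|iter (M - tick n (k%:R : R)) (wstepn sl su n) (fun l' => F (wpath n l')) l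
       - G (wpath n l)| <= eps &
     [/\ G_small sl su d (fun w => at_path F w - v k.+1 w),
         G_small sl su d (fun w => at_path G w - Y k w) &
         G_small sl su d (fun w => at_path Z w - v k.+1 w)]].
  have [kN|] := boolP (k < N)%N; last by exists (0, (fun=> 0), (fun=> 0), (fun=> 0)).
  have [_ _ /(_ _ d0)[xi [eta [ce xs es]]]] := vY kN.
  have [T [F [G [[_ cF cG xiE etaE] conv]]]] := Lip_cond_exp_walk sl0 slu ce.
  have [_ /(_ _ d0)[Z cZ Zs]] := va kN.
  by exists (T, F, G, Z) => _; split => //; split => //; [move: xs; rewrite xiE | move: es; rewrite etaE].
have [q qP] := choice ex.
pose T k := (q k).1.1.1; pose F k := (q k).1.1.2; pose G k := (q k).1.2; pose Z k := (q k).2.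
have qE k : (k < N)%N -> [/\ cyl (T k) (F k), cyl k%:R (G k), cyl k.+1%:R (Z k),
     forall eps, 0 < eps -> exists n0, forall n, (n0 <= n)%N ->
     forall M, (tick n (T k) <= M)%N -> forall l, size l = tick n (k%:R : R) ->
     `|iter (M - tick n (k%:R : R)) (wstepn sl su n) (fun l' => F k (wpath n l')) l
       - G k (wpath n l)| <= eps &
     [/\ G_small sl su d (fun w => at_path (F k) w - v k.+1 w),
         G_small sl su d (fun w => at_path (G k) w - Y k w) &
         G_small sl su d (fun w => at_path (Z k) w - v k.+1 w)]].
  by move=> kN; have := qP k kN; rewrite /T /F /G /Z; case: (q k) => [[[? ?] ?] ?].
have [Q PQ QE] : exists2 Q, PG sl su Q & - (N%:R * (d + 2 * d)) <=
    Ex Q (fun w => \sum_(k < N) (Z k (fun s => B s w) - G k (fun s => B s w))).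
  apply: (@exists_drift_measure _ _ _ sl0 slu N T F G Z) => //.
  - by move=> k kN; have [cF cG cZ _ _] := qE k kN.
  - by move=> k kN; have [_ _ _ conv _] := qE k kN.
  move=> k kN P PP; have [_ _ _ _ [Fs _ Zs]] := qE k kN.
  have := G_smallB Fs Zs PP; rewrite (_ : d + d = 2 * d); last ring.
  move=> [_]; congr (_ <= _); congr Ex; apply/funext => w; congr `|_|.
  by rewrite /at_path; ring.
exists Q => //.
have h k : (k < N)%N -> integ Q (fun w => Z k (fun s => B s w) - G k (fun s => B s w)) /\
    Ex Q (fun w => Z k (fun s => B s w) - G k (fun s => B s w)) - 2 * d <=
    Ex Q (fun w => v k.+1 w - Y k w).
  move=> kN; have [_ _ _ _ [_ Gs Zs]] := qE k kN.
  have [v1i Yi] := G_cexp_integ sl0 slu PQ (vY kN).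
  have [gi gE] := G_smallB Gs Zs PQ; have vYi := integB v1i Yi.
  have zgE : (fun w => Z k (fun s => B s w) - G k (fun s => B s w)) =
     fun w => (v k.+1 w - Y k w) - (at_path (G k) w - Y k w - (at_path (Z k) w - v k.+1 w)).
    by apply/funext => w; rewrite /at_path; ring.
  rewrite zgE; split; first exact: integB.
  rewrite (ExB vYi gi) -addrA gerDl subr_le0; apply: (le_trans (ler_norm _)).
  by rewrite normrN (le_trans (Ex_abs gi))// (le_trans gE)// mulr_natl mulr2n.
have QE' : Ex Q (fun w => \sum_(k < N) (Z k (fun s => B s w) - G k (fun s => B s w))) =
    \sum_(k < N) Ex Q (fun w => Z k (fun s => B s w) - G k (fun s => B s w)).
  by rewrite Ex_sum// => k; have [] := h k (ltn_ord k).
rewrite QE' in QE.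
have s1 : \sum_(k < N) Ex Q (fun w => Z k (fun s => B s w) - G k (fun s => B s w)) - N%:R * (2 * d) <=
    \sum_(k < N) Ex Q (fun w => v k.+1 w - Y k w).
  have -> : N%:R * (2 * d) = \sum_(k < N) (2 * d).
    by rewrite sumr_const card_ord mulr_natl.
  by rewrite -sumrB; apply: ler_sum => k _; have [] := h k (ltn_ord k).
have s2 : 5 * N%:R * d <= e.
  rewrite /d mulrCA ger_pMr// ler_pdivrMr ?mulr_gt0// mul1r ler_pM2l//.
  by rewrite ler_nat.
lra.
Qed.

Hypothesis ne : PG sl su !=set0.

(** Before [tau] one has [v k = Y k] off a null set, so the increments of the stopped [v] are
    [v k.+1 - Y k] on [tau > k]. Over all of [Omega] these differences sum to at least [- e] under
    [Q]; their parts on [tau <= k] have nonpositive expectation, so removing them keeps the bound.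
    At [tau], [v <= X]. *)
Lemma exists_near_optimal (e : R) : 0 < e -> exists2 tau, T0 sl su tau &
  (forall w, (tau w <= N)%N) /\ exists2 Q, PG sl su Q &
  Ex Q (v 0%N) - e <= Ex Q (fun w => X (minn (tau w) N) w).
Proof.
move=> e0; have [Q PQ Qe] := exists_near_martingale e0.
have ex n : exists D, (n < N)%N -> [/\ measurable_fun setT D, forall w, D (stop n%:R w) = D w &
    exists2 A, G_null sl su A & forall w, ~ A w -> D w = v n w - X n w].
  have [nN|] := boolP (n < N)%N; last by exists (fun=> 0).
  have [D DP] := G_approx_adapted ne (G_approxB (va (ltnW nN)) (Xa (ltnW nN))).
  by exists D.
have [D DP] := choice ex.
have Ds n : (n < N)%N -> forall w, D n (stop n%:R w) = D n w by move=> /DP[].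
have Da n : (n < N)%N -> G_approx sl su n%:R (D n).
  move=> nN; have [mD _ [A nA AD]] := DP n nN.
  apply: (G_approx_ae nA mD _ (G_approxB (va (ltnW nN)) (Xa (ltnW nN)))).
  by move=> w /AD ->.
have [A nA AD] : exists2 A, G_null sl su A & forall w, ~ A w -> forall n, (n < N)%N ->
    D n w = v n w - X n w.
  have exA n : exists A, G_null sl su A /\ forall w, ~ A w -> (n < N)%N -> D n w = v n w - X n w.
    have [nN|] := boolP (n < N)%N.
      by have [_ _ [A nA AD]] := DP n nN; exists A; split => // w /AD.
    by exists set0; split => //; split => // P _; rewrite measure0.
  have [A AP] := choice exA; exists (\bigcup_n A n).
    by apply: G_null_bigcup => n; have [] := AP n.
  move=> w nw n nN; have [_ h] := AP n; apply: h => // Anw; apply: nw.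
  by exists n.
pose tau := first_nonpos N D.
have tauT : T0 sl su tau by exact: first_nonpos_T0.
exists tau => //; split; first exact: first_nonpos_le.
exists Q => //.
have [st _] := tauT; have ev := events st; have vi := v_integ PQ.
have [mA A0] := nA.
have mt k : (k < N)%N -> measurable [set w | (tau w <= k)%N].
  by move=> _; exact: adapted_indic_measurable (let: And3 a _ _ := ev k in a).
have vXi : Ex Q (fun w => v (minn (tau w) N) w) <= Ex Q (fun w => X (minn (tau w) N) w).
  have i1 := stopped_integ mt vi; have i2 := stopped_integ mt (X_integ PQ).
  (* The inequality [v <= X] at [tau] holds only off [A]; the minimum agrees with [v] there and is
     below [X] everywhere. *)
  have i3 : integ Q (fun w => Num.min (v (minn (tau w) N) w) (X (minn (tau w) N) w)).
    apply: (@integ_le _ _ _ _ _ (fun w => `|v (minn (tau w) N) w| + `|X (minn (tau w) N) w|)).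
    - by apply: measurable_minr; [exact: (integ_measurable i1) | exact: (integ_measurable i2)].
    - move=> w; rewrite [leRHS]ger0_norm ?addr_ge0//.
      by case: (leP (v _ w)) => _; rewrite ?lerDl ?lerDr.
    - by apply: integD; exact: integ_abs.
  rewrite (@Ex_ae_eq _ _ _ _ _ _ A mA (A0 Q PQ) i1 i3); last first.
    move=> w nAw; apply/esym/min_idPl.
    rewrite (minn_idPl (first_nonpos_le N D w)).
    have := first_nonpos_le N D w; rewrite leq_eqVlt => /predU1P[->|lt]; first by rewrite vN.
    by have := first_nonposP lt; rewrite AD// subr_le0.
  by apply: Ex_le => // w; rewrite ge_min lexx orbT.
apply: le_trans vXi; rewrite (Ex_stopped mt vi) lerD2l; apply: (le_trans Qe).
apply: ler_sum => k _; have kN := ltn_ord k.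
have [_ le0 _] := Ex_indic_cexp_le0 sl0 slu PQ (vY kN) (ev k).
have [v1i Yi] := G_cexp_integ sl0 slu PQ (vY kN); have vYi := integB v1i Yi.
have mI : measurable_fun setT (\1_[set w | (tau w <= k)%N] : Omega R -> R).
  exact: measurable_indic (mt _ kN).
have mI' : measurable_fun setT (fun w => 1 - \1_[set w | (tau w <= k)%N] w : R).
  exact: measurable_funB.
have I1 w : `|1 - \1_[set w | (tau w <= k)%N] w : R| <= 1.
  by rewrite indicE; case: (w \in _); rewrite ?subrr ?subr0 ?normr0 ?normr1.
have I1' w : `|\1_[set w | (tau w <= k)%N] w : R| <= 1.
  by rewrite indicE; case: (w \in _); rewrite ?normr0 ?normr1.
have j1 := integM_bounded mI' I1 vYi; have j2 := integM_bounded mI I1' vYi.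
have vki := vi k (ltnW kN).
have -> : Ex Q (fun w => (1 - \1_[set w | (tau w <= k)%N] w) * (v k.+1 w - v k w)) =
    Ex Q (fun w => (1 - \1_[set w | (tau w <= k)%N] w) * (v k.+1 w - Y k w)).
  apply: (@Ex_ae_eq _ _ _ _ _ _ A mA (A0 Q PQ)) => //.
    by apply: (integM_bounded mI' I1); exact: integB.
  move=> w nAw; rewrite indicE; have [h|/negP h] := boolP (w \in _).
    by rewrite subrr !mul0r.
  congr (_ * (_ - _)); rewrite vmax//; apply/max_idPr.
  have kt : (k < tau w)%N by rewrite ltnNge; apply/negP => hk; apply: h; rewrite inE.
  have := lt_first_nonpos kt; rewrite AD// vmax// subr_gt0 lt_max ltxx /=.
  exact: ltW.
have -> : (fun w => v k.+1 w - Y k w) = fun w =>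
    \1_[set w | (tau w <= k)%N] w * (v k.+1 w - Y k w) +
    (1 - \1_[set w | (tau w <= k)%N] w) * (v k.+1 w - Y k w).
  by apply/funext => w; ring.
by rewrite ExD// gerDr.
Qed.

End Snell.

(** * The value of the stopping problem *)

Section DominatedStopping.
Variables (R : realType) (sl su beta : R) (X : nat -> Omega R -> R).
Hypothesis hbeta : 1 < beta.
Hypothesis mX : forall n, measurable_fun setT (X n).
Hypothesis X_sup : (Ehat sl su (fun w =>
   ereal_sup [set (`|X n w| `^ beta)%:E | n in [set: nat]]) < +oo)%E.
Variables (P : probability (Omega R) R) (PP : PG sl su P).

(** As [beta > 1], [|X n| <= 1 + |X n|^beta]. The supremum may be infinite on a null set, where
    [fine] would return 0; this is the exceptional set [A]. *)
Lemma sup_dominated : exists g, exists2 A, measurable A /\ P A = 0%E &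
  integ P g /\ forall w, ~ A w -> forall n, `|X n w| <= g w.
Proof.
pose S w := ereal_sup [set (`|X n w| `^ beta)%:E | n in [set: nat]].
have Sub n w : ((`|X n w| `^ beta)%:E <= S w)%E by apply: ereal_sup_ubound; exists n.
have S0 w : (0 <= S w)%E by apply: le_trans (Sub 0%N w); rewrite lee_fin powR_ge0.
have mS : measurable_fun setT S.
  rewrite (_ : S = fun w => esups (fun n => (`|X n w| `^ beta)%:E) 0%N).
    apply: measurable_fun_esups => n; apply/measurable_EFinP.
    by apply: (measurableT_comp (measurable_powR beta)); exact: measurableT_comp.
  apply/funext => w; rewrite /S /esups /sdrop; congr ereal_sup.
  by apply/seteqP; split => x [n _ <-]; exists n.
have Si : P.-integrable setT S.
  apply/integrableP; split => //; apply: le_lt_trans X_sup.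
  under eq_integral do rewrite gee0_abs//.
  by apply: ereal_sup_ubound; exists P.
have [A [mA A0 finA]] := integrable_ae measurableT Si.
have fSi : integ P (fine \o S).
  apply/integrableP; split; first by apply/measurable_EFinP; exact: (measurableT_comp (fine_measurable measurableT)).
  have /integrableP[_ lt] := Si; apply: le_lt_trans lt; apply: ge0_le_integral => //.
  - by apply: measurableT_comp => //; apply/measurable_EFinP; exact: (measurableT_comp (fine_measurable measurableT)).
  - exact: measurableT_comp.
  - move=> w _; rewrite /comp; have := S0 w; case: (S w) => [r| |] //= _.
    by rewrite leey.
exists (fun w => 1 + fine (S w)), A => //; split; first by apply: integD => //; exact: integ_cst.
move=> w nA n; have Sf : S w \is a fin_num.
  by apply: contrapT => h; apply: nA; apply: finA => /(_ Logic.I).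
have h : `|X n w| `^ beta <= fine (S w) by rewrite -lee_fin fineK//; exact: Sub.
have [x1|x1] := leP `|X n w| 1.
  by apply: (le_trans x1); rewrite lerDl fine_ge0.
apply: (@le_trans _ _ (`|X n w| `^ beta)); first by rewrite le1r_powR// ltW.
by apply: (le_trans h); rewrite lerDr.
Qed.

Lemma stopped_cvg (tau : Omega R -> nat) : (forall k, measurable [set w | (tau w <= k)%N]) ->
  integ P (fun w => X (tau w) w) /\
  Ex P (fun w => X (minn (tau w) N) w) @[N --> \oo] --> Ex P (fun w => X (tau w) w).
Proof.
move=> mt; have [g [A [mA A0] [gi Xg]]] := sup_dominated.
have ev w : X (minn (tau w) N) w @[N --> \oo] --> X (tau w) w.
  by apply: cvg_near_cst; exists (tau w) => // n /= h; rewrite (minn_idPl h).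
have mXn N : measurable_fun setT (fun w => X (minn (tau w) N) w).
  rewrite (_ : (fun w => _) = fun w => X 0%N w +
    \sum_(k < N) (1 - \1_[set w | (tau w <= k)%N] w) * (X k.+1 w - X k w)).
    apply: measurable_funD => //; apply: measurable_sum => k.
    by apply: measurable_funM; apply: measurable_funB => //; exact: measurable_indic.
  apply/funext => w; rewrite (telescope_min (X ^~ w)); congr (_ + _).
  apply: eq_bigr => k _; congr ((1 - _%:R) * _); congr nat_of_bool.
  by apply/idP/idP; rewrite inE.
have mXt : measurable_fun setT (fun w => X (tau w) w).
  by apply: (measurable_fun_cvg mXn) => w _; exact: ev.
have [_ i c] := @Ex_dominated_cvg _ _ _ P (fun N w => X (minn (tau w) N) w)
  (fun w => X (tau w) w) g A mXn mXt gi mA A0 (fun w _ => ev w) (fun N w nA => Xg w nA _).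
by split.
Qed.

End DominatedStopping.

(** The family [V] satisfies the recursion only quasi-surely. The versions [v] satisfy it at every
    path, and [G_cexp] is insensitive to changes on null sets. *)
Lemma horizon_data (R : realType) (sl su : R) : 0 <= sl -> sl <= su ->
  forall X V, (forall n : nat, G_approx sl su n%:R (X n)) ->
  finite_horizon_value sl su X V -> forall N, PG sl su !=set0 /\
  exists v Y, [/\ forall n : nat, (n <= N)%N -> G_approx sl su n%:R (v n),
    forall n, (n < N)%N -> G_cexp sl su n%:R (v n.+1) (Y n),
    forall n, (n < N)%N -> forall w, v n w = Num.max (X n w) (Y n w), v N = X N &
    exists2 A, G_null sl su A & forall w, ~ A w -> V N 0%N w = v 0%N w].
Proof.
move=> sl0 slu X V Xa HV N; have [qN hn] := HV N.
have [ne [AN nAN ANP]] := quasi_surelyP qN; split => //.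
have ex n : exists Y, (n < N)%N -> cond_exp sl su n%:R (V N n.+1) Y /\
    quasi_surely sl su (fun w => V N n w = Num.max (X n w) (Y w)).
  have [nN|] := boolP (n < N)%N; last by exists (fun=> 0).
  by have [Y cY qY] := hn n nN; exists Y.
have [Y YP] := choice ex.
pose v n w := if (n < N)%N then Num.max (X n w) (Y n w) else X n w.
have vmax n : (n < N)%N -> forall w, v n w = Num.max (X n w) (Y n w).
  by move=> nN w; rewrite /v nN.
have vN : v N = X N by apply/funext => w; rewrite /v ltnn.
have va n : (n <= N)%N -> G_approx sl su n%:R (v n).
  rewrite leq_eqVlt => /predU1P[->|nN]; first by rewrite vN.
  have [cY _] := YP n nN; have Ya := G_cexp_approx sl0 slu (cond_exp_G_cexp sl0 slu cY).
  rewrite (_ : v n = fun w => Num.max (X n w) (Y n w)); first exact: G_approx_max.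
  by apply/funext => w; rewrite vmax.
have vV n : (n <= N)%N -> exists2 A, G_null sl su A & forall w, ~ A w -> V N n w = v n w.
  rewrite leq_eqVlt => /predU1P[->|nN]; first by exists AN => //; rewrite vN.
  have [_ /quasi_surelyP[_ [A nA AP]]] := YP n nN; exists A => // w /AP ->.
  by rewrite vmax.
exists v, Y; split => //; last exact: vV.
move=> n nN; have [cY _] := YP n nN; have [A nA AP] := vV n.+1 nN.
by apply: (G_cexp_ae sl0 slu nA _ AP (cond_exp_G_cexp sl0 slu cY)); have [] := va n.+1 nN.
Qed.

Theorem proposition3p7 (R : realType) (sl su : R) (hsl : 0 <= sl)
  (hsu : sl <= su) (beta : R) (hbeta : 1 < beta)
  (X : nat -> Omega R -> R)
  (X_bounded_below : forall n, exists c : R,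
     quasi_surely sl su (fun w => c <= X n w))
  (X_LG : forall n, LG sl su beta n%:R (X n))
  (X_sup : (Ehat sl su (fun w =>
     ereal_sup [set (`|X n w| `^ beta)%:E | n in [set: nat]]) < +oo)%E)
  (V : nat -> nat -> Omega R -> R)
  (HV : finite_horizon_value sl su X V) :
  quasi_surely sl su (fun w => (V N 0%N w)%:E @[N --> \oo] --> V0 sl su X).
Proof.
have Xa n : G_approx sl su n%:R (X n) by exact: LG_approx (ltW hbeta) (X_LG n).
have mX n : measurable_fun setT (X n) by have [] := Xa n.
have data := horizon_data hsl hsu Xa HV.
have [ne _] := data 0%N.
(* The value at time 0 is quasi-surely a constant, lying between all stopped expectations with
   horizon [N] and the value of the full problem. What remains is the convergence of a real
   sequence. *)
have exc N : exists cA : R * set (Omega R), [/\ G_null sl su cA.2,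
    forall w, ~ cA.2 w -> V N 0%N w = cA.1,
    forall P tau, PG sl su P -> G_stopping_time sl su (fun w => (tau w)%:R) ->
      Ex P (fun w => X (minn (tau w) N) w) <= cA.1 & (cA.1%:E <= V0 sl su X)%E].
  have [_ [v [Y [va vY vmax vN [A nA AV]]]]] := data N.
  have [c [A' nA' A'c]] := G_approx0_cst ne (va 0%N (leq0n N)).
  have Exv P : PG sl su P -> Ex P (v 0%N) = c.
    move=> PP; rewrite -(Ex_cst P c); have [mA' A'0] := nA'.
    apply: (Ex_ae_eq mA' (A'0 P PP) (G_approx_integ PP (va _ (leq0n N))) (integ_cst P c)).
    exact: A'c.
  exists (c, A `|` A'); split => /=.
  - exact: G_nullU.
  - by move=> w /not_orP[/AV -> /A'c].
  - move=> P tau PP st; rewrite -(Exv P PP).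
    by apply: (Ex_stopped_le hsl hsu va _ vY vmax vN PP st) => n _; exact: Xa.
  - apply/lee_addgt0Pr => e e0.
    have [tau tauT [tauN [Q PQ QE]]] := exists_near_optimal hsl hsu va (fun n _ => Xa n) vY vmax vN ne e0.
    rewrite (Exv Q PQ) in QE.
    have [st _] := tauT.
    have mt k : measurable [set w | (tau w <= k)%N].
      have [_ /(_ k%:R (ler0n _ _))[aA _ _]] := st.
      have := adapted_indic_measurable aA; congr measurable.
      by apply/seteqP; split => w /=; rewrite ler_nat.
    have [Xi _] := stopped_cvg hbeta mX X_sup PQ mt.
    apply: (@le_trans _ _ ((Ex Q (fun w => X (tau w) w))%:E + e%:E)%E).
      rewrite -EFinD lee_fin -lerBlDr; apply: (le_trans QE).
      rewrite le_eqVlt; apply/orP; left; apply/eqP; congr Ex; apply/funext => w.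
      by rewrite (minn_idPl (tauN w)).
    rewrite leeD2r// -Ex_EFin//.
    apply: (@le_trans _ _ (Ehat sl su (fun w => (X (tau w) w)%:E))).
      by apply: ereal_sup_ubound; exists Q.
    by apply: ereal_sup_ubound; exists tau.
have [cA cAP] := choice exc.
pose c N := (cA N).1.
apply: (@G_null_quasi_surely _ _ _ _ (\bigcup_N (cA N).2)) => //.
  by apply: G_null_bigcup => N; have [] := cAP N.
move=> w nw.
have -> : (fun N => (V N 0%N w)%:E) = fun N => (c N)%:E.
  apply/funext => N; have [_ h _ _] := cAP N; rewrite h// => hw; apply: nw.
  by exists N.
have cV N : ((c N)%:E <= V0 sl su X)%E by have [] := cAP N.
(* A stopping time and a measure whose payoff exceeds [a] keep a payoff above [a] after truncation
   at a large [N], by dominated convergence. *)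
have low (a : R) : (a%:E < V0 sl su X)%E -> \forall N \near \oo, a <= c N.
  move=> /ereal_sup_gt[_ [tau [st _] <-]] /ereal_sup_gt[_ [P PP <-]] aE.
  have mt k : measurable [set w | (tau w <= k)%N].
    have [_ /(_ k%:R (ler0n _ _))[aA _ _]] := st.
    have := adapted_indic_measurable aA; congr measurable.
    by apply/seteqP; split => w' /=; rewrite ler_nat.
  have [Xi cv] := stopped_cvg hbeta mX X_sup PP mt.
  rewrite Ex_EFin// lte_fin in aE.
  apply: filterS (cvgr_ge _ cv _ aE) => N h; apply: (le_trans h).
  by have [_ _ h2 _] := cAP N; exact: h2.
case E : (V0 sl su X) => [r| |].
- apply: cvg_EFin; first exact: nearW.
  apply/cvgrPdist_le => e e0.
  have : ((r - e)%:E < V0 sl su X)%E by rewrite E lte_fin ltrBlDr ltrDl.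
  move=> /low; apply: filterS => N h /=.
  have := cV N; rewrite E lee_fin => h2.
  by rewrite ger0_norm ?subr_ge0// lerBlDr -lerBlDl.
- apply/cvgeyPge => a; have : (a%:E < V0 sl su X)%E by rewrite E ltry.
  by move=> /low; apply: filterS => N h; rewrite lee_fin.
- by have := cV 0%N; rewrite E leeNy_eq.
Qed.
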